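(* Let $\Omega \subset \mathbb{C}^n$ be a bounded pseudoconvex domain with $C^2$-boundary, and let $g$ be a complete Kähler metric on $\Omega$ of $C^1$-bounded geometry. Suppose there exist a compact subset $K \subset\subset \Omega$ and constants $C_2 \geq C_1 > 0$ such that $$-C_1 g \geq \operatorname{Ric}(g) \geq -C_2 g \quad \text{in } \Omega \setminus K.$$ If $g$ is a Kähler-Ricci soliton with a real holomorphic vector field $X$ such that the dual $1$-form $X^{\flat}$ of $X$ with respect to $g$ is closed, then $g$ is Kähler-Einstein.
   Context: For a Kähler metric $g = g_{i\bar j}\,dz^i d\bar z^j$, the Ricci curvature is $\operatorname{Ric}(g) = R_{i\bar j}\,dz^i d\bar z^j$ with $R_{i\bar j} = -\partial_i\partial_{\bar j}\log\det(g_{k\bar l})$. The metric $g$ is Kähler-Einstein if $\operatorname{Ric}(g)=\lambda g$ for some $\lambda\in\mathbb{R}$. A real vector field $X$ is real holomorphic if its $(1,0)$-part is a holomorphic vector field, i.e. $X = X^i\partial_i + \overline{X^i}\,\partial_{\bar i}$ with $X^i$ holomorphic. The metric $g$ is a Kähler-Ricci soliton with the real holomorphic vector field $X$ if there is a constant $\lambda\in\mathbb{R}$ with $$\operatorname{Ric}(g)+\mathcal{L}_X g=\lambda g,$$ where $\mathcal{L}_X$ is the Lie derivative. In local coordinates this reads $R_{i\bar j}+\nabla_i X_{\bar j}+\nabla_{\bar j}X_i=\lambda g_{i\bar j}$, where $X_{\bar j}=g_{k\bar j}X^k$, $X_i = g_{i\bar l}\overline{X^l}$ and $\nabla$ is the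 Levi-Civita connection. The dual $1$-form of $X$ is $X^{\flat}=g(X,\cdot)$. A complete Kähler metric $g$ on $M$ has $C^k$-bounded geometry if for each integer $0\le l\le k$ there is a constant $C_l>0$ with $\sup_M|\nabla^l \operatorname{Rm}|\le C_l$, where $\operatorname{Rm}$ is the Riemann curvature tensor, and moreover $(M,g)$ has positive injectivity radius. *)

(* Defs.v *)
From HB Require Import structures.
From mathcomp Require Import all_boot all_order all_algebra.
From mathcomp Require Import all_classical all_reals all_analysis.
From mathcomp Require Import complex.

Set Implicit Arguments.
Unset Strict Implicit.
Unset Printing Implicit Defensive.

Import Order.TTheory GRing.Theory Num.Theory.
Import numFieldNormedType.Exports.

Local Open Scope classical_set_scope.
Local Open Scope ring_scope.
Local Open Scope complex_scope.

(* Makes the generic topology of a numFieldType available on R[i]. *)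
HB.instance Definition _ (R : realType) := PseudoPointedMetric.copy R[i] R[i]^o.

(* The ambient space C^n is 'rV[R[i]]_n with the library topology.  Its real
   tangent spaces are identified with C^n by u |-> u^i d_i + conj(u^i) d_ibar.
   The library differential calculus on C^n is over the field R[i], i.e.
   holomorphic, so real differentiation goes through real curves t |-> z + t v. *)

Section RealCalculus.
Context {R : realType} {n : nat}.
Local Notation V := 'rV[R[i]]_n.

Definition real_line (z v : V) (t : R) : V := z + t%:C *: v.

Definition dirderivable (v : V) (f : V -> R) (z : V) : Prop :=
  derivable (fun t : R => f (real_line z v t)) 0 1.

Definition dirD (v : V) (f : V -> R) (z : V) : R :=
  derive1 (fun t : R => f (real_line z v t)) 0.

Definition dirDC (v : V) (f : V -> R[i]) (z : V) : R[i] :=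
  dirD v (fun y => complex.Re (f y)) z +i* dirD v (fun y => complex.Im (f y)) z.

Definition dirDV (v : V) (X : V -> V) (z : V) : V :=
  \row_j dirDC v (fun y => X y 0 j) z.

(* The real frame d/dx_1, ..., d/dx_n, d/dy_1, ..., d/dy_n and its
   coordinates, for z_j = x_j + i y_j. *)
Definition frame (a : 'I_(n + n)) : V :=
  match fintype.split a with
  | inl j => delta_mx 0 j
  | inr j => 'i *: delta_mx 0 j
  end.

Definition rcoord (v : V) (a : 'I_(n + n)) : R :=
  match fintype.split a with
  | inl j => complex.Re (v 0 j)
  | inr j => complex.Im (v 0 j)
  end.

Definition pd (a : 'I_(n + n)) (f : V -> R) : V -> R := dirD (frame a) f.

Fixpoint Ck (k : nat) (U : set V) (f : V -> R) : Prop :=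
  (forall z, U z -> {for z, continuous f}) /\
  match k with
  | 0%N => True
  | k'.+1 => forall a, (forall z, U z -> dirderivable (frame a) f z) /\
                       Ck k' U (pd a f)
  end.

Definition smooth (U : set V) (f : V -> R) : Prop := forall k, Ck k U f.

Definition smoothC (U : set V) (f : V -> R[i]) : Prop :=
  smooth U (fun z => complex.Re (f z)) /\ smooth U (fun z => complex.Im (f z)).

Definition smooth_map (U : set V) (F : V -> V) : Prop :=
  forall j, smoothC U (fun z => F z 0 j).

Definition diffeo_onto_image (U : set V) (F : V -> V) : Prop :=
  [/\ smooth_map U F, open (F @` U) &
    exists G : V -> V, smooth_map (F @` U) G /\ (forall v, U v -> G (F v) = v)].

(* Wirtinger derivatives d/dz_i and d/dzbar_i. *)
Definition dz (i : 'I_n) (f : V -> R[i]) (z : V) : R[i] :=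
  2^-1 * (dirDC (delta_mx 0 i) f z - 'i * dirDC ('i *: delta_mx 0 i) f z).

Definition dzbar (i : 'I_n) (f : V -> R[i]) (z : V) : R[i] :=
  2^-1 * (dirDC (delta_mx 0 i) f z + 'i * dirDC ('i *: delta_mx 0 i) f z).

Definition curve_coord (gam : R -> V) (a : 'I_(n + n)) (t : R) : R :=
  rcoord (gam t) a.

Definition velocity (gam : R -> V) (t : R) : V :=
  \sum_a (derive1 (curve_coord gam a) t)%:C *: frame a.

End RealCalculus.

Section Domains.
Context {R : realType} {n : nat}.
Local Notation V := 'rV[R[i]]_n.

Definition domain (Om : set V) : Prop := [/\ Om !=set0, open Om & connected Om].

(* Sub-mean value property on every closed complex disc inside Om. *)
Definition continuous_psh (Om : set V) (u : V -> R) : Prop :=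
  (forall z, Om z -> {for z, continuous u}) /\
  forall z w : V, (forall c : R[i], `|c| <= 1 -> Om (z + c *: w)) ->
    u z <= (2 * pi)^-1 *
      \int[lebesgue_measure]_(t in `[0, 2 * pi]) u (z + (cos t +i* sin t) *: w).

(* Existence of a continuous plurisubharmonic exhaustion function; this
   requires no boundary regularity. *)
Definition pseudoconvex (Om : set V) : Prop :=
  exists u : V -> R, continuous_psh Om u /\
    forall c : R, exists K : set V,
      [/\ compact K, K `<=` Om & [set z | Om z /\ u z < c] `<=` K].

Definition C2_boundary (Om : set V) : Prop :=
  forall p, (closure Om `\` Om) p ->
    exists (U : set V) (rho : V -> R),
      [/\ open U, U p, Ck 2 U rho, (exists a, pd a rho p != 0) &
          forall z, U z -> (Om z <-> rho z < 0)].

End Domains.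

Section RiemannianGeometry.
Context {R : realType} {n : nat}.
Local Notation V := 'rV[R[i]]_n.
Local Notation m := (n + n)%N.

(* G z u v is the value at z of a real covariant 2-tensor on tangent vectors u, v. *)
Implicit Types (G : V -> V -> V -> R) (Om : set V).

Definition gram G (z : V) : 'M[R]_m := \matrix_(a, b) G z (frame a) (frame b).

Definition gram_inv G (z : V) : 'M[R]_m := invmx (gram G z).

Definition tcomp G (a b : 'I_m) (z : V) : R := G z (frame a) (frame b).

(* christoffel G c a b is Gamma^c_{ab} of the Levi-Civita connection. *)
Definition christoffel G (c a b : 'I_m) (z : V) : R :=
  2^-1 * \sum_d gram_inv G z c d *
    (pd a (tcomp G d b) z + pd b (tcomp G d a) z - pd d (tcomp G a b) z).

(* riem_up G e a b c is the component along frame e of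
   R(d_a, d_b) d_c = nabla_a nabla_b d_c - nabla_b nabla_a d_c. *)
Definition riem_up G (e a b c : 'I_m) (z : V) : R :=
  pd a (christoffel G e b c) z - pd b (christoffel G e a c) z +
  \sum_f (christoffel G e a f z * christoffel G f b c z
        - christoffel G e b f z * christoffel G f a c z).

(* Components, in the real frame, of covariant k-tensors. *)
Definition tensor (k : nat) := k.-tuple 'I_m -> V -> R.

Definition riem G : tensor 4 := fun i z =>
  \sum_e tcomp G (tnth i 3) e z *
    riem_up G e (tnth i 0) (tnth i 1) (tnth i 2) z.

Definition nabla G k (T : tensor k) : tensor k.+1 := fun i z =>
  let a := thead i in
  let j := [tuple of behead i] in
  pd a (T j) z -
  \sum_(s < k) \sum_c christoffel G c a (tnth j s) z *
     T [tuple if r == s then c else tnth j r | r < k] z.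

Fixpoint nabla_riem G (l : nat) : tensor (l + 4) :=
  match l return tensor (l + 4) with
  | 0%N => riem G
  | l'.+1 => nabla G (@nabla_riem G l')
  end.

Definition tensor_norm G k (T : tensor k) (z : V) : R :=
  Num.sqrt (\sum_(i : k.-tuple 'I_m) \sum_(j : k.-tuple 'I_m)
    (\prod_(s < k) gram_inv G z (tnth i s) (tnth j s)) * (T i z * T j z)).

(* C^1 curves give the same infimum of lengths as piecewise C^1 ones, since
   velocities may vanish. *)
Definition C1_path Om (p q : V) (gam : R -> V) : Prop :=
  [/\ forall a, (forall t, derivable (curve_coord gam a) t 1) /\
                continuous (derive1 (curve_coord gam a) : R -> R),
      forall t, 0 <= t <= 1 -> Om (gam t), gam 0 = p & gam 1 = q].

Definition path_length G (gam : R -> V) : \bar R :=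
  (\int[lebesgue_measure]_(t in `[0%R, 1%R])
     (Num.sqrt (G (gam t) (velocity gam t) (velocity gam t)))%:E)%E.

Definition riem_dist G Om (p q : V) : \bar R :=
  ereal_inf [set path_length G gam | gam in C1_path Om p q].

Definition complete_metric G Om : Prop :=
  forall u : nat -> V, (forall k, Om (u k)) ->
    (forall e : R, 0 < e -> exists N : nat, forall k l : nat,
       (N <= k)%N -> (N <= l)%N -> (riem_dist G Om (u k) (u l) < e%:E)%E) ->
    exists2 p, Om p & forall e : R, 0 < e -> exists N : nat, forall k : nat,
       (N <= k)%N -> (riem_dist G Om (u k) p < e%:E)%E.

Definition geodesic_on G Om (J : set R) (gam : R -> V) : Prop :=
  forall t, J t ->
    [/\ Om (gam t),
        forall a, derivable (curve_coord gam a) t 1 /\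
                  derivable (derive1 (curve_coord gam a) : R -> R) t 1 &
        forall c, derive1n 2 (curve_coord gam c) t +
          \sum_a \sum_b christoffel G c a b (gam t) *
            (derive1 (curve_coord gam a) t * derive1 (curve_coord gam b) t) = 0].

Definition exp_graph G Om (p v q : V) : Prop :=
  exists (gam : R -> V) (e : R),
    [/\ 0 < e, geodesic_on G Om `](- e), (1 + e)[ gam,
        gam 0 = p, velocity gam 0 = v & gam 1 = q].

(* Junk value 0 when the geodesic with initial velocity v does not reach time 1. *)
Definition riem_exp G Om (p v : V) : V := xget 0 (exp_graph G Om p v).

Definition tangent_ball G (p : V) (r : R) : set V := [set v | G p v v < r ^+ 2].

Definition inj_radius_at G Om (p : V) : \bar R :=
  ereal_sup [set r%:E | r in [set r : R |
    [/\ 0 < r,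
        forall v, tangent_ball G p r v -> exists q, exp_graph G Om p v q &
        diffeo_onto_image (tangent_ball G p r) (riem_exp G Om p)]]].

Definition inj_radius G Om : \bar R := ereal_inf [set inj_radius_at G Om p | p in Om].

Definition bounded_geometry (k : nat) G Om : Prop :=
  (forall l : nat, (l <= k)%N -> exists2 C : R, 0 < C &
     forall z, Om z -> tensor_norm G (@nabla_riem G l) z <= C) /\
  (0 < inj_radius G Om)%E.

(* Lie derivative evaluated on constant vector fields u, v, for which
   [X, u] = - D_u X. *)
Definition lie_derivative (X : V -> V) G : V -> V -> V -> R := fun z u v =>
  dirD (X z) (fun y => G y u v) z + G z (dirDV u X z) v + G z u (dirDV v X z).

Definition flat G (X : V -> V) (z u : V) : R := G z (X z) u.

(* d alpha evaluated on constant vector fields. *)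
Definition closed_1form Om (al : V -> V -> R) : Prop :=
  forall z, Om z -> forall u v,
    dirD u (fun y => al y v) z - dirD v (fun y => al y u) z = 0.

Definition closed_2form Om (om : V -> V -> V -> R) : Prop :=
  forall z, Om z -> forall u v w,
    dirD u (fun y => om y v w) z + dirD v (fun y => om y w u) z
    + dirD w (fun y => om y u v) z = 0.

End RiemannianGeometry.

Section KaehlerGeometry.
Context {R : realType} {n : nat}.
Local Notation V := 'rV[R[i]]_n.

(* The real symmetric tensor h_{i jbar} (dz^i (x) dzbar^j + dzbar^j (x) dz^i)
   of a Hermitian matrix field h, so that its value on (d_i, d_jbar) is
   h_{i jbar}. *)
Definition realform (h : V -> 'M[R[i]]_n) (z u v : V) : R :=
  2 * complex.Re (\sum_i \sum_j h z i j * u 0 i * (v 0 j)^*).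

Definition kaehler_form (g : V -> 'M[R[i]]_n) (z u v : V) : R :=
  realform g z ('i *: u) v.

Definition kaehler_metric (Om : set V) (g : V -> 'M[R[i]]_n) : Prop :=
  [/\ forall i j, smoothC Om (fun z => g z i j),
      forall z, Om z -> forall i j, g z j i = (g z i j)^*,
      forall z, Om z -> forall u, u != 0 -> 0 < realform g z u u &
      closed_2form Om (kaehler_form g)].

Definition ricci (g : V -> 'M[R[i]]_n) (z : V) : 'M[R[i]]_n :=
  \matrix_(i, j) - dz i (dzbar j (fun y => (ln (complex.Re (\det (g y))))%:C)) z.

Definition kaehler_einstein (Om : set V) (g : V -> 'M[R[i]]_n) : Prop :=
  exists lam : R, forall z, Om z -> ricci g z = lam%:C *: g z.

(* X is given by its components X^i.  Differentiability is over R[i], hence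
   complex. *)
Definition real_holomorphic (Om : set V) (X : V -> V) : Prop :=
  forall z, Om z -> differentiable X z.

Definition kaehler_ricci_soliton (Om : set V) (g : V -> 'M[R[i]]_n)
    (X : V -> V) : Prop :=
  exists lam : R, forall z, Om z -> forall u v,
    realform (ricci g) z u v + lie_derivative X (realform g) z u v
    = lam * realform g z u v.

End KaehlerGeometry.

(* Main.v *)
(* The field [X] vanishes, so that the soliton equation reduces to Ric(g) = lam g.
   Since [X] is holomorphic and its dual form is closed, nabla X is symmetric; hence JX is a
   Killing field and the soliton equation at (X, X) reads
   d|X|^2(X) = lam |X|^2 - Ric(X, X).  As Ric is bounded outside a compact set, this gives
   |d|X|^2(zeta X)| <= c |Re zeta| (1 + |X|^2), so |X| stays bounded along the motion in the
   direction zeta X during a bounded time, and by completeness such a motion never leaves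
   [Om].  A flow in complex time is thus expected to exist for all times; its orbits would be
   bounded entire curves, which are constant.  Flows are avoided by means of Euler polygons
   F_(k+1)(zeta) = F_k(zeta) + h_k zeta X(F_k(zeta)) with F_0 = p, which are holomorphic in
   zeta by construction and satisfy F_k'(0) = (h_0 + ... + h_(k-1)) X(p).  With the steps
   chosen as large as possible, completeness forces the sum of the h_k to diverge, while
   the Cauchy estimate bounds F_k'(0) because [Om] is bounded; so X(p) = 0. *)

Require Import Defs.
From mathcomp Require Import all_boot all_order all_algebra.
From mathcomp Require Import all_classical all_reals all_analysis.
From mathcomp Require Import complex ring lra measurable_realfun.

Set Implicit Arguments.
Unset Strict Implicit.
Unset Printing Implicit Defensive.

Import Order.TTheory GRing.Theory Num.Theory.
Import numFieldNormedType.Exports.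

Local Open Scope classical_set_scope.
Local Open Scope ring_scope.
Local Open Scope complex_scope.

(** * Real-valued norms *)

(** Complex time is essential: a bounded real trajectory is no contradiction, a bounded entire curve
    is. The imaginary direction costs nothing, since the derivative of |X|^2 along JX vanishes and
    only Re zeta enters the growth bound. Polygons replace exact laws by inequalities with slack: an
    edge keeps the direction zeta X(z) of its starting point, and the growth rate is enlarged to
    absorb the resulting error. The delicate point is the divergence of the sum of the h_k. Were it
    finite, the points F_k(zeta) would be Cauchy for the Riemannian distance, with a limit in [Om].
    Near each limit one step size is admissible, and compactness of the parameter square makes it
    uniform in zeta and in all late k; maximality then bounds h_k from below. Passing from
    Riemannian to Euclidean closeness needs a cutoff function integrated along curves. The Cauchy
    estimate serves twice: for the polygons, and to bound the derivative of X locally. It comes from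
    Goursat's subdivision in the logarithmic coordinate, where circles become vertical sides of a
    rectangle. *)

Section L1.
Context {R : realType}.

(* The library norms on [R[i]] and on C^n are [R[i]]-valued; [nm] and [nrm] are equivalent
   norms with values in [R]. *)
Definition nm (z : R[i]) : R := `|complex.Re z| + `|complex.Im z|.

Lemma cReD (x y : R[i]) : complex.Re (x + y) = complex.Re x + complex.Re y.
Proof. by case: x => a b; case: y. Qed.
Lemma cImD (x y : R[i]) : complex.Im (x + y) = complex.Im x + complex.Im y.
Proof. by case: x => a b; case: y. Qed.
Lemma cReN (x : R[i]) : complex.Re (- x) = - complex.Re x.
Proof. by case: x. Qed.
Lemma cImN (x : R[i]) : complex.Im (- x) = - complex.Im x.
Proof. by case: x. Qed.
Lemma cReM (x y : R[i]) : complex.Re (x * y) =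
  complex.Re x * complex.Re y - complex.Im x * complex.Im y.
Proof. by case: x => a b; case: y. Qed.
Lemma cImM (x y : R[i]) : complex.Im (x * y) =
  complex.Re x * complex.Im y + complex.Im x * complex.Re y.
Proof. by case: x => a b; case: y. Qed.

Lemma nm_ge0 z : 0 <= nm z. Proof. by rewrite addr_ge0. Qed.
Lemma nm0 : nm 0 = 0. Proof. by rewrite /nm /= !normr0 addr0. Qed.
Lemma nm_eq0 z : nm z <= 0 -> z = 0.
Proof.
case: z => a b; rewrite /nm /= => h.
have := normr_ge0 a; have := normr_ge0 b => hb ha.
have /eqP : `|a| = 0 by lra.
have /eqP : `|b| = 0 by lra.
by rewrite !normr_eq0 => /eqP -> /eqP ->.
Qed.
Lemma nmD x y : nm (x + y) <= nm x + nm y.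
Proof.
rewrite /nm cReD cImD.
have := ler_normD (complex.Re x) (complex.Re y).
have := ler_normD (complex.Im x) (complex.Im y).
lra.
Qed.
Lemma nmN x : nm (- x) = nm x.
Proof. by rewrite /nm cReN cImN !normrN. Qed.
Lemma nmB x y : nm (x - y) <= nm x + nm y.
Proof. by rewrite -(nmN y) nmD. Qed.
Lemma nmM x y : nm (x * y) <= nm x * nm y.
Proof.
rewrite /nm cReM cImM.
have := ler_normB (complex.Re x * complex.Re y) (complex.Im x * complex.Im y).
have := ler_normD (complex.Re x * complex.Im y) (complex.Im x * complex.Re y).
rewrite !normrM; lra.
Qed.
Lemma nmMr (t : R) x : nm (t%:C * x) = `|t| * nm x.
Proof. by rewrite /nm cReM cImM /= !mul0r subr0 addr0 !normrM mulrDr. Qed.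
Lemma nm_i x : nm ('i * x) = nm x.
Proof. by rewrite /nm cReM cImM /= !mul0r !mul1r sub0r add0r normrN addrC. Qed.
Lemma ReZ_le x : `|complex.Re x| <= nm x. Proof. by rewrite lerDl. Qed.
Lemma ImZ_le x : `|complex.Im x| <= nm x. Proof. by rewrite lerDr. Qed.

Lemma nm_conj (x : R[i]) : nm x^* = nm x.
Proof. by case: x => a b; rewrite /nm /= normrN. Qed.
Lemma nm_sum (I : finType) (F : I -> R[i]) : nm (\sum_i F i) <= \sum_i nm (F i).
Proof.
elim/big_ind2 : _ => [|x1 x2 y1 y2 h1 h2|//]; first by rewrite nm0.
by apply: le_trans (nmD _ _) _; rewrite lerD.
Qed.

Lemma normc_nm (x : R[i]) : `|x| <= (nm x)%:C.
Proof.
rewrite normc_def lecR -[leRHS]ger0_norm ?nm_ge0 // -sqrtr_sqr ler_sqrt ?sqr_ge0 //.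
rewrite /nm -(normr_id (complex.Re x)) -[complex.Re x ^+ 2]real_normK ?num_real //.
rewrite -[complex.Im x ^+ 2]real_normK ?num_real // normr_id.
have := normr_ge0 (complex.Re x); have := normr_ge0 (complex.Im x).
set a := `|_|; set b := `|_|; nra.
Qed.

Lemma nm_normc (x : R[i]) : (nm x)%:C <= 2 * `|x|.
Proof.
have -> : (2 : R[i]) = (2 : R)%:C by rewrite rmorph_nat.
rewrite normc_def -rmorphM lecR /nm mulr_natl mulr2n.
by rewrite lerD // -sqrtr_sqr ler_sqrt ?addr_ge0 ?sqr_ge0 // ?lerDl ?lerDr ?sqr_ge0.
Qed.

Lemma posC (e : R[i]) : 0 < e -> e = (complex.Re e)%:C /\ 0 < complex.Re e.
Proof. by case: e => a b; rewrite ltcE /= => /andP[/eqP -> ->]. Qed.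

Section Rows.
Context {n : nat}.
Local Notation V := 'rV[R[i]]_n.

Definition nrm (v : V) : R := \sum_j nm (v 0 j).

Lemma nrm_ge0 v : 0 <= nrm v. Proof. by apply: sumr_ge0 => j _; exact: nm_ge0. Qed.
Lemma nrm0 : nrm 0 = 0. Proof. by apply: big1 => j _; rewrite mxE nm0. Qed.
Lemma nm_le_nrm (v : V) j : nm (v 0 j) <= nrm v.
Proof. by rewrite /nrm (bigD1 j) //= lerDl sumr_ge0 // => k _; exact: nm_ge0. Qed.
Lemma nrmD u v : nrm (u + v) <= nrm u + nrm v.
Proof. by rewrite /nrm -big_split ler_sum // => j _; rewrite mxE nmD. Qed.
Lemma nrmN v : nrm (- v) = nrm v.
Proof. by apply: eq_bigr => j _; rewrite mxE nmN. Qed.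
Lemma nrmBC u v : nrm (u - v) = nrm (v - u).
Proof. by rewrite -nrmN opprB. Qed.
Lemma nrmZ c v : nrm (c *: v) <= nm c * nrm v.
Proof. by rewrite /nrm mulr_sumr ler_sum // => j _; rewrite mxE nmM. Qed.
Lemma nrmZr (t : R) v : nrm (t%:C *: v) = `|t| * nrm v.
Proof. by rewrite /nrm mulr_sumr; apply: eq_bigr => j _; rewrite mxE nmMr. Qed.
Lemma nrm_triangle (v u w : V) : nrm (u - w) <= nrm (u - v) + nrm (v - w).
Proof. by rewrite -[X in nrm X <= _](subrKA v) nrmD. Qed.
Lemma nrm_sum (I : finType) (F : I -> V) : nrm (\sum_i F i) <= \sum_i nrm (F i).
Proof.
elim/big_ind2 : _ => [|x1 x2 y1 y2 h1 h2|//]; first by rewrite nrm0.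
by apply: le_trans (nrmD _ _) _; rewrite lerD.
Qed.
Lemma linear_nrm_bound (L : {linear V -> V}) (B : R) :
  (forall i, nrm (L (delta_mx 0 i)) <= B) -> forall v, nrm (L v) <= B * nrm v.
Proof.
move=> LB v; rewrite {1}(row_sum_delta v) linear_sum /=.
apply: le_trans (nrm_sum _) _; rewrite [nrm v]/nrm mulr_sumr; apply: ler_sum => i _.
rewrite linearZ /=; apply: le_trans (nrmZ _ _) _.
by rewrite mulrC ler_wpM2r ?nm_ge0.
Qed.
Lemma nrm_eq0 v : nrm v <= 0 -> v = 0.
Proof.
by move=> h; apply/rowP => j; rewrite mxE; apply: nm_eq0; apply: le_trans h; exact: nm_le_nrm.
Qed.

Lemma nbhs_nrm (z : V) (A : set V) :
  nbhs z A <-> exists2 e : R, 0 < e & forall y, nrm (y - z) < e -> A y.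
Proof.
split=> [/nbhs_ballP[e /= e0 eA]|[e e0 eA]].
  have [eE re0] := posC e0.
  exists (complex.Re e) => // y yz; apply: eA; split=> // i j.
  rewrite /ball /= /ball_ distrC ord1 eE.
  apply: (le_lt_trans (normc_nm _)); rewrite ltcR.
  apply: le_lt_trans yz; have := nm_le_nrm (y - z) j; by rewrite !mxE.
apply/nbhs_ballP.
(* The factor 2 pays for [nm_normc]; [n.+1] instead of [n] covers [n = 0] and makes the sum of [n]
   terms [e / n.+1] strictly smaller than [e]. *)
have n0 : 0 < (n.+1%:R * 2 : R) by rewrite mulr_gt0.
exists (e / (n.+1%:R * 2))%:C => /=; first by rewrite ltcR divr_gt0.
move=> y [_ yb]; apply: eA; rewrite /nrm.
have key j : nm ((y - z) 0 j) <= e / n.+1%:R.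
  rewrite -lecR; apply: le_trans (nm_normc _) _.
  have := yb 0 j; rewrite /ball /= /ball_ distrC !mxE => /ltW h.
  have -> : (e / n.+1%:R)%:C = 2 * (e / (n.+1%:R * 2))%:C.
    have -> : (2 : R[i]) = (2 : R)%:C by rewrite rmorph_nat.
    rewrite -rmorphM; congr (real_complex _ _).
    have : (n.+1%:R : R) != 0 by rewrite pnatr_eq0.
    by move: (n.+1%:R : R) => N N0; field.
  by rewrite ler_pM2l.
apply: (@le_lt_trans _ _ (\sum_(j < n) e / n.+1%:R)); first by apply: ler_sum => j _; apply: key.
rewrite sumr_const card_ord -[X in X < _]mulr_natr mulrAC ltr_pdivrMr ?ltr0n //.
by rewrite ltr_pM2l // ltr_nat.
Qed.

End Rows.
End L1.

(** * Goursat's lemma and the Cauchy estimate *)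

Section Goursat.
Context {R : realType}.
Implicit Types a b c d s t : R.

Lemma nested_intervals (u l : nat -> R) :
  (forall k, u k <= u k.+1) -> (forall k, u k.+1 + l k.+1 <= u k + l k) ->
  (forall k, 0 <= l k) -> exists x, forall k, u k <= x <= u k + l k.
Proof.
move=> hu hl l0.
have mono : {homo u : i j / (i <= j)%N >-> i <= j}.
  by apply: homo_leq => //; exact: le_trans.
have mono' : {homo (fun k => u k + l k) : i j / (i <= j)%N >-> j <= i}.
  by apply: homo_leq => // x y z h1 h2; exact: le_trans h2 h1.
have ub k j : u j <= u k + l k.
  case: (leqP j k) => jk.
    by apply: (le_trans (mono _ _ jk)); rewrite lerDl.
  by apply: le_trans (mono' _ _ (ltnW jk)); rewrite lerDl.
exists (sup (range u)) => k; apply/andP; split.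
  apply: ub_le_sup; last by exists k.
  by exists (u 0%N + l 0%N) => _ [j _ <-].
by apply: ge_sup; [exists (u 0%N), 0%N | move=> _ [j _ <-]].
Qed.

(** The bookkeeping of Goursat's subdivision, kept apart from any integral: [P k a c] is meant to
    say that the rectangle with lower left corner (a, c) and sides [L / 2 ^+ k], [H / 2 ^+ k] is
    bad. The common point comes from nested intervals in each coordinate. *)
Lemma quadrisection (P : nat -> R -> R -> Prop) (a0 c0 L H : R) :
  0 <= L -> 0 <= H -> P 0%N a0 c0 ->
  (forall k a c, P k a c -> exists a' c', P k.+1 a' c' /\
     (a' = a \/ a' = a + L / 2 ^+ k.+1) /\ (c' = c \/ c' = c + H / 2 ^+ k.+1)) ->
  exists s t, forall k, exists a c, [/\ P k a c,
     a0 <= a /\ a + L / 2 ^+ k <= a0 + L, c0 <= c /\ c + H / 2 ^+ k <= c0 + H,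
     a <= s <= a + L / 2 ^+ k & c <= t <= c + H / 2 ^+ k].
Proof.
move=> L0 H0 P0 step.
have stepT (k : nat) (x : R * R) : exists y : R * R, P k x.1 x.2 ->
    P k.+1 y.1 y.2 /\
     (y.1 = x.1 \/ y.1 = x.1 + L / 2 ^+ k.+1) /\
     (y.2 = x.2 \/ y.2 = x.2 + H / 2 ^+ k.+1).
  (* The step is made total, with the value [x] where [P] fails, so that the sequence can be defined
     by recursion before [P] is known along it. *)
  have [h|h] := pselect (P k x.1 x.2); last by exists x.
  by have [a' [c' h']] := step _ _ _ h; exists (a', c').
pose nxt k x := projT1 (cid (stepT k x)).
have nxtP k x := projT2 (cid (stepT k x)).
pose z := fix z k := if k is k'.+1 then nxt k' (z k') else (a0, c0).
have zP k : P k (z k).1 (z k).2.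
  by elim: k => [//|k IH]; have [] := nxtP k (z k) IH.
have half M k : 0 <= M -> M / 2 ^+ k.+1 + M / 2 ^+ k.+1 = M / 2 ^+ k :> R.
  by move=> _; rewrite exprS invfM; set w := (2 ^+ k)^-1; rewrite mulrCA; field.
have pos M k : 0 <= M -> 0 <= M / 2 ^+ k :> R.
  by move=> ?; rewrite divr_ge0 // exprn_ge0.
have z1 k : (z k).1 <= (z k.+1).1 /\
   (z k.+1).1 + L / 2 ^+ k.+1 <= (z k).1 + L / 2 ^+ k.
  have [_ [h _]] := nxtP k (z k) (zP k); have := pos L k.+1 L0; have := half L k L0.
  move: h; rewrite -/(nxt k (z k)) -/(z k.+1); case=> -> //; lra.
have z2 k : (z k).2 <= (z k.+1).2 /\
   (z k.+1).2 + H / 2 ^+ k.+1 <= (z k).2 + H / 2 ^+ k.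
  have [_ [_ h]] := nxtP k (z k) (zP k); have := pos H k.+1 H0; have := half H k H0.
  move: h; rewrite -/(nxt k (z k)) -/(z k.+1); case=> -> //; lra.
have [s sP] := @nested_intervals (fun k => (z k).1) (fun k => L / 2 ^+ k)
  (fun k => (z1 k).1) (fun k => (z1 k).2) (fun k => pos L k L0).
have [t tP] := @nested_intervals (fun k => (z k).2) (fun k => H / 2 ^+ k)
  (fun k => (z2 k).1) (fun k => (z2 k).2) (fun k => pos H k H0).
exists s, t => k; exists (z k).1, (z k).2; split=> //.
- elim: k => [|k [h1 h2]]; first by rewrite /= expr0 divr1.
  have [h3 h4] := z1 k; split; [exact: le_trans h3|exact: le_trans h2].
- elim: k => [|k [h1 h2]]; first by rewrite /= expr0 divr1.
  have [h3 h4] := z2 k; split; [exact: le_trans h3|exact: le_trans h2].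
Qed.

(** Goursat's argument for an abstract rectangle function: by additivity one of four quarters
    carries at least a quarter of the value, so the values along the nested rectangles decay no
    faster than [4 ^- k], whereas smallness at the common point forces them below any multiple of
    the squared side sum. *)
Lemma additive_rectangle_eq0 (I : R -> R -> R -> R -> R) a0 b0 c0 d0 :
  a0 <= b0 -> c0 <= d0 ->
  (forall a m b c d, a0 <= a -> a <= m -> m <= b -> b <= b0 ->
     c0 <= c -> c <= d -> d <= d0 -> I a b c d = I a m c d + I m b c d) ->
  (forall a b c m d, a0 <= a -> a <= b -> b <= b0 ->
     c0 <= c -> c <= m -> m <= d -> d <= d0 -> I a b c d = I a b c m + I a b m d) ->
  (forall s t, a0 <= s <= b0 -> c0 <= t <= d0 -> forall e, 0 < e ->
     exists2 dl, 0 < dl & forall a b c d, a0 <= a -> b <= b0 -> c0 <= c -> d <= d0 ->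
       a <= s <= b -> c <= t <= d -> b - a < dl -> d - c < dl ->
       `|I a b c d| <= e * (b - a + (d - c)) ^+ 2) ->
  I a0 b0 c0 d0 = 0.
Proof.
move=> ab cd add1 add2 small; apply/eqP/negPn/negP => /negPf nz.
(* Half of the value, so that the strict inequality in [P] already holds at level 0. *)
pose eta := `|I a0 b0 c0 d0| / 2.
have eta0 : 0 < eta by rewrite divr_gt0 // normr_gt0 nz.
pose L := b0 - a0; pose H := d0 - c0.
have L0 : 0 <= L by rewrite subr_ge0. have H0 : 0 <= H by rewrite subr_ge0.
pose P k a c := [/\ a0 <= a, a + L / 2 ^+ k <= b0, c0 <= c, c + H / 2 ^+ k <= d0 &
  eta / 4 ^+ k < `|I a (a + L / 2 ^+ k) c (c + H / 2 ^+ k)|].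
have aL : a0 + L = b0 by rewrite /L addrC subrK.
have cH : c0 + H = d0 by rewrite /H addrC subrK.
have P0 : P 0%N a0 c0.
  rewrite /P !expr0 !divr1 aL cH; split=> //.
  rewrite /eta -[X in _ < X]mulr1 ltr_pM2l ?normr_gt0 ?nz //; lra.
have half M k : M / 2 ^+ k.+1 + M / 2 ^+ k.+1 = M / 2 ^+ k :> R.
  by rewrite exprS invfM; set w := (2 ^+ k)^-1; rewrite mulrCA; field.
have pos M k : 0 <= M -> 0 <= M / 2 ^+ k :> R.
  by move=> ?; rewrite divr_ge0 // exprn_ge0.
have step k a c : P k a c -> exists a' c', P k.+1 a' c' /\
     (a' = a \/ a' = a + L / 2 ^+ k.+1) /\ (c' = c \/ c' = c + H / 2 ^+ k.+1).
  move=> [h1 h2 h3 h4 h5].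
  have l0 := pos L k.+1 L0; have k0 := pos H k.+1 H0.
  move: h2 h4 h5; rewrite -(half L k) -(half H k) /P.
  set l := L / _ in l0 *; set h := H / _ in k0 *; rewrite !addrA => h2 h4 h5.
  have E4 : eta / 4 ^+ k = 4 * (eta / 4 ^+ k.+1).
    by rewrite exprS invfM; set w := (4 ^+ k)^-1; field.
  have A1 : I a (a + l + l) c (c + h + h) =
      I a (a + l) c (c + h + h) + I (a + l) (a + l + l) c (c + h + h).
    by apply: add1 => //; lra.
  have A2 : I a (a + l) c (c + h + h) = I a (a + l) c (c + h) + I a (a + l) (c + h) (c + h + h).
    by apply: add2 => //; lra.
  have A3 : I (a + l) (a + l + l) c (c + h + h) =
      I (a + l) (a + l + l) c (c + h) + I (a + l) (a + l + l) (c + h) (c + h + h).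
    by apply: add2 => //; lra.
  rewrite E4 A1 A2 A3 in h5.
  have hh := lt_le_trans h5 (le_trans (ler_normD _ _) (lerD (ler_normD _ _) (ler_normD _ _))).
  have [w1|w1] := ltP (eta / 4 ^+ k.+1) `|I a (a + l) c (c + h)|.
    by exists a, c; split; [split=> //; lra|split; left].
  have [w2|w2] := ltP (eta / 4 ^+ k.+1) `|I a (a + l) (c + h) (c + h + h)|.
    by exists a, (c + h); split; [split=> //; lra|split; [left|right]].
  have [w3|w3] := ltP (eta / 4 ^+ k.+1) `|I (a + l) (a + l + l) c (c + h)|.
    by exists (a + l), c; split; [split=> //; lra|split; [right|left]].
  exists (a + l), (c + h); split; [split=> //; lra|by split; right].
have [s [t st]] := quadrisection L0 H0 P0 step.
have sI : a0 <= s <= b0 by have [a [c [_ [? ?] _ /andP[? ?] _]]] := st 0%N; apply/andP; split;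
  lra.
have tI : c0 <= t <= d0 by have [a [c [_ _ [? ?] _ /andP[? ?]]]] := st 0%N; apply/andP; split;
  lra.
have D0 : 0 < (L + H + 1) ^+ 2 by rewrite exprn_gt0 // ltr_wpDl // addr_ge0.
(* The summand 1 keeps the denominator positive when the rectangle is degenerate. *)
have [dl dl0 dlP] := small s t sI tI (eta / (L + H + 1) ^+ 2) (divr_gt0 eta0 D0).
have [k kdl] : exists k, (L + H + 1) / 2 ^+ k < dl.
  have LH : 0 < L + H + 1 by rewrite ltr_wpDl // addr_ge0.
  have [k hk] : exists k : nat, (L + H + 1) / dl < k%:R.
    by exists (Num.bound ((L + H + 1) / dl)); apply: archi_boundP; rewrite divr_ge0 // ltW.
  exists k; rewrite ltr_pdivrMr ?exprn_gt0 // mulrC -ltr_pdivrMr //.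
  apply: (lt_le_trans hk); rewrite -natrX ler_nat ltnW // ltn_expl //.
have [a [c [[h1 h2 h3 h4 h5] _ _ hs ht]]] := st k.
have p2 : 0 < (2 ^+ k)^-1 :> R by rewrite invr_gt0 exprn_gt0.
have := dlP a (a + L / 2 ^+ k) c (c + H / 2 ^+ k) h1 h2 h3 h4 hs ht.
have e1 x y : x + y - x = y :> R by rewrite addrC addKr.
rewrite !e1 => /(_ _ _) hh; move: kdl; rewrite 2!mulrDl => kdl.
have l0 := pos L k L0; have k0 := pos H k H0.
have := hh ltac:(lra) ltac:(lra) => h6.
have E4 : (4 ^+ k)^-1 = (2 ^+ k)^-1 ^+ 2 :> R.
  by rewrite -exprVn -(exprVn 2 k) -exprM mulnC exprM; congr (_ ^+ _); field.
have := lt_le_trans h5 h6; rewrite E4 -mulrDl (exprMn _ (L + H)) [X in _ < X]mulrA ltr_pM2r;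
  last by rewrite exprn_gt0.
rewrite mulrAC ltr_pdivlMr // ltr_pM2l // ltNge => /negP; apply.
by apply: lerXn2r; rewrite ?nnegrE; lra.
Qed.

Lemma derive_continuous_within (f df : R -> R) a b :
  (forall x, a <= x <= b -> is_derive x 1 f (df x)) ->
  {within `[a, b], continuous f}.
Proof.
move=> fd; apply: continuous_in_subspaceT => x.
rewrite inE /= in_itv /= => xab.
have h := fd x xab; apply: differentiable_continuous; apply/derivable1_diffP; exact: ex_derive.
Qed.

Lemma mvt_bound (f df : R -> R) a b e : a <= b ->
  (forall x, a <= x <= b -> is_derive x 1 f (df x)) ->
  (forall x, a <= x <= b -> `|df x| <= e) -> `|f b - f a| <= e * (b - a).
Proof.
move=> ab fd dfe.
have [x|c] := @MVT_segment R f df a b ab _ (derive_continuous_within fd).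
  by rewrite in_itv /= => /andP[/ltW ? /ltW ?]; apply: fd; apply/andP.
rewrite in_itv /= => cab ->; rewrite normrM (ger0_norm (_ : 0 <= b - a)) ?subr_ge0 //.
by rewrite ler_wpM2r ?subr_ge0 ?dfe.
Qed.

(** The mean value inequality for [f] minus the antiderivative of [k1 + k2 * (x - s)]; it replaces
    an integral estimate of the first-order remainder. *)
Lemma mvt_affine_bound (f df : R -> R) a b s k1 k2 e : a <= b ->
  (forall x, a <= x <= b -> is_derive x 1 f (df x)) ->
  (forall x, a <= x <= b -> `|df x - k1 - k2 * (x - s)| <= e) ->
  `|f b - f a - (k1 * (b - a) + k2 * ((b - s) ^+ 2 - (a - s) ^+ 2) / 2)| <= e * (b - a).
Proof.
move=> ab fd dfe.
pose g x := f x - (k1 * x + k2 * ((x - s) ^+ 2) / 2).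
have -> : f b - f a - (k1 * (b - a) + k2 * ((b - s) ^+ 2 - (a - s) ^+ 2) / 2) = g b - g a.
  by rewrite /g; field.
apply: (@mvt_bound g (fun x => df x - k1 - k2 * (x - s))) => // x xab.
have := fd x xab => fdx; rewrite /g.
apply: is_derive_eq; rewrite !scaler1 /GRing.scale /=.
by field.
Qed.

(** The counterclockwise integral of [P ds + Q dt] over the boundary of the rectangle, each side
    being evaluated by a primitive along it: bottom, right, top, left. *)
Definition boundary_form (PP QQ : R -> R -> R) a b c d : R :=
  (PP b c - PP a c) + (QQ b d - QQ b c) - (PP b d - PP a d) - (QQ a d - QQ a c).

(* [PP], [QQ] are partial primitives of the coefficients of the 1-form
   [P ds + Q dt], which is only assumed to be pointwise differentiable and closed. *)
Lemma goursat (P Q PP QQ : R -> R -> R) a0 b0 c0 d0 : a0 <= b0 -> c0 <= d0 ->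
  (forall s t, a0 <= s <= b0 -> c0 <= t <= d0 -> is_derive s 1 (PP^~ t) (P s t)) ->
  (forall s t, a0 <= s <= b0 -> c0 <= t <= d0 -> is_derive t 1 (QQ s) (Q s t)) ->
  (forall s t, a0 <= s <= b0 -> c0 <= t <= d0 -> exists p1 p2 q2,
     forall e, 0 < e -> exists2 dl, 0 < dl & forall x y, a0 <= x <= b0 -> c0 <= y <= d0 ->
       `|x - s| < dl -> `|y - t| < dl ->
       `|P x y - P s t - p1 * (x - s) - p2 * (y - t)| <= e * (`|x - s| + `|y - t|) /\
       `|Q x y - Q s t - p2 * (x - s) - q2 * (y - t)| <= e * (`|x - s| + `|y - t|)) ->
  boundary_form PP QQ a0 b0 c0 d0 = 0.
Proof.
move=> ab cd hP hQ dif; apply: additive_rectangle_eq0 => //.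
- by move=> *; rewrite /boundary_form; ring.
- by move=> *; rewrite /boundary_form; ring.
move=> s t sI tI e e0; have [p1 [p2 [q2 dif']]] := dif s t sI tI.
have [|dl dl0 {}dif] := dif' (e / 2); first by rewrite divr_gt0.
exists dl => // a b c d ha hb hc hd /andP[as_ sb] /andP[ct td] lab lcd.
pose S := b - a + (d - c).
have near x y : a <= x <= b -> c <= y <= d ->
  `|P x y - P s t - p1 * (x - s) - p2 * (y - t)| <= e / 2 * S /\
  `|Q x y - Q s t - p2 * (x - s) - q2 * (y - t)| <= e / 2 * S.
  move=> /andP[x1 x2] /andP[y1 y2].
  have hx : `|x - s| <= b - a by rewrite ler_norml; apply/andP; split; lra.
  have hy : `|y - t| <= d - c by rewrite ler_norml; apply/andP; split; lra.
  have [||||h1 h2] := dif x y; rewrite ?(le_lt_trans hx) ?(le_lt_trans hy) //; try (apply/andP;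
    split; lra).
  by split; [apply: le_trans h1 _|apply: le_trans h2 _];
    rewrite ler_pM2l ?divr_gt0 // lerD.
have bot : forall y, c <= y <= d -> `|PP b y - PP a y - ((P s t + p2 * (y - t)) * (b - a) +
   p1 * ((b - s) ^+ 2 - (a - s) ^+ 2) / 2)| <= e / 2 * S * (b - a).
  move=> y yI; apply: (@mvt_affine_bound (PP^~ y) (P^~ y)); first lra.
    move=> x /andP[x1 x2]; apply: hP; apply/andP; move/andP: yI => [? ?]; split; lra.
  move=> x xI; have [h _] := near x y xI yI; apply: le_trans h.
  by rewrite le_eqVlt; apply/orP; left; apply/eqP; congr `|_|; ring.
have rig : forall x, a <= x <= b -> `|QQ x d - QQ x c - ((Q s t + p2 * (x - s)) * (d - c) +
   q2 * ((d - t) ^+ 2 - (c - t) ^+ 2) / 2)| <= e / 2 * S * (d - c).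
  move=> x xI; apply: (@mvt_affine_bound (QQ x) (Q x)); first lra.
    move=> y /andP[y1 y2]; apply: hQ; apply/andP; move/andP: xI => [? ?]; split; lra.
  move=> y yI; have [_ h] := near x y xI yI; apply: le_trans h.
  by rewrite le_eqVlt; apply/orP; left; apply/eqP; congr `|_|; ring.
(* The affine parts of the four sides cancel, because the same [p2] is the [t]-derivative of [P] and
   the [s]-derivative of [Q]. The four remainders, each with constant [e / 2], add up to
   [e * S ^+ 2]. *)
have := bot c ltac:(lra); have := bot d ltac:(lra).
have := rig a ltac:(lra); have := rig b ltac:(lra).
rewrite /boundary_form -/S !ler_norml => /andP[r1 r2] /andP[r3 r4] /andP[r5 r6] /andP[r7 r8].
have E : e * S ^+ 2 = e / 2 * S * (b - a) + e / 2 * S * (b - a) +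
   (e / 2 * S * (d - c) + e / 2 * S * (d - c)) by rewrite /S; field.
rewrite E; apply/andP; split; lra.
Qed.

(** The integral starts at [a - 1], so that the point [a] itself is interior and a two-sided
    derivative exists there. *)
Definition primitive_from a (f : R -> R) (x : R) : R :=
  \int[lebesgue_measure]_(t in `[a - 1, x]) f t.

Lemma is_derive_primitive (f : R -> R) a x : continuous f -> a <= x ->
  is_derive x 1 (primitive_from a f) (f x).
Proof.
move=> cf ax.
have ci : lebesgue_measure.-integrable `[a - 1, x + 1] (EFin \o f).
  by apply: continuous_compact_integrable; [exact: segment_compact|exact: continuous_subspaceT].
have xu : x < x + 1 by lra.
have ax' : a - 1 < x by lra.
have [h1 h2] := continuous_FTC1_closed xu ci ax' (cf x).
apply: (@DeriveDef _ _ _ _ _ _ _ h1).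
by rewrite -derive1E.
Qed.

End Goursat.

(** * Complex differentiability by epsilon estimates, and the complex exponential *)

Section Epsilon.
Context {R : realType}.

Lemma mul_divK (B e x : R) : 0 < B -> B * (e / B * x) = e * x.
Proof. by move=> /lt0r_neq0 B0; field. Qed.

Lemma is_derive_epsP (f : R -> R) (x d : R) :
  is_derive x 1 f d <-> forall e, 0 < e -> exists2 dl, 0 < dl &
     forall h, `|h| < dl -> `|f (x + h) - f x - d * h| <= e * `|h|.
Proof.
split=> [fd e e0|H].
  have [fd' fdE] := fd.
  have : h^-1 *: (f (h *: 1 + x) - f x) @[h --> 0^'] --> d.
    by rewrite -fdE; exact: fd'.
  move=> /cvgrPdist_le /(_ e e0) /nbhs_ballP[dl /= dl0 hdl].
  exists dl => // h hd.
  have [->|h0] := eqVneq h 0; first by rewrite addr0 subrr mulr0 subr0 normr0 mulr0.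
  have := hdl h; rewrite /ball /= sub0r normrN => /(_ hd h0).
  rewrite /GRing.scale /= mulr1 distrC (addrC h x).
  rewrite -(ler_pM2r (_ : 0 < `|h|)) ?normr_gt0 // -normrM mulrBl.
  by rewrite mulrAC mulVf // mul1r.
have C : h^-1 *: (f (h *: 1 + x) - f x) @[h --> 0^'] --> d.
  apply/cvgrPdist_le => e e0; have [dl dl0 hdl] := H e e0.
  apply/nbhs_ballP; exists dl => //= h; rewrite /ball /= sub0r normrN => hd h0.
  rewrite /GRing.scale /= mulr1 distrC (addrC h x).
  rewrite -(ler_pM2r (_ : 0 < `|h|)) ?normr_gt0 // -normrM mulrBl.
  by rewrite mulrAC mulVf // mul1r; exact: hdl.
apply: DeriveDef; last exact: cvg_lim.
by apply/cvg_ex; exists d.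
Qed.

Lemma is_derive_continuous (f : R -> R) (x d : R) : is_derive x 1 f d -> {for x, continuous f}.
Proof. by case=> h _; apply: differentiable_continuous; apply/derivable1_diffP. Qed.

Lemma continuous_epsP (f : R -> R) (x : R) :
  {for x, continuous f} <-> forall e, 0 < e -> exists2 dl, 0 < dl &
     forall y, `|y - x| < dl -> `|f y - f x| < e.
Proof.
split=> [cf e e0|H].
  move/cvgrPdist_lt : cf => /(_ e e0) /nbhs_ballP[dl /= dl0 hdl].
  by exists dl => // y yx; rewrite distrC; apply: hdl; rewrite /ball /= distrC.
apply/cvgrPdist_lt => e e0; have [dl dl0 hdl] := H e e0.
by apply/nbhs_ballP; exists dl => //= y; rewrite /ball /= distrC => /hdl; rewrite distrC.
Qed.

Definition cder (f : R[i] -> R[i]) (z d : R[i]) : Prop :=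
  forall e, 0 < e -> exists2 dl, 0 < dl &
    forall w, nm w < dl -> nm (f (z + w) - f z - d * w) <= e * nm w.

Lemma cder_lip f z d : cder f z d -> exists2 dl, 0 < dl &
  forall w, nm w < dl -> nm (f (z + w) - f z) <= (nm d + 1) * nm w.
Proof.
move=> /(_ 1 ltr01) [dl dl0 H]; exists dl => // w /H h.
rewrite -(subrK (d * w) (f (z + w) - f z)); apply: le_trans (nmD _ _) _.
by rewrite mulrDl addrC lerD // nmM.
Qed.

Lemma cder_cont f z d : cder f z d -> forall e, 0 < e -> exists2 dl, 0 < dl &
  forall w, nm w < dl -> nm (f (z + w) - f z) < e.
Proof.
move=> /cder_lip [dl dl0 H] e e0.
have d0 : 0 < nm d + 1 by rewrite ltr_wpDl ?nm_ge0.
exists (Num.min dl (e / (nm d + 1))); first by rewrite lt_min dl0 divr_gt0.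
move=> w; rewrite lt_min => /andP[/H h1 h2]; apply: le_lt_trans h1 _.
by rewrite mulrC -ltr_pdivlMr.
Qed.

Lemma cder_cst c z : cder (fun=> c) z 0.
Proof. by move=> e e0; exists 1 => // w _;
  rewrite subrr mul0r subr0 nm0 mulr_ge0 ?nm_ge0 // ltW. Qed.

Lemma cderD f g z d k : cder f z d -> cder g z k ->
  cder (fun w => f w + g w) z (d + k).
Proof.
move=> Hf Hg e e0.
have e2 : 0 < e / 2 by lra.
have [d1 d10 H1] := Hf _ e2; have [d2 d20 H2] := Hg _ e2.
exists (Num.min d1 d2) => [|w]; first by rewrite lt_min d10.
rewrite lt_min => /andP[/H1 h1 /H2 h2].
have -> : f (z + w) + g (z + w) - (f z + g z) - (d + k) * w =
  (f (z + w) - f z - d * w) + (g (z + w) - g z - k * w) by ring.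
by apply: le_trans (nmD _ _) _; move: h1 h2; lra.
Qed.

Lemma cderM f g z d k : cder f z d -> cder g z k ->
  cder (fun w => f w * g w) z (d * g z + f z * k).
Proof.
move=> Hf Hg e e0.
pose A := nm (g z) + 1; pose B := nm (f z) + 1.
have A0 : 0 < A by rewrite ltr_wpDl ?nm_ge0.
have B0 : 0 < B by rewrite ltr_wpDl ?nm_ge0.
have [d1 d10 H1] := Hf (e / 3 / A) ltac:(rewrite !divr_gt0 //; lra).
have [d2 d20 H2] := Hg (e / 3 / B) ltac:(rewrite !divr_gt0 //; lra).
have K0 : 0 < nm k + 1 by rewrite ltr_wpDl ?nm_ge0.
have [d3 d30 H3] := cder_cont Hf (e := e / 3 / (nm k + 1)) ltac:(rewrite !divr_gt0 //; lra).
have [d4 d40 H4] := cder_cont Hf ltr01.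
exists (Num.min (Num.min d1 d2) (Num.min d3 d4)) => [|w]; first by rewrite !lt_min d10 d20 d30.
rewrite !lt_min => /andP[/andP[w1 w2] /andP[w3 w4]].
have -> : f (z + w) * g (z + w) - f z * g z - (d * g z + f z * k) * w =
  (f (z + w) - f z - d * w) * g z + f (z + w) * (g (z + w) - g z - k * w)
   + (f (z + w) - f z) * (k * w) by ring.
have h1 : nm ((f (z + w) - f z - d * w) * g z) <= e / 3 * nm w.
  apply: le_trans (nmM _ _) _; apply: (@le_trans _ _ (e / 3 / A * nm w * A)).
    by rewrite ler_pM ?nm_ge0 ?H1 // lerDl.
  by rewrite mulrAC divfK ?gt_eqF.
have fw : nm (f (z + w)) <= B.
  rewrite -(subrK (f z) (f (z + w))) addrC; apply: le_trans (nmD _ _) _.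
  by rewrite lerD2l ltW // H4.
have h2 : nm (f (z + w) * (g (z + w) - g z - k * w)) <= e / 3 * nm w.
  apply: le_trans (nmM _ _) _; apply: (@le_trans _ _ (B * (e / 3 / B * nm w))).
    by rewrite ler_pM ?nm_ge0 ?H2.
  by rewrite mul_divK.
have h3 : nm ((f (z + w) - f z) * (k * w)) <= e / 3 * nm w.
  apply: le_trans (nmM _ _) _.
  apply: (@le_trans _ _ (e / 3 / (nm k + 1) * ((nm k + 1) * nm w))).
    apply: ler_pM; rewrite ?nm_ge0 ?(ltW (H3 _ w3)) //.
    by apply: le_trans (nmM _ _) _; rewrite ler_wpM2r ?nm_ge0 // lerDl.
  by rewrite mulrA divfK ?gt_eqF.
apply: le_trans (nmD _ _) _; have := nmD ((f (z + w) - f z - d * w) * g z)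
  (f (z + w) * (g (z + w) - g z - k * w)).
move: h1 h2 h3; lra.
Qed.

Lemma cder_comp f g z d k : cder f z d -> cder g (f z) k ->
  cder (fun w => g (f w)) z (k * d).
Proof.
move=> Hf Hg e e0.
have D0 : 0 < nm d + 1 by rewrite ltr_wpDl ?nm_ge0.
have K0 : 0 < nm k + 1 by rewrite ltr_wpDl ?nm_ge0.
have [d1 d10 H1] := Hf (e / 2 / (nm k + 1)) ltac:(rewrite !divr_gt0 //; lra).
have [d2 d20 H2] := Hg (e / 2 / (nm d + 1)) ltac:(rewrite !divr_gt0 //; lra).
have [d3 d30 H3] := cder_lip Hf.
have [d4 d40 H4] := cder_cont Hf d20.
exists (Num.min d1 (Num.min d3 d4)) => [|w]; first by rewrite !lt_min d10 d30.
rewrite !lt_min => /andP[w1 /andP[w3 w4]].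
have -> : g (f (z + w)) - g (f z) - k * d * w =
  (g (f z + (f (z + w) - f z)) - g (f z) - k * (f (z + w) - f z)) +
   k * (f (z + w) - f z - d * w).
  by rewrite (addrC (f z)) subrK; ring.
apply: le_trans (nmD _ _) _.
have h1 : nm (g (f z + (f (z + w) - f z)) - g (f z) - k * (f (z + w) - f z)) <= e / 2 * nm w.
  apply: le_trans (H2 _ (H4 _ w4)) _.
  apply: (@le_trans _ _ (e / 2 / (nm d + 1) * ((nm d + 1) * nm w))).
    by rewrite ler_pM2l ?H3 // !divr_gt0 //; lra.
  by rewrite mulrA divfK ?gt_eqF.
have h2 : nm (k * (f (z + w) - f z - d * w)) <= e / 2 * nm w.
  apply: le_trans (nmM _ _) _.
  apply: (@le_trans _ _ ((nm k + 1) * (e / 2 / (nm k + 1) * nm w))).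
    by rewrite ler_pM ?nm_ge0 ?H1 // lerDl.
  by rewrite mul_divK.
move: h1 h2; lra.
Qed.

Definition cexp (z : R[i]) : R[i] :=
  (expR (complex.Re z) * cos (complex.Im z)) +i* (expR (complex.Re z) * sin (complex.Im z)).

Lemma cexpD z w : cexp (z + w) = cexp z * cexp w.
Proof.
apply/eqP; rewrite eq_complex /= cReD cImD expRD cosD sinD.
by apply/andP; split; apply/eqP; ring.
Qed.

Lemma cexpN z : cexp z * cexp (- z) = 1.
Proof.
rewrite -cexpD subrr /cexp /= expR0 cos0 sin0 mulr0 mulr1.
by apply/eqP; rewrite eq_complex /= !eqxx.
Qed.

Lemma nm_cexp z : nm (cexp z) <= 2 * expR (complex.Re z).
Proof.
rewrite /nm /= !normrM (ger0_norm (expR_ge0 _)) -mulrDr mulrC ler_pM2r ?expR_gt0 //.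
have hc : `|cos (complex.Im z)| <= 1 by rewrite ler_norml cos_geN1 cos_le1.
have hs : `|sin (complex.Im z)| <= 1 by rewrite ler_norml sin_geN1 sin_le1.
lra.
Qed.

Lemma cder_cexp z : cder cexp z (cexp z).
Proof.
suff H e : 0 < e -> exists2 dl, 0 < dl & forall w, nm w < dl -> nm (cexp w - 1 - w) <= e * nm w.
  move=> e e0; have C0 : 0 < nm (cexp z) + 1 by rewrite ltr_wpDl ?nm_ge0.
  have [dl dl0 hd] := H (e / (nm (cexp z) + 1)) (divr_gt0 e0 C0).
  exists dl => // w /hd h; rewrite cexpD.
  have -> : cexp z * cexp w - cexp z - cexp z * w = cexp z * (cexp w - 1 - w) by ring.
  apply: le_trans (nmM _ _) _.
  apply: (@le_trans _ _ ((nm (cexp z) + 1) * (e / (nm (cexp z) + 1) * nm w))).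
    by rewrite ler_pM ?nm_ge0 // lerDl.
  by rewrite mul_divK.
move=> e0.
have e8 : 0 < e / 8 by lra.
have [d1 d10 H1] := (is_derive_epsP _ _ _).1 (is_derive_expR (0 : R)) _ e8.
have [d2 d20 H2] := (is_derive_epsP _ _ _).1 (is_derive_cos (0 : R)) _ e8.
have [d3 d30 H3] := (is_derive_epsP _ _ _).1 (is_derive_sin (0 : R)) _ e8.
have m0 : 0 < Num.min (e / 8) 1 by rewrite lt_min e8 ltr01.
have [d4 d40 H4] := (continuous_epsP _ _).1 (@continuous_expR R 0) _ m0.
exists (Num.min (Num.min d1 d2) (Num.min d3 d4)) => [|w]; first by rewrite !lt_min d10 d20 d30.
rewrite !lt_min => /andP[/andP[w1 w2] /andP[w3 w4]].
have Re_lt dl : nm w < dl -> `|complex.Re w| < dl by apply: le_lt_trans; exact: ReZ_le.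
have Im_lt dl : nm w < dl -> `|complex.Im w| < dl by apply: le_lt_trans; exact: ImZ_le.
have := H1 _ (Re_lt _ w1); have := H2 _ (Im_lt _ w2); have := H3 _ (Im_lt _ w3).
have := H4 (complex.Re w); rewrite subr0 => /(_ (Re_lt _ w4)).
rewrite lt_min /nm !cReD !cReN !cImD !cImN /= !(add0r, expR0, cos0, sin0, oppr0, mul0r, mul1r,
  subr0, addr0).
move: (complex.Re w) (complex.Im w) => a b.
set E := expR a; set c := cos b; set s := sin b => /andP[h4 h4'] h3 h2 h1.
have E2 : `|E| <= 2.
  have := ler_normD (E - 1) 1; rewrite subrK normr1; lra.
have -> : E * c - 1 - a = E * (c - 1) + (E - 1 - a) by ring.
have -> : E * s - b = E * (s - b) + (E - 1) * b by ring.
have := ler_normD (E * (c - 1)) (E - 1 - a).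
have := ler_normD (E * (s - b)) ((E - 1) * b).
rewrite !normrM.
have k1 : `|E| * `|c - 1| <= 2 * (e / 8 * `|b|) by rewrite ler_pM.
have k2 : `|E| * `|s - b| <= 2 * (e / 8 * `|b|) by rewrite ler_pM.
have k3 : `|E - 1| * `|b| <= e / 8 * `|b| by rewrite ler_wpM2r // ltW.
have a0 := normr_ge0 a; have b0 := normr_ge0 b.
have ea0 : 0 <= e * `|a| by rewrite mulr_ge0 // ltW.
have eb0 : 0 <= e * `|b| by rewrite mulr_ge0 // ltW.
move: k1 k2 k3 h1; rewrite mulrDr; lra.
Qed.

End Epsilon.

(** * The Cauchy estimate at the centre of a square *)

Section Cauchy.
Context {R : realType}.

(** A square rather than a disc: it contains the values of [cexp] on the closed left half-plane, and
    as a product of two segments it is visibly compact. *)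
Definition square : set R[i] :=
  [set z | `|complex.Re z| <= 1 /\ `|complex.Im z| <= 1].

Lemma square0 : square 0.
Proof. by rewrite /square /= normr0 ler01. Qed.

Lemma square_cexp (z : R[i]) : complex.Re z <= 0 -> square (cexp z).
Proof.
move=> z0; rewrite /square /= !normrM (ger0_norm (expR_ge0 _)).
have E1 : expR (complex.Re z) <= 1 by rewrite -[leRHS]expR0 ler_expR.
have E0 := expR_ge0 (complex.Re z).
have hc : `|cos (complex.Im z)| <= 1 by rewrite ler_norml cos_geN1 cos_le1.
have hs : `|sin (complex.Im z)| <= 1 by rewrite ler_norml sin_geN1 sin_le1.
by split; rewrite mulr_ile1.
Qed.

Lemma cder_opp (z : R[i]) : cder (fun w => - w) z (-1).
Proof.
move=> e e0; exists 1 => // w _.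
have -> : - (z + w) - - z - -1 * w = 0 by ring.
by rewrite nm0 mulr_ge0 ?nm_ge0 // ltW.
Qed.

Section Estimate.
Variables (f df : R[i] -> R[i]) (M : R).
Hypothesis fd : forall z, square z -> cder f z (df z).
Hypothesis fM : forall z, square z -> nm (f z) <= M.

(* The difference quotient [(f x - f 0) / x] in the logarithmic coordinate [x = exp z]. *)
Let h z := (f (cexp z) - f 0) * cexp (- z).

Let dh z := df (cexp z) * cexp z * cexp (- z) + (f (cexp z) - f 0) * (cexp (- z) * -1).

Let h_der z : complex.Re z <= 0 -> cder h z (dh z).
Proof.
move=> z0; have A := cder_comp (cder_cexp z) (fd (square_cexp z0)).
have B := cderD A (@cder_cst R (- f 0) z); rewrite addr0 in B.
have C := cder_comp (cder_opp z) (cder_cexp (- z)).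
exact: cderM B C.
Qed.

(** The quotient is controlled only for nonpositive real part. Clipping at 0 makes it continuous on
    the whole plane, as [is_derive_primitive] requires, without changing it there. *)
Let H s t : R[i] := h (Num.min s 0 +i* t).

Let clip_lip (s s' : R) : `|Num.min s 0 - Num.min s' 0| <= `|s - s'|.
Proof.
rewrite /Num.min /Order.min; case: ifP => h1; case: ifP => h2 //; rewrite ?subrr ?normr0 //.
- rewrite subr0; have h0 : 0 <= s' by rewrite leNgt h2.
  by rewrite !ltr0_norm //; lra.
- rewrite sub0r normrN; have h0 : 0 <= s by rewrite leNgt h1.
  rewrite ltr0_norm // ger0_norm; lra.
Qed.

Let H_cont s t e : 0 < e -> exists2 dl, 0 < dl & forall x y,
  `|x - s| < dl -> `|y - t| < dl -> nm (H x y - H s t) < e.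
Proof.
move=> e0; have s0 : complex.Re (Num.min s 0 +i* t) <= 0 by rewrite /= ge_min lexx orbT.
have [dl dl0 hd] := cder_cont (h_der s0) e0.
exists (dl / 2) => [|x y xs yt]; first lra.
rewrite /H; have -> : Num.min x 0 +i* y =
    (Num.min s 0 +i* t) + ((Num.min x 0 - Num.min s 0) +i* (y - t)).
  by apply/eqP; rewrite eq_complex /= !(addrC _ (_ - _)) !subrK !eqxx.
apply: hd; rewrite /nm /=; have := clip_lip x s; lra.
Qed.

Let H_periodic s : H s 0 = H s (2 * pi).
Proof.
rewrite /H /h; have E x : cexp (x +i* (2 * pi)) = cexp (x +i* 0).
  by rewrite /cexp /= mulr_natl cos2pi sin2pi cos0 sin0.
rewrite E; congr (_ * _).
have -> : - (Num.min s 0 +i* (2 * pi)) = (- Num.min s 0) +i* (- (2 * pi)) :> R[i] by [].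
have -> : - (Num.min s 0 +i* 0) = (- Num.min s 0) +i* (- 0) :> R[i] by [].
by rewrite /cexp /= !sinN !cosN mulr_natl cos2pi sin2pi cos0 sin0.
Qed.

Let H_diff s t : s <= 0 -> forall e, 0 < e -> exists2 dl, 0 < dl &
  forall x y, x <= 0 -> `|x - s| < dl -> `|y - t| < dl ->
  nm (H x y - H s t - dh (s +i* t) * ((x - s) +i* (y - t))) <= e * (`|x - s| + `|y - t|).
Proof.
move=> s0 e e0; have [dl dl0 hd] := h_der (z := s +i* t) s0 e0.
exists (dl / 2) => [|x y x0 xs yt]; first lra.
have := hd ((x - s) +i* (y - t)); rewrite /nm /= -!/(nm _).
have -> : (s +i* t) + ((x - s) +i* (y - t)) = x +i* y.
  by apply/eqP; rewrite eq_complex /= !(addrC _ (_ - _)) !subrK !eqxx.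
by rewrite /H !min_l //; apply; lra.
Qed.

(* Any real-linear functional of the closed form [h dz] is a real closed form. *)
Let circle_mean (k1 k2 : R) (s0 : R) (L := fun z : R[i] => k1 * complex.Re z + k2 * complex.Im
  z) :
  s0 <= 0 -> exists Q0 Q1 : R -> R,
  [/\ forall t, 0 <= t <= 2 * pi -> is_derive t 1 Q0 (L (H s0 t)),
      forall t, 0 <= t <= 2 * pi -> is_derive t 1 Q1 (L (H 0 t)) &
      Q0 (2 * pi) - Q0 0 = Q1 (2 * pi) - Q1 0].
Proof.
move=> s00; have pi0 : 0 <= 2 * pi :> R by rewrite mulr_ge0 // pi_ge0.
(* [L' z] is [L (- 'i * z)], so [L' h ds + L h dt] is the functional [L] applied to the form [h dz]
   divided by ['i]. *)
pose L' (z : R[i]) : R := k1 * complex.Im z - k2 * complex.Re z.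
pose K := `|k1| + `|k2| + 1.
have K0 : 0 < K by rewrite ltr_wpDl // addr_ge0.
have LB z : `|L z| <= K * nm z.
  rewrite /L /K /nm; have := ler_normD (k1 * complex.Re z) (k2 * complex.Im z).
  rewrite !normrM; move: (normr_ge0 k1) (normr_ge0 k2) (normr_ge0 (complex.Re z)) (normr_ge0
    (complex.Im z)).
  nra.
have LB' z : `|L' z| <= K * nm z.
  rewrite /L' /K /nm; have := ler_normB (k1 * complex.Im z) (k2 * complex.Re z).
  rewrite !normrM; move: (normr_ge0 k1) (normr_ge0 k2) (normr_ge0 (complex.Re z)) (normr_ge0
    (complex.Im z)).
  nra.
have LD z w : L (z - w) = L z - L w by rewrite /L cReD cImD cReN cImN; ring.
have LD' z w : L' (z - w) = L' z - L' w by rewrite /L' cReD cImD cReN cImN; ring.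
have LM z x y : L (z * (x +i* y)) = (k1 * complex.Re z + k2 * complex.Im z) * x +
    (k2 * complex.Re z - k1 * complex.Im z) * y by rewrite /L cReM cImM /=; ring.
have LM' z x y : L' (z * (x +i* y)) = (k1 * complex.Im z - k2 * complex.Re z) * x +
    (k1 * complex.Re z + k2 * complex.Im z) * y by rewrite /L' cReM cImM /=; ring.
have cP t : continuous (fun s => L' (H s t)).
  move=> s; apply/continuous_epsP => e e0.
  have [dl dl0 hd] := H_cont s t (divr_gt0 e0 K0).
  exists dl => // x xs; rewrite -LD'; apply: le_lt_trans (LB' _) _.
  by rewrite mulrC -ltr_pdivlMr // hd // subrr normr0.
have cQ s : continuous (fun t => L (H s t)).
  move=> t; apply/continuous_epsP => e e0.
  have [dl dl0 hd] := H_cont s t (divr_gt0 e0 K0).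
  exists dl => // x xs; rewrite -LD; apply: le_lt_trans (LB _) _.
  by rewrite mulrC -ltr_pdivlMr // hd // subrr normr0.
pose PP s t := primitive_from s0 (fun s => L' (H s t)) s.
pose QQ s := primitive_from 0 (fun t => L (H s t)).
have : boundary_form PP QQ s0 0 0 (2 * pi) = 0.
  apply: (@goursat R (fun s t => L' (H s t)) (fun s t => L (H s t))) => //.
  - by move=> s t /andP[s1 _] _; exact: is_derive_primitive (cP t) s1.
  - by move=> s t _ /andP[t1 _]; exact: is_derive_primitive (cQ s) t1.
  - move=> s t /andP[_ sl0] _; pose a := complex.Re (dh (s +i* t));
    pose b := complex.Im (dh (s +i* t)).
    (* These are [L'], [L] and [L o 'i] at the complex derivative [dh]. The middle one serves for
       both mixed derivatives: this is the Cauchy-Riemann equation in the form of closedness. *)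
    exists (k1 * b - k2 * a), (k1 * a + k2 * b), (k2 * a - k1 * b) => e e0.
    have [dl dl0 hd] := @H_diff s t sl0 _ (divr_gt0 e0 K0).
    exists dl => // x y /andP[_ x0] _ xs yt; have hh := hd x y x0 xs yt.
    have E1 : e * (`|x - s| + `|y - t|) = K * (e / K * (`|x - s| + `|y - t|)) by rewrite mul_divK.
    split; rewrite E1.
      apply: (@le_trans _ _ (K * nm (H x y - H s t - dh (s +i* t) * ((x - s) +i* (y - t)))));
        last by rewrite ler_pM2l.
      apply: le_trans (LB' _); rewrite le_eqVlt; apply/orP; left; apply/eqP; congr `|_|.
      by rewrite LD' LD' (LM' (dh (s +i* t))) -/a -/b; ring.
    apply: (@le_trans _ _ (K * nm (H x y - H s t - dh (s +i* t) * ((x - s) +i* (y - t)))));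
      last by rewrite ler_pM2l.
    apply: le_trans (LB _); rewrite le_eqVlt; apply/orP; left; apply/eqP; congr `|_|.
    by rewrite LD LD (LM (dh (s +i* t))) -/a -/b; ring.
rewrite /boundary_form.
(* By the period [2 * pi] of [H] the horizontal sides cancel, which leaves the equality of the
   integrals over the two vertical sides, that is, over two circles. *)
have EP s : PP s (2 * pi) = PP s 0.
  by rewrite /PP; congr (primitive_from _ _ _); apply/funext => x; rewrite H_periodic.
rewrite !EP => E; exists (QQ s0), (QQ 0); split=> [t /andP[? _]|t /andP[? _]|].
- exact: is_derive_primitive (cQ s0) _.
- exact: is_derive_primitive (cQ 0) _.
move: E; move: (PP 0 0) (PP s0 0) (QQ 0 (2 * pi)) (QQ 0 0) (QQ s0 (2 * pi)) (QQ s0 0) => x1 x2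
  x3 x4 x5 x6 E.
lra.
Qed.

(** The mean of the difference quotient is the same on all circles in the unit disc. On the unit
    circle the quotient is at most [2 * M * 2] in [nm], the last factor coming from [nm_cexp]; on
    small circles it is close to [df 0]. Hence [4 * M] bounds the real and the imaginary part of
    [df 0]. *)
Lemma cauchy_estimate : nm (df 0) <= 8 * M.
Proof.
have pi0 : 0 < 2 * pi :> R by rewrite mulr_gt0 // pi_gt0.
have M0 : 0 <= M by apply: le_trans (fM square0); exact: nm_ge0.
have H0 t : nm (H 0 t) <= 4 * M.
  rewrite /H /h min_l //; apply: le_trans (nmM _ _) _.
  have h1 : nm (f (cexp (0 +i* t)) - f 0) <= 2 * M.
    apply: le_trans (nmB _ _) _; have := fM square0.
    have := fM (square_cexp (z := 0 +i* t) (lexx 0)); lra.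
  have h2 : nm (cexp (- (0 +i* t))) <= 2.
    by apply: le_trans (nm_cexp _) _; rewrite /= oppr0 expR0 mulr1.
  have -> : 4 * M = 2 * M * 2 by ring.
  by rewrite ler_pM ?nm_ge0.
have near0 e : 0 < e -> exists2 s0, s0 <= 0 & forall t, nm (H s0 t - df 0) <= e.
  (* The divisor 4 compensates the two factors 2 of [nm_cexp], for [cexp w] and for [cexp (- w)]. *)
  move=> e0; have [dl dl0 hd] := fd square0 (e := e / 4) ltac:(lra).
  pose s0 := Num.min 0 (ln (dl / 4)).
  have s00 : s0 <= 0 by rewrite /s0 ge_min lexx.
  have es0 : expR s0 <= dl / 4.
    by rewrite -[leRHS]lnK ?posrE; [rewrite ler_expR /s0 ge_min lexx orbT|lra].
  exists s0 => // t; rewrite /H /h min_l //.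
  set w := s0 +i* t; set x := cexp w.
  have nx : nm x <= 2 * expR s0 by exact: nm_cexp.
  have nx' : nm (cexp (- w)) <= 2 * expR (- s0) by exact: nm_cexp.
  have E : (f x - f 0) * cexp (- w) - df 0 = (f (0 + x) - f 0 - df 0 * x) * cexp (- w).
    have hx1 : x * cexp (- w) = 1 by exact: cexpN.
    by rewrite add0r [in RHS]mulrBl -(mulrA (df 0)) hx1 mulr1.
  rewrite E; apply: le_trans (nmM _ _) _.
  have hx : nm x < dl by lra.
  have -> : e = (e / 4 * (2 * expR s0)) * (2 * expR (- s0)).
    have -> : e / 4 * (2 * expR s0) * (2 * expR (- s0)) = e * (expR s0 * expR (- s0)) by field.
    by rewrite expRxMexpNx_1 mulr1.
  rewrite ler_pM ?nm_ge0 //; apply: le_trans (hd _ hx) _.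
  by rewrite ler_pM2l //; lra.
have key k1 k2 : `|k1| + `|k2| <= 1 ->
    k1 * complex.Re (df 0) + k2 * complex.Im (df 0) <= 4 * M.
  move=> kk; apply/ler_addgt0Pr => e e0.
  have [s0 s00 hs0] := near0 e e0.
  have LB (z : R[i]) : `|k1 * complex.Re z + k2 * complex.Im z| <= nm z.
    rewrite /nm; have := ler_normD (k1 * complex.Re z) (k2 * complex.Im z).
    rewrite !normrM.
    move: (normr_ge0 k1) (normr_ge0 k2) (normr_ge0 (complex.Re z)) (normr_ge0 (complex.Im z)).
    nra.
  have [Q0 [Q1 [h0 h1 E]]] := circle_mean k1 k2 s00.
  have B1 := mvt_bound (ltW pi0) h1 (e := 4 * M) (fun t _ => le_trans (LB _) (H0 t)).
  set k := k1 * complex.Re (df 0) + k2 * complex.Im (df 0).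
  have B0 : `|Q0 (2 * pi) - Q0 0 - (k * (2 * pi - 0) + 0 * ((2 * pi - 0) ^+ 2 - (0 - 0) ^+ 2) /
    2)| <= e * (2 * pi - 0).
    apply: (mvt_affine_bound (ltW pi0) h0) => t _.
    rewrite mul0r subr0; apply: le_trans (hs0 t); apply: le_trans (LB _).
    by rewrite le_eqVlt; apply/orP; left; apply/eqP; congr `|_|;
      rewrite cReD cImD cReN cImN /k; ring.
  rewrite mul0r mul0r addr0 !subr0 in B0 B1.
  move: B0 B1; rewrite E !ler_norml => /andP[b1 _] /andP[_ b2].
  have : k * (2 * pi) <= (4 * M + e) * (2 * pi).
    by clearbody k; lra.
  by rewrite ler_pM2r.
have := key 1 0; have := key (-1) 0; have := key 0 1; have := key 0 (-1).
rewrite !(normr1, normr0, normrN, addr0, add0r, mul0r, mul1r, mulN1r) => /(_ (lexx 1)) a1 /(_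
  (lexx 1)) a2 /(_ (lexx 1)) a3 /(_ (lexx 1)) a4.
have hR : `|complex.Re (df 0)| <= 4 * M by rewrite ler_norml; apply/andP; split; lra.
have hI : `|complex.Im (df 0)| <= 4 * M by rewrite ler_norml; apply/andP; split; lra.
rewrite /nm; lra.
Qed.

End Estimate.
End Cauchy.

(** * Holomorphic and directional derivatives *)

Section HolomorphicMaps.
Context {R : realType} {n : nat}.
Local Notation V := 'rV[R[i]]_n.

Lemma normr_nrm (v : V) : `|v| <= (nrm v)%:C.
Proof.
rewrite (_ : `|v| = mx_norm v) //.
have [->|v0] := eqVneq (mx_norm v) 0; first by rewrite ler0c nrm_ge0.
have [[i j] /= ij] := mx_norm_neq0 v0.
rewrite ij; apply: le_trans (normc_nm _) _.
by rewrite lecR ord1 nm_le_nrm.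
Qed.

Lemma nrm_normr (v : V) : (nrm v)%:C <= (n * 2)%:R * `|v|.
Proof.
rewrite /nrm rmorph_sum /=.
apply: (@le_trans _ _ (\sum_(j < n) 2 * `|v|)).
  apply: ler_sum => j _; apply: le_trans (nm_normc _) _.
  rewrite ler_pM2l // (_ : `|v| = mx_norm v) // mx_normE.
  have -> : `|v 0 j| = (`|v 0 j|%:nng)%:num by [].
  by rewrite num_le; exact: (@le_bigmax _ _ _ _ (fun ij : 'I_1 * 'I_n => `|v ij.1 ij.2|%:nng)
    (0, j)).
by rewrite sumr_const card_ord -[leLHS]mulr_natl natrM -mulrA.
Qed.

Lemma continuous_nrmP (f : V -> R) z : {for z, continuous f} <->
  forall e, 0 < e -> exists2 dl, 0 < dl & forall y, nrm (y - z) < dl -> `|f y - f z| < e.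
Proof.
split=> [cf e e0|H].
  move/cvgrPdist_lt : cf => /(_ e e0) /nbhs_nrm[dl dl0 h].
  by exists dl => // y /h; rewrite distrC.
apply/(@cvgrPdist_lt _ _ _ (nbhs z)) => e e0; apply/nbhs_nrm; have [dl dl0 h] := H e e0.
by exists dl => // y /h; rewrite distrC.
Qed.

Lemma differentiable_nrm (X : V -> V) z : differentiable X z ->
  forall e, 0 < e -> exists2 dl, 0 < dl & forall w, nrm w < dl ->
    nrm (X (z + w) - X z - 'd X z w) <= e * nrm w.
Proof.
move=> /diff_locally /eqaddoP H e e0.
have N0 : 0 < (n * 2).+1%:R :> R by rewrite ltr0n.
have e' : 0 < (e / (n * 2).+1%:R)%:C :> R[i] by rewrite ltcR divr_gt0.
have /nbhs_nrm[dl dl0 hd] := H _ e'.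
exists dl => // w wdl; have := hd w; rewrite subr0 => /(_ wdl) /=.
rewrite !fctE /= (addrC w z) opprD addrA => h; rewrite -lecR.
apply: le_trans (nrm_normr _) _.
apply: (@le_trans _ _ ((n * 2).+1%:R * ((e / (n * 2).+1%:R)%:C * (nrm w)%:C))).
  apply: ler_pM => //; first by rewrite ler_nat.
  by apply: le_trans h _; rewrite ler_pM2l // normr_nrm.
have -> : ((n * 2).+1%:R : R[i]) = ((n * 2).+1%:R : R)%:C by rewrite rmorph_nat.
by rewrite -!rmorphM /= mul_divK.
Qed.

Lemma diff_nrm_continuous (X : V -> V) z : differentiable X z ->
  forall e, 0 < e -> exists2 dl, 0 < dl & forall w, nrm w < dl -> nrm (X (z + w) - X z) < e.
Proof.
move=> /differentiable_continuous cX e e0.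
have N0 : 0 < (n * 2).+1%:R :> R by rewrite ltr0n.
have e' : 0 < (e / (n * 2).+1%:R)%:C :> R[i] by rewrite ltcR divr_gt0.
move/cvgrPdist_lt : cX => /(_ _ e') /nbhs_nrm[dl dl0 hd].
exists dl => // w wdl; have := hd (z + w); rewrite addrC addKr => /(_ wdl) h.
rewrite nrmBC -ltcR; apply: le_lt_trans (nrm_normr _) _.
apply: (@le_lt_trans _ _ ((n * 2).+1%:R * `|X z - X (z + w)|)).
  by rewrite ler_wpM2r ?normr_ge0 // ler_nat.
apply: (@lt_le_trans _ _ ((n * 2).+1%:R * (e / (n * 2).+1%:R)%:C)).
  by rewrite ltr_pM2l ?ltr0n.
have -> : ((n * 2).+1%:R : R[i]) = ((n * 2).+1%:R : R)%:C by rewrite rmorph_nat.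
by rewrite -rmorphM /= mulrC divfK // gt_eqF.
Qed.

Lemma nrm_delta (j : 'I_n) : nrm (delta_mx 0 j : V) = 1.
Proof.
rewrite /nrm (bigD1 j) //= big1 => [|k kj]; last by rewrite mxE (negPf kj) andbF nm0.
by rewrite mxE !eqxx addr0 /nm /= normr1 normr0 addr0.
Qed.

Lemma cder_along_line (X : V -> V) (z v : V) (r : R) c j : differentiable X (z + (r%:C * c) *:
  v) ->
  cder (fun w => X (z + (r%:C * w) *: v) 0 j) c (r%:C * 'd X (z + (r%:C * c) *: v) v 0 j).
Proof.
move=> dX e e0.
have K0 : 0 < `|r| * nrm v + 1 by rewrite ltr_wpDl // mulr_ge0 ?nrm_ge0.
have [dl dl0 hd] := differentiable_nrm dX (divr_gt0 e0 K0).
exists (dl / (`|r| * nrm v + 1)) => [|w]; first by rewrite divr_gt0.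
rewrite ltr_pdivlMr // => wd; pose u := (r%:C * w) *: v.
have nu : nrm u <= nm w * (`|r| * nrm v + 1).
  apply: le_trans (nrmZ _ _) _; rewrite nmMr.
  by have := nm_ge0 w; rewrite (_ : nm w * _ = `|r| * nm w * nrm v + nm w); [lra|ring].
have -> : z + (r%:C * (c + w)) *: v = z + (r%:C * c) *: v + u.
  by rewrite mulrDr scalerDl addrA.
have := hd u (le_lt_trans nu wd).
set A := X (_ + u); set B := X _ => h.
have -> : A 0 j - B 0 j - r%:C * 'd X (z + (r%:C * c) *: v) v 0 j * w =
   (A - B - 'd X (z + (r%:C * c) *: v) u) 0 j.
  have -> : 'd X (z + (r%:C * c) *: v) u = (r%:C * w) *: 'd X (z + (r%:C * c) *: v) v by exact:
    linearZ.
  by rewrite !mxE; ring.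
apply: le_trans (nm_le_nrm _ _) _; apply: le_trans h _.
apply: (@le_trans _ _ (e / (`|r| * nrm v + 1) * (nm w * (`|r| * nrm v + 1)))).
  by rewrite ler_pM2l // divr_gt0.
by rewrite (mulrC (nm w)) mulrA divfK // gt_eqF.
Qed.

(** Complex differentiability alone gives no continuity of the differential; the local bound comes
    from the Cauchy estimate along each coordinate axis, fed by the local boundedness of [X]. *)
Lemma diff_locally_bounded (Om : set V) (X : V -> V) z0 : open Om -> Om z0 ->
  (forall z, Om z -> differentiable X z) ->
  exists B dl, [/\ 0 <= B, 0 < dl & forall z, nrm (z - z0) < dl -> Om z /\
    nrm (X z) <= B /\ forall v, nrm ('d X z v) <= B * nrm v].
Proof.
move=> oOm Oz0 dX.
have [d1 d10 H1] : exists2 d1 : R, 0 < d1 & forall z, nrm (z - z0) < d1 -> Om z.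
  by have /nbhs_nrm[d d0 h] := open_nbhs_nbhs (conj oOm Oz0); exists d.
have [d2 d20 H2] := diff_nrm_continuous (dX _ Oz0) ltr01.
pose rho := Num.min d1 d2.
have rho0 : 0 < rho by rewrite lt_min d10.
pose M := nrm (X z0) + 1.
have M0 : 0 <= M by rewrite addr_ge0 ?nrm_ge0.
have H z : nrm (z - z0) < rho -> Om z /\ nrm (X z) <= M.
  rewrite lt_min => /andP[/H1 h1 h2]; split=> //.
  have := H2 _ h2; rewrite (addrC z0) subrK => /ltW h.
  by rewrite -(subrK (X z0) (X z)); apply: le_trans (nrmD _ _) _; rewrite addrC lerD2l.
(* A point of [square] has [nm] at most 2, so the parametrized square moves [z] by at most
   [rho / 4]; as [z] lies within [rho / 2] of [z0], everything stays within [rho]. *)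
pose r := rho / 8; have r0 : 0 < r by rewrite divr_gt0.
pose B := M + n%:R * (8 * M) / r.
have nB : 0 <= n%:R * (8 * M) / r by apply: divr_ge0; [rewrite !mulr_ge0 ?ler0n|exact: ltW].
exists B, (rho / 2); split=> [||z zd]; [by rewrite addr_ge0|by rewrite divr_gt0|].
have [Oz Xz] : Om z /\ nrm (X z) <= M by apply: H; lra.
split=> //; split; first by rewrite /B; lra.
have line c i : square c -> nrm (z + (r%:C * c) *: delta_mx 0 i - z0) < rho.
  move=> [c1 c2]; rewrite addrAC; apply: le_lt_trans (nrmD _ _) _.
  have := nrmZ (r%:C * c) (delta_mx 0 i : V); rewrite nrm_delta mulr1 nmMr gtr0_norm // /nm.
  have : r * (`|complex.Re c| + `|complex.Im c|) <= r * 2 by rewrite ler_pM2l //; lra.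
  rewrite /r; lra.
have Lb i : nrm ('d X z (delta_mx 0 i : V)) <= n%:R * (8 * M) / r.
  have -> : n%:R * (8 * M) / r = \sum_(j < n) (8 * M / r) by rewrite sumr_const card_ord -mulrA
    mulr_natl.
  apply: ler_sum => j _.
  rewrite ler_pdivlMr // mulrC.
  have := @cauchy_estimate R (fun c => X (z + (r%:C * c) *: delta_mx 0 i) 0 j)
    (fun c => r%:C * 'd X (z + (r%:C * c) *: delta_mx 0 i) (delta_mx 0 i : V) 0 j) M.
  rewrite mulr0 scale0r addr0 nmMr gtr0_norm //; apply.
    by move=> c cs; apply: cder_along_line; apply: dX; exact: (H _ (line c i cs)).1.
  by move=> c cs; apply: le_trans (nm_le_nrm _ _) _; exact: (H _ (line c i cs)).2.
by apply: linear_nrm_bound => i; apply: le_trans (Lb i) _; rewrite /B; lra.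
Qed.

End HolomorphicMaps.

(** * Directional derivatives and real coordinates *)

Section DirectionalDerivatives.
Context {R : realType} {n : nat}.
Local Notation V := 'rV[R[i]]_n.
Local Notation m := (n + n)%N.

Lemma real_lineD (z v : V) s t : real_line (real_line z v s) v t = real_line z v (s + t).
Proof. by rewrite /real_line rmorphD scalerDl addrA. Qed.

Lemma real_line0 (z v : V) : real_line z v 0 = z.
Proof. by rewrite /real_line scale0r addr0. Qed.

Lemma real_lineZ (z v : V) c t : real_line z (c%:C *: v) t = real_line z v (t * c).
Proof. by rewrite /real_line scalerA -rmorphM. Qed.

Lemma is_derive_line_shift (f : V -> R) (z v : V) (s d : R) :
  is_derive (0 : R) 1 (fun t => f (real_line (real_line z v s) v t)) d ->
  is_derive s 1 (fun t => f (real_line z v t)) d.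
Proof.
move=> /is_derive_epsP H; apply/is_derive_epsP => e e0.
have [dl dl0 hd] := H e e0; exists dl; first exact: dl0.
move=> h /hd.
by rewrite !real_lineD addr0 add0r.
Qed.

Lemma is_derive_line_scale (f : V -> R) (z v : V) (c d : R) :
  is_derive (0 : R) 1 (fun t => f (real_line z v t)) d ->
  is_derive (0 : R) 1 (fun t => f (real_line z (c%:C *: v) t)) (c * d).
Proof.
move=> /is_derive_epsP H; apply/is_derive_epsP => e e0.
have c0 : 0 < `|c| + 1 by rewrite ltr_wpDl.
have [dl dl0 hd] := H (e / (`|c| + 1)) (divr_gt0 e0 c0).
exists (dl / (`|c| + 1)) => [|h]; first by rewrite divr_gt0.
rewrite ltr_pdivlMr // => hdl.
have hc : `|h * c| <= `|h| * (`|c| + 1) by rewrite normrM ler_wpM2l // lerDl.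
have := hd (h * c) (le_lt_trans hc hdl).
rewrite !real_lineZ !add0r mul0r (_ : c * d * h = d * (h * c)); last by ring.
move/le_trans; apply; apply: (@le_trans _ _ (e / (`|c| + 1) * (`|h| * (`|c| + 1)))).
  by rewrite ler_pM2l // divr_gt0.
by rewrite (mulrC `|h|) mulrA divfK // gt_eqF.
Qed.

Lemma split_lshift (i : 'I_n) : fintype.split (lshift n i) = inl i.
Proof. by rewrite -[RHS](unsplitK (inl i)). Qed.

Lemma split_rshift (i : 'I_n) : fintype.split (rshift n i) = inr i.
Proof. by rewrite -[RHS](unsplitK (inr i)). Qed.

Lemma rcoord0 a : rcoord (0 : V) a = 0.
Proof. by rewrite /rcoord; case: fintype.split => j; rewrite mxE. Qed.

Lemma rcoordN (u : V) a : rcoord (- u) a = - rcoord u a.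
Proof. by rewrite /rcoord; case: fintype.split => j; rewrite mxE ?cReN ?cImN. Qed.

Lemma rcoordD (u v : V) a : rcoord (u + v) a = rcoord u a + rcoord v a.
Proof. by rewrite /rcoord; case: fintype.split => j; rewrite mxE ?cReD ?cImD. Qed.

Lemma rcoordZ c (u : V) a : rcoord (c%:C *: u) a = c * rcoord u a.
Proof. by rewrite /rcoord; case: fintype.split => j;
  rewrite mxE ?cReM ?cImM /= !mul0r ?subr0 ?addr0. Qed.

Lemma rcoord_le (u : V) a : `|rcoord u a| <= nrm u.
Proof.
by rewrite /rcoord; case: fintype.split => j; apply: le_trans (nm_le_nrm u j);
  [exact: ReZ_le|exact: ImZ_le].
Qed.

Lemma rcoord_sum (u : V) : u = \sum_a (rcoord u a)%:C *: frame a.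
Proof.
rewrite big_split_ord /=.
rewrite -big_split /= [LHS]row_sum_delta; apply: eq_bigr => j _.
rewrite /rcoord /frame split_lshift split_rshift scalerA -scalerDl; congr (_ *: _).
by rewrite [LHS]complexE mulrC.
Qed.

Lemma nrm_frame a : nrm (frame a : V) = 1.
Proof.
rewrite /frame; case: fintype.split => j; rewrite ?nrm_delta //.
rewrite -(nrm_delta j); apply: eq_bigr => k _; by rewrite mxE nm_i.
Qed.

Lemma nrm_real_line (z v : V) t : nrm (real_line z v t - z) = `|t| * nrm v.
Proof. by rewrite /real_line addrC addKr nrmZr. Qed.

(* Induction on the number of coordinates moved, with the mean value theorem in each. *)
Lemma Ck1_is_derive (Om : set V) (f : V -> R) z u : open Om -> Ck 1 Om f -> Om z ->
  is_derive (0 : R) 1 (fun t => f (real_line z u t)) (\sum_a rcoord u a * pd a f z).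
Proof.
move=> oOm [_ Cf] Oz.
have [d0 d00 HO] : exists2 d : R, 0 < d & forall y, nrm (y - z) < d -> Om y.
  by have /nbhs_nrm[d d0 h] := open_nbhs_nbhs (conj oOm Oz); exists d.
pose up k : V := \sum_(a < m | (a < k)%N) (rcoord u a)%:C *: frame a.
suff H k : (k <= m)%N -> is_derive (0 : R) 1 (fun t => f (real_line z (up k) t))
    (\sum_(a < m | (a < k)%N) rcoord u a * pd a f z).
  have := H m (leqnn m).
  have -> : up m = u by rewrite [RHS]rcoord_sum /up; apply: eq_bigl => a; rewrite ltn_ord.
  by under eq_bigl do rewrite ltn_ord.
elim: k => [_|k IH km].
  rewrite /up !big_pred0 // /real_line.
  under eq_fun do rewrite scaler0 addr0.
  exact: is_derive_cst.
pose b : 'I_m := Ordinal km.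
have split_sum (T : zmodType) (F : 'I_m -> T) :
    \sum_(a < m | (a < k.+1)%N) F a = \sum_(a < m | (a < k)%N) F a + F b.
  rewrite (bigD1 b) /= ?ltnSn // addrC; congr (_ + _); apply: eq_bigl => a.
  by rewrite ltnS ltn_neqAle andbC.
have -> : up k.+1 = up k + (rcoord u b)%:C *: frame b by exact: split_sum.
rewrite split_sum; have {}IH := IH (ltnW km).
move/is_derive_epsP : IH => IH; apply/is_derive_epsP => e e0.
set c := rcoord u b; set w := up k.
have c0 : 0 < `|c| + 1 by rewrite ltr_wpDl.
have e2 : 0 < e / 2 by lra.
have e3 : 0 < e / 2 / (`|c| + 1) by rewrite divr_gt0.
have [d1 d10 H1] := IH _ e2.
have [db [cb _]] := Cf b.
have [d2 d20 H2] := (continuous_nrmP _ _).1 (cb _ Oz) _ e3.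
pose K := nrm w + `|c| + 1.
have K0 : 0 < K by rewrite ltr_wpDl // addr_ge0 ?nrm_ge0.
exists (Num.min d1 (Num.min d0 d2 / K)) => [|h];
  first by rewrite lt_min d10 divr_gt0 // lt_min d00.
rewrite lt_min ltr_pdivlMr // lt_min add0r => /andP[h1 /andP[h0 h2]].
have := H1 h h1; rewrite add0r !real_line0 => A.
have near t : 0 <= t <= 1 -> nrm (real_line (real_line z w h) ((h * c)%:C *: frame b) t - z) <=
  `|h| * K.
  move=> /andP[t0 t1]; rewrite -(subrKA (real_line z w h)); apply: le_trans (nrmD _ _) _.
  rewrite !nrm_real_line nrmZr nrm_frame mulr1 (ger0_norm t0) normrM /K.
  have : t * (`|h| * `|c|) <= `|h| * `|c| by rewrite ler_piMl // mulr_ge0.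
  have : 0 <= `|h| by [].
  by rewrite !mulrDr mulr1; lra.
(* The last coordinate is moved at the displaced point, where the derivative is not [pd b f z];
   continuity of [pd b f] at [z] makes the discrepancy small along the whole segment. *)
have B : `|f (real_line (real_line z w h) ((h * c)%:C *: frame b) 1) -
     f (real_line (real_line z w h) ((h * c)%:C *: frame b) 0) -
     ((h * c * pd b f z) * (1 - 0) + 0 * ((1 - 0) ^+ 2 - (0 - 0) ^+ 2) / 2)| <=
     (`|h| * (e / 2)) * (1 - 0).
  apply: (@mvt_affine_bound R (fun t => f (real_line (real_line z w h) ((h * c)%:C *: frame b) t))
    (fun t => h * c * pd b f (real_line (real_line z w h) ((h * c)%:C *: frame b) t)) 0 1 0) =>
      //.
    move=> t tI; apply: is_derive_line_shift; apply: is_derive_line_scale.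
    have Oy := HO _ (le_lt_trans (near t tI) h0).
    apply: (DeriveDef (db _ Oy)).
    by rewrite /pd /dirD derive1E.
  move=> t tI; rewrite mul0r subr0 -mulrBr normrM normrM -mulrA ler_wpM2l //.
  apply: (@le_trans _ _ ((`|c| + 1) * (e / 2 / (`|c| + 1)))).
    by rewrite ler_pM ?lerDl // ltW // H2 // (le_lt_trans (near t tI)).
  by rewrite mulrC divfK // gt_eqF.
have E1 : real_line (real_line z w h) ((h * c)%:C *: frame b) 1 = real_line z (w + c%:C *:
  frame b) h.
  by rewrite /real_line scale1r scalerDr addrA scalerA -rmorphM.
move: B; rewrite E1 !real_line0 mul0r mul0r addr0 subr0 !mulr1 => B.
have -> : f (real_line z (w + c%:C *: frame b) h) - f z -
   (\sum_(a < m | (a < k)%N) rcoord u a * pd a f z + c * pd b f z) * h =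
   (f (real_line z (w + c%:C *: frame b) h) - f (real_line z w h) - h * c * pd b f z) +
   (f (real_line z w h) - f z - (\sum_(a < m | (a < k)%N) rcoord u a * pd a f z) * h).
  by ring.
by apply: le_trans (ler_normD _ _) _; move: A B; lra.
Qed.

Lemma Ck1_derivative_bounded (Om : set V) (f : V -> R) z0 : Ck 1 Om f -> Om z0 ->
  exists B dl, [/\ 0 <= B, 0 < dl & forall z, nrm (z - z0) < dl ->
    forall u, `|\sum_a rcoord u a * pd a f z| <= B * nrm u].
Proof.
move=> [_ Cf] Oz.
have H a : exists d, 0 < d /\ forall y, nrm (y - z0) < d -> `|pd a f y| <= `|pd a f z0| + 1.
  have [_ [ca _]] := Cf a; have [d d0 h] := (continuous_nrmP _ _).1 (ca _ Oz) _ ltr01.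
  exists d; split=> // y /h /ltW hy; rewrite -(subrK (pd a f z0) (pd a f y)).
  by apply: le_trans (ler_normD _ _) _; rewrite addrC lerD2l.
pose d a := projT1 (cid (H a)); have dP a := projT2 (cid (H a)).
exists (\sum_a (`|pd a f z0| + 1)), (\big[Num.min/1]_a d a); split.
- by apply: sumr_ge0 => a _; rewrite addr_ge0.
- elim/big_ind: _ => // [x y x0 y0|a _]; [by rewrite lt_min x0|exact: (dP a).1].
move=> z zd u; apply: le_trans (ler_norm_sum _ _ _) _; rewrite mulr_suml; apply: ler_sum => a _.
rewrite normrM mulrC ler_pM ?rcoord_le //; apply: (dP a).2; apply: lt_le_trans zd _.
exact: bigmin_le.
Qed.

End DirectionalDerivatives.

Section CurveDerivatives.
Context {R : realType}.

Definition curve_der (c : R -> R[i]) (d : R[i]) : Prop :=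
  is_derive (0 : R) 1 (fun t => complex.Re (c t)) (complex.Re d) /\
  is_derive (0 : R) 1 (fun t => complex.Im (c t)) (complex.Im d).

Lemma curve_der_cst a : curve_der (fun=> a) 0.
Proof. by split; exact: is_derive_cst. Qed.

Lemma curve_derD c1 c2 d1 d2 : curve_der c1 d1 -> curve_der c2 d2 ->
  curve_der (fun t => c1 t + c2 t) (d1 + d2).
Proof.
move=> [r1 i1] [r2 i2]; split.
  under eq_fun do rewrite cReD.
  by rewrite cReD; exact: is_deriveD.
under eq_fun do rewrite cImD.
by rewrite cImD; exact: is_deriveD.
Qed.

Lemma curve_derM c1 c2 d1 d2 : curve_der c1 d1 -> curve_der c2 d2 ->
  curve_der (fun t => c1 t * c2 t) (d1 * c2 0 + c1 0 * d2).
Proof.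
move=> [r1 i1] [r2 i2]; split.
  under eq_fun do rewrite cReM.
  rewrite cReD !cReM; apply: is_derive_eq; rewrite /GRing.scale /=; ring.
under eq_fun do rewrite cImM.
rewrite cImD !cImM; apply: is_derive_eq; rewrite /GRing.scale /=; ring.
Qed.

Lemma curve_der_conj c d : curve_der c d -> curve_der (fun t => (c t)^*) d^*.
Proof.
have Rj (x : R[i]) : complex.Re x^* = complex.Re x by case: x.
have Ij (x : R[i]) : complex.Im x^* = - complex.Im x by case: x.
move=> [r i]; split.
  by under eq_fun do rewrite Rj; rewrite Rj.
by under eq_fun do rewrite Ij; rewrite Ij; exact: is_deriveN.
Qed.

Lemma curve_der_sum (I : Type) (r : seq I) (c : I -> R -> R[i]) d :
  (forall i, curve_der (c i) (d i)) ->
  curve_der (fun t => \sum_(i <- r) c i t) (\sum_(i <- r) d i).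
Proof.
move=> H; elim: r => [|i r IH].
  under eq_fun do rewrite big_nil.
  by rewrite big_nil; exact: curve_der_cst.
under eq_fun do rewrite big_cons.
by rewrite big_cons; exact: curve_derD.
Qed.

End CurveDerivatives.

(** * Sesquilinear forms and their real parts *)

Section Forms.
Context {R : realType} {n : nat}.
Local Notation V := 'rV[R[i]]_n.
Implicit Types (h : 'M[R[i]]_n) (u v w : V).

Definition sesq h u v : R[i] := \sum_i \sum_j h i j * u 0 i * (v 0 j)^*.
Definition rf h u v : R := 2 * complex.Re (sesq h u v).

Lemma realformE g (z u v : V) : realform g z u v = rf (g z) u v. Proof. by []. Qed.

Lemma sesqDl h u u' v : sesq h (u + u') v = sesq h u v + sesq h u' v.
Proof.
rewrite -big_split; apply: eq_bigr => i _; rewrite -big_split; apply: eq_bigr => j _ /=.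
by rewrite mxE mulrDr mulrDl.
Qed.
Lemma sesqDr h u v v' : sesq h u (v + v') = sesq h u v + sesq h u v'.
Proof.
rewrite -big_split; apply: eq_bigr => i _; rewrite -big_split; apply: eq_bigr => j _ /=.
by rewrite mxE rmorphD mulrDr.
Qed.
Lemma sesqZl h c u v : sesq h (c *: u) v = c * sesq h u v.
Proof.
rewrite mulr_sumr; apply: eq_bigr => i _; rewrite mulr_sumr; apply: eq_bigr => j _ /=.
by rewrite mxE; ring.
Qed.
Lemma sesqZr h c u v : sesq h u (c *: v) = c^* * sesq h u v.
Proof.
rewrite mulr_sumr; apply: eq_bigr => i _; rewrite mulr_sumr; apply: eq_bigr => j _ /=.
by rewrite mxE rmorphM /=; ring.
Qed.
Lemma sesqDm h h' u v : sesq (h + h') u v = sesq h u v + sesq h' u v.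
Proof.
rewrite -big_split; apply: eq_bigr => i _; rewrite -big_split; apply: eq_bigr => j _ /=.
by rewrite mxE !mulrDl.
Qed.
Lemma sesqZm c h u v : sesq (c *: h) u v = c * sesq h u v.
Proof.
rewrite mulr_sumr; apply: eq_bigr => i _; rewrite mulr_sumr; apply: eq_bigr => j _ /=.
by rewrite mxE; ring.
Qed.
Lemma sesq_herm h u v : (forall i j, h j i = (h i j)^*) -> sesq h v u = (sesq h u v)^*.
Proof.
move=> hh; rewrite /sesq exchange_big /= rmorph_sum; apply: eq_bigr => i _.
rewrite rmorph_sum; apply: eq_bigr => j _ /=; rewrite !rmorphM /= -hh conjcK; ring.
Qed.

Lemma rfDl h u u' v : rf h (u + u') v = rf h u v + rf h u' v.
Proof. by rewrite /rf sesqDl cReD mulrDr. Qed.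
Lemma rfDr h u v v' : rf h u (v + v') = rf h u v + rf h u v'.
Proof. by rewrite /rf sesqDr cReD mulrDr. Qed.
Lemma rfDm h h' u v : rf (h + h') u v = rf h u v + rf h' u v.
Proof. by rewrite /rf sesqDm cReD mulrDr. Qed.
Lemma rfZl h (c : R) u v : rf h (c%:C *: u) v = c * rf h u v.
Proof. by rewrite /rf sesqZl cReM /=; ring. Qed.
Lemma rfZr h (c : R) u v : rf h u (c%:C *: v) = c * rf h u v.
Proof. by rewrite /rf sesqZr cReM /=; ring. Qed.
Lemma rfZm (c : R) h u v : rf (c%:C *: h) u v = c * rf h u v.
Proof. by rewrite /rf sesqZm cReM /=; ring. Qed.
Lemma rf0l h v : rf h 0 v = 0.
Proof. by rewrite -[0](scale0r (0 : V)) rfZl mul0r. Qed.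
Lemma rf0r h v : rf h v 0 = 0.
Proof. by rewrite -[0](scale0r (0 : V)) rfZr mul0r. Qed.
Lemma rf_il h u v : rf h ('i *: u) v = - rf h u ('i *: v).
Proof. by rewrite /rf sesqZl sesqZr !cReM /=; ring. Qed.
Lemma rfC h u v : (forall i j, h j i = (h i j)^*) -> rf h v u = rf h u v.
Proof. by move=> hh; rewrite /rf (sesq_herm _ _ hh); case: (sesq h u v). Qed.
Lemma rf_i0 h u : (forall i j, h j i = (h i j)^*) -> rf h u ('i *: u) = 0.
Proof. by move=> hh; have := rf_il h u u; rewrite rfC //; lra. Qed.
Lemma rf_scale h c u : rf h (c *: u) (c *: u) = (complex.Re c ^+ 2 + complex.Im c ^+ 2) * rf h
  u u.
Proof.
rewrite /rf sesqZl sesqZr mulrA !cReM /=; case: (sesq h u u) => a b; case: c => x y /=; ring.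
Qed.

Definition mx_nm h : R := \sum_i \sum_j nm (h i j).

Lemma mx_nm_ge0 h : 0 <= mx_nm h.
Proof. by apply: sumr_ge0 => i _; apply: sumr_ge0 => j _; exact: nm_ge0. Qed.
Lemma mx_nmD h h' : mx_nm (h + h') <= mx_nm h + mx_nm h'.
Proof.
rewrite /mx_nm -big_split; apply: ler_sum => i _.
by rewrite -big_split; apply: ler_sum => j _ /=; rewrite mxE nmD.
Qed.
Lemma mx_nmBC h h' : mx_nm (h - h') = mx_nm (h' - h).
Proof. by apply: eq_bigr => i _; apply: eq_bigr => j _; rewrite -opprB mxE nmN. Qed.

Lemma rf_bound h u v : `|rf h u v| <= 2 * (mx_nm h * nrm u * nrm v).
Proof.
rewrite /rf normrM normr_nat ler_pM2l //; apply: le_trans (ReZ_le _) _.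
apply: le_trans (nm_sum _) _; rewrite /mx_nm !mulr_suml; apply: ler_sum => i _.
apply: le_trans (nm_sum _) _; rewrite !mulr_suml; apply: ler_sum => j _.
apply: le_trans (nmM _ _) _; rewrite nm_conj ler_pM ?nm_ge0 ?nm_le_nrm //.
by apply: le_trans (nmM _ _) _; rewrite ler_wpM2l ?nm_ge0 ?nm_le_nrm.
Qed.

(** Polarization: replacing [u] by ['i *: u] turns the real part of the sesquilinear form into its
    imaginary part, and the values on basis vectors are the matrix entries. *)
Lemma rf_inj h h' : (forall u v, rf h u v = rf h' u v) -> h = h'.
Proof.
move=> H; apply/matrixP => a b.
have E k u v : sesq k u v = (rf k u v / 2) +i* (- rf k ('i *: u) v / 2).
  rewrite /rf sesqZl cReM /=; case: (sesq k u v) => x y /=.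
  by apply/eqP; rewrite eq_complex /=; apply/andP; split; apply/eqP; field.
have S k : sesq k (delta_mx 0 a) (delta_mx 0 b) = k a b.
  rewrite /sesq (bigD1 a) //= (bigD1 b) //= !big1 => [|i ia|j jb].
  - have e1 (c : 'I_n) : (delta_mx 0 c : V) 0 c = 1 by rewrite mxE !eqxx.
    by rewrite !e1 rmorph1 !mulr1 !addr0.
  - by apply: big1 => j _; rewrite !mxE (negPf ia) andbF mulr0 mul0r.
  - have e0 : (delta_mx 0 b : V) 0 j = 0 by rewrite mxE (negPf jb) andbF.
    by rewrite e0 rmorph0 mulr0.
by rewrite -(S h) -(S h') !E !H.
Qed.

Lemma is_derive_rf (h : R -> 'M[R[i]]_n) (u v : R -> V) (dh : 'M[R[i]]_n) (du dv : V) :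
  (forall i j, curve_der (fun t => h t i j) (dh i j)) ->
  (forall i, curve_der (fun t => u t 0 i) (du 0 i)) ->
  (forall i, curve_der (fun t => v t 0 i) (dv 0 i)) ->
  is_derive (0 : R) 1 (fun t => rf (h t) (u t) (v t))
    (rf dh (u 0) (v 0) + rf (h 0) du (v 0) + rf (h 0) (u 0) dv).
Proof.
move=> H U W.
have [D _] : curve_der (fun t => sesq (h t) (u t) (v t))
    (sesq dh (u 0) (v 0) + sesq (h 0) du (v 0) + sesq (h 0) (u 0) dv).
  rewrite /sesq -!big_split /=; apply: curve_der_sum => i.
  rewrite -!big_split /=; apply: curve_der_sum => j.
  have := curve_derM (curve_derM (H i j) (U i)) (curve_der_conj (W j)).
  by rewrite mulrDl.
rewrite /rf -!mulrDr -!cReD.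
apply: is_derive_eq; rewrite /GRing.scale /=; ring.
Qed.

End Forms.

(** * The length of the soliton field *)

Section Soliton.
Context {R : realType} {n : nat}.
Local Notation V := 'rV[R[i]]_n.
Variables (Om : set V) (g : V -> 'M[R[i]]_n) (X : V -> V).
Hypothesis oOm : open Om.
Hypothesis gC1 : forall i j, Ck 1 Om (fun z => complex.Re (g z i j)) /\
                             Ck 1 Om (fun z => complex.Im (g z i j)).
Hypothesis gH : forall z, Om z -> forall i j, g z j i = (g z i j)^*.
Hypothesis dX : forall z, Om z -> differentiable X z.

(** Written through partial derivatives, so that real linearity in [u] is immediate; that this is
    the derivative of [g] along [u] is [curve_der_metric]. *)
Definition dmetric z u : 'M[R[i]]_n := \matrix_(i, j)
  ((\sum_a rcoord u a * pd a (fun y => complex.Re (g y i j)) z) +i*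
   (\sum_a rcoord u a * pd a (fun y => complex.Im (g y i j)) z)).

Definition sqnorm z : R := rf (g z) (X z) (X z).
Definition dsqnorm z w : R :=
  rf (dmetric z w) (X z) (X z) + rf (g z) ('d X z w) (X z) + rf (g z) (X z) ('d X z w).

Lemma curve_der_metric z u i j : Om z ->
  curve_der (fun t => g (real_line z u t) i j) (dmetric z u i j).
Proof.
move=> Oz; have [cr ci] := gC1 i j.
by split; rewrite mxE /=; apply: Ck1_is_derive oOm _ Oz.
Qed.

Lemma curve_der_holo z u i : Om z ->
  curve_der (fun t => X (real_line z u t) 0 i) ('d X z u 0 i).
Proof.
move=> Oz; have H e : 0 < e -> exists2 dl, 0 < dl & forall h, `|h| < dl ->
   nm (X (real_line z u h) 0 i - X z 0 i - h%:C * 'd X z u 0 i) <= e * `|h|.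
  move=> e0; have c0 : 0 < nrm u + 1 by rewrite ltr_wpDl ?nrm_ge0.
  have [dl dl0 hd] := differentiable_nrm (dX Oz) (divr_gt0 e0 c0).
  exists (dl / (nrm u + 1)) => [|h]; first by rewrite divr_gt0.
  rewrite ltr_pdivlMr // => hdl.
  have nh : nrm (h%:C *: u) <= `|h| * (nrm u + 1) by rewrite nrmZr ler_wpM2l // lerDl.
  have := hd _ (le_lt_trans nh hdl) => A.
  have -> : X (real_line z u h) 0 i - X z 0 i - h%:C * 'd X z u 0 i =
     (X (z + h%:C *: u) - X z - 'd X z (h%:C *: u)) 0 i.
    have -> : 'd X z (h%:C *: u) = h%:C *: 'd X z u by exact: linearZ.
    by rewrite !mxE.
  apply: le_trans (nm_le_nrm _ _) _; apply: le_trans A _.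
  apply: (@le_trans _ _ (e / (nrm u + 1) * (`|h| * (nrm u + 1)))).
    by rewrite ler_pM2l // divr_gt0.
  by rewrite (mulrC `|h|) mulrA divfK // gt_eqF.
split; apply/is_derive_epsP => e e0; have [dl dl0 hd] := H e e0;
  exists dl; rewrite ?dl0 // => h /hd; apply: le_trans; rewrite add0r real_line0.
  apply: le_trans (ReZ_le _); rewrite !cReD !cReN cReM /= mul0r subr0 mulrC //.
by apply: le_trans (ImZ_le _); rewrite !cImD !cImN cImM /= mul0r addr0 mulrC.
Qed.

Lemma dirDV_holo z u : Om z -> dirDV u X z = 'd X z u.
Proof.
move=> Oz; apply/rowP => j; rewrite mxE /dirDC /dirD !derive1E.
have [dr di] := curve_der_holo u j Oz.
rewrite (derive_val (is_derive := dr)) (derive_val (is_derive := di)).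
by case: ('d X z u 0 j).
Qed.

Lemma dirD_realform z u x v : Om z ->
  dirD u (fun y => realform g y x v) z = rf (dmetric z u) x v.
Proof.
move=> Oz; rewrite /dirD derive1E.
have D := @is_derive_rf R n (fun t => g (real_line z u t)) (fun=> x) (fun=> v)
  (dmetric z u) 0 0 (fun i j => curve_der_metric u i j Oz)
  (fun i => _) (fun i => _).
have c0 (y : V) i : curve_der (fun=> y 0 i) ((0 : V) 0 i) by rewrite mxE; exact: curve_der_cst.
have := D (c0 x) (c0 v) => {}D.
rewrite (derive_val (is_derive := D)).
by rewrite rf0l rf0r !addr0.
Qed.

Lemma dirD_flat z u v : Om z ->
  dirD u (fun y => flat (realform g) X y v) z =
  rf (dmetric z u) (X z) v + rf (g z) ('d X z u) v.
Proof.
move=> Oz; rewrite /dirD derive1E.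
have c0 (y : V) i : curve_der (fun=> y 0 i) ((0 : V) 0 i) by rewrite mxE; exact: curve_der_cst.
have D := @is_derive_rf R n (fun t => g (real_line z u t)) (fun t => X (real_line z u t))
  (fun=> v) (dmetric z u) ('d X z u) 0 (fun i j => curve_der_metric u i j Oz)
  (fun i => curve_der_holo u i Oz) (c0 v).
rewrite (derive_val (is_derive := D)) real_line0.
by rewrite rf0r !addr0.
Qed.

Lemma is_derive_sqnorm z w : Om z ->
  is_derive (0 : R) 1 (fun t => sqnorm (real_line z w t)) (dsqnorm z w).
Proof.
move=> Oz.
have D := @is_derive_rf R n (fun t => g (real_line z w t)) (fun t => X (real_line z w t))
  (fun t => X (real_line z w t)) (dmetric z w) ('d X z w) ('d X z w)
  (fun i j => curve_der_metric w i j Oz)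
  (fun i => curve_der_holo w i Oz) (fun i => curve_der_holo w i Oz).
by rewrite real_line0 in D.
Qed.

(** Hermitian symmetry of [g] is differentiated along a line. It is known only in [Om], hence only
    for small times, so uniqueness of the derivative is used in a local form. *)
Lemma dmetric_herm z u i j : Om z -> dmetric z u j i = (dmetric z u i j)^*.
Proof.
move=> Oz.
have [ra ia] := curve_der_metric u i j Oz; have [rb ib] := curve_der_metric u j i Oz.
have [d d0 HO] : exists2 d : R, 0 < d & forall t, `|t| < d -> Om (real_line z u t).
  have /nbhs_nrm[d d0 h] := open_nbhs_nbhs (conj oOm Oz).
  have c0 : 0 < nrm u + 1 by rewrite ltr_wpDl ?nrm_ge0.
  exists (d / (nrm u + 1)) => [|t]; first by rewrite divr_gt0.
  rewrite ltr_pdivlMr // => hd; apply: h; rewrite nrm_real_line; apply: le_lt_trans hd.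
  by rewrite ler_wpM2l // lerDl.
have uniq (f1 f2 : R -> R) d1 d2 : (forall t, `|t| < d -> f1 t = f2 t) ->
    is_derive (0 : R) 1 f1 d1 -> is_derive (0 : R) 1 f2 d2 -> d1 = d2.
  move=> E D1 /is_derive_epsP D2; rewrite -(derive_val (is_derive := D1)).
  have D3 : is_derive (0 : R) 1 f1 d2.
    apply/is_derive_epsP => e e0; have [dl dl0 h] := D2 e e0.
    exists (Num.min d dl) => [|t]; first by rewrite lt_min d0.
    by rewrite lt_min => /andP[td /h]; rewrite add0r !E // normr0.
  by rewrite (derive_val (is_derive := D3)).
apply/eqP; rewrite eq_complex; apply/andP; split; apply/eqP.
  have -> : complex.Re (dmetric z u i j)^* = complex.Re (dmetric z u i j) by case: (dmetric z u
    i j).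
  by apply: uniq rb ra => t /HO Ot; rewrite gH //; case: (g _ i j).
have -> : complex.Im (dmetric z u i j)^* = - complex.Im (dmetric z u i j) by case: (dmetric z u
  i j).
apply: uniq ib (is_deriveN ia) => t /HO Ot; rewrite gH // fctE; by case: (g _ i j).
Qed.

Lemma dmetricD z u v : dmetric z (u + v) = dmetric z u + dmetric z v.
Proof.
apply/matrixP => i j; rewrite !mxE; apply/eqP; rewrite eq_complex /= -!big_split /=.
by apply/andP; split; apply/eqP; apply: eq_bigr => a _; rewrite rcoordD mulrDl.
Qed.

Lemma dmetricZ z c u : dmetric z (c%:C *: u) = c%:C *: dmetric z u.
Proof.
apply/matrixP => i j; rewrite !mxE; apply/eqP;
  rewrite eq_complex /= !mul0r subr0 addr0 !mulr_sumr.
by apply/andP; split; apply/eqP; apply: eq_bigr => a _; rewrite rcoordZ mulrA.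
Qed.

Lemma dsqnormD z u v : dsqnorm z (u + v) = dsqnorm z u + dsqnorm z v.
Proof.
have E : 'd X z (u + v) = 'd X z u + 'd X z v by exact: linearD.
rewrite /dsqnorm dmetricD E rfDl rfDr rfDm; ring.
Qed.

Lemma dsqnormZ z c u : dsqnorm z (c%:C *: u) = c * dsqnorm z u.
Proof.
have E : 'd X z (c%:C *: u) = c%:C *: 'd X z u by exact: linearZ.
by rewrite /dsqnorm dmetricZ E rfZl rfZr rfZm; ring.
Qed.

Section Equation.
Variable lam : R.
Hypothesis sol : forall z, Om z -> forall u v,
  realform (ricci g) z u v + lie_derivative X (realform g) z u v = lam * realform g z u v.
Hypothesis clX : closed_1form Om (flat (realform g) X).

(** Since [X, X] = 0, the Lie derivative of [g] at (X, X) is the derivative of |X|^2 along X. *)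
Lemma dsqnorm_X z : Om z -> dsqnorm z (X z) = lam * sqnorm z - realform (ricci g) z (X z) (X z).
Proof.
move=> Oz; have := sol Oz (X z) (X z).
rewrite /lie_derivative dirD_realform // dirDV_holo // !realformE -/(sqnorm z) /dsqnorm; lra.
Qed.

(* [JX] is a Killing field, so the length of [X] is constant along it. *)
Lemma dsqnorm_iX z : Om z -> dsqnorm z ('i *: X z) = 0.
Proof.
(* Closedness is tested on the pair (iX, X). The term in which [g] is differentiated along X and
   evaluated on (X, iX) vanishes, as ['i] is skew for a Hermitian form; complex linearity of the
   differential turns the rest into the derivative of |X|^2 along iX. *)
move=> Oz; have := clX Oz ('i *: X z) (X z).
rewrite !dirD_flat //.
have E : 'd X z ('i *: X z) = 'i *: 'd X z (X z) by exact: linearZ.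
rewrite (rf_i0 (X z)) => [|i j]; last exact: dmetric_herm.
rewrite add0r E rf_il /dsqnorm E rf_il.
have -> : rf (g z) (X z) ('i *: 'd X z (X z)) = - rf (g z) ('d X z (X z)) ('i *: X z).
  by rewrite -rf_il rfC //; exact: gH.
lra.
Qed.

Lemma dsqnorm_zetaX z c : Om z ->
  dsqnorm z (c *: X z) = complex.Re c * (lam * sqnorm z - realform (ricci g) z (X z) (X z)).
Proof.
move=> Oz; rewrite {1}[c]complexE scalerDl dsqnormD // mulrC -scalerA !dsqnormZ //.
by rewrite dsqnorm_iX // mulr0 addr0 dsqnorm_X.
Qed.

End Equation.
End Soliton.

(** * Uniform control of a single Euler step *)

Section LocalStep.
Context {R : realType} {n : nat}.
Local Notation V := 'rV[R[i]]_n.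
Variables (Om : set V) (g : V -> 'M[R[i]]_n) (X : V -> V).
Hypothesis oOm : open Om.
Hypothesis gC1 : forall i j, Ck 1 Om (fun z => complex.Re (g z i j)) /\
                             Ck 1 Om (fun z => complex.Im (g z i j)).
Hypothesis gH : forall z, Om z -> forall i j, g z j i = (g z i j)^*.
Hypothesis gpos : forall z, Om z -> forall u, u != 0 -> 0 < rf (g z) u u.
Hypothesis dX : forall z, Om z -> differentiable X z.

Lemma rf_ge0 z u : Om z -> 0 <= rf (g z) u u.
Proof.
move=> Oz; have [->|u0] := eqVneq u 0; last exact/ltW/gpos.
by rewrite rf0l.
Qed.

Lemma open_nrm z : Om z -> exists2 d : R, 0 < d & forall y, nrm (y - z) < d -> Om y.
Proof.
by move=> Oz; have /nbhs_nrm[d d0 h] := open_nbhs_nbhs (conj oOm Oz); exists d.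
Qed.

Lemma metric_continuous z0 e : Om z0 -> 0 < e ->
  exists2 d : R, 0 < d & forall y, nrm (y - z0) < d -> mx_nm (g y - g z0) < e.
Proof.
move=> Oz e0; pose e' := e / (n.+1%:R ^+ 2 * 2).
have N0 : 0 < n.+1%:R :> R by rewrite ltr0n.
have e'0 : 0 < e' by rewrite divr_gt0 // mulr_gt0 // exprn_gt0.
have : nbhs z0 (fun y => forall ij : 'I_n * 'I_n, nm ((g y - g z0) ij.1 ij.2) < 2 * e').
  apply: (@filter_forall V ('I_n * 'I_n)%type (fun ij y => nm ((g y - g z0) ij.1 ij.2) < 2 *
    e') (nbhs z0) _) => -[i j] /=.
  apply/(@nbhs_nrm R n).
  have [[cr _] [ci _]] := gC1 i j.
  have [d1 d10 H1] := (continuous_nrmP _ _).1 (cr _ Oz) _ e'0.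
  have [d2 d20 H2] := (continuous_nrmP _ _).1 (ci _ Oz) _ e'0.
  exists (Num.min d1 d2) => [|y]; first by rewrite lt_min d10.
  rewrite lt_min => /andP[/H1 h1 /H2 h2]; rewrite /nm !mxE cReD cImD cReN cImN; lra.
move=> /nbhs_nrm[d d0 hd]; exists d => // y /hd h.
apply: (@le_lt_trans _ _ (\sum_(i < n) \sum_(j < n) (2 * e'))).
  by apply: ler_sum => i _; apply: ler_sum => j _; exact: ltW (h (i, j)).
rewrite !sumr_const !card_ord -mulrnA -[X in X < _]mulr_natr natrM.
have -> : e = 2 * e' * (n.+1%:R * n.+1%:R).
  by rewrite /e'; move: (lt0r_neq0 N0); move: (n.+1%:R) => N N1; field.
rewrite ltr_pM2l ?mulr_gt0 // ltr_pM ?ler0n // ltr_nat ltnSn //.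
Qed.

Lemma local_bounds z0 : Om z0 -> exists B d, [/\ 0 < B, 0 < d &
  forall z, nrm (z - z0) < d -> [/\ Om z, nrm (X z) <= B, mx_nm (g z) <= B &
    forall w, `|dsqnorm g X z w| <= B * nrm w]].
Proof.
move=> Oz.
have [B1 [d1 [B10 d10 H1]]] := diff_locally_bounded oOm Oz dX.
have [d2 d20 H2] := metric_continuous Oz ltr01.
pose B2 := mx_nm (g z0) + 1.
have B20 : 0 < B2 by rewrite ltr_wpDl ?mx_nm_ge0.
have [B3 [d3 [B30 d30 H3]]] : exists B3 d3 : R, [/\ 0 <= B3, 0 < d3 &
    forall z, nrm (z - z0) < d3 -> forall w, mx_nm (dmetric g z w) <= B3 * nrm w].
  have H (ij : 'I_n * 'I_n) : exists x : R * R, [/\ 0 <= x.1, 0 < x.2 &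
     forall z, nrm (z - z0) < x.2 -> forall w, nm (dmetric g z w ij.1 ij.2) <= x.1 * nrm w].
    have [cr ci] := gC1 ij.1 ij.2.
    have [a [d [a0 d0 h]]] := Ck1_derivative_bounded cr Oz.
    have [a' [d' [a0' d0' h']]] := Ck1_derivative_bounded ci Oz.
    exists (a + a', Num.min d d') => /=; split; rewrite ?addr_ge0 ?lt_min ?d0 //.
    move=> z; rewrite lt_min => /andP[/h hz /h' hz'] w; rewrite /nm mxE /= mulrDl.
    by apply: lerD; [exact: hz|exact: hz'].
  pose x ij := projT1 (cid (H ij)); have xP ij := projT2 (cid (H ij)).
  exists (\sum_i \sum_j (x (i, j)).1), (\big[Num.min/1]_ij (x ij).2); split.
  - by apply: sumr_ge0 => i _; apply: sumr_ge0 => j _; have [] := xP (i, j).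
  - elim/big_ind: _ => // [a b a0 b0|ij _]; [by rewrite lt_min a0|by have [] := xP ij].
  move=> z zd w; rewrite mulr_suml; apply: ler_sum => i _; rewrite mulr_suml;
    apply: ler_sum => j _.
  have [_ _ h] := xP (i, j); apply: h; apply: lt_le_trans zd _; exact: bigmin_le.
pose B4 := 2 * (B3 * B1 * B1) + 2 * (B2 * B1 * B1) + 2 * (B2 * B1 * B1).
have m2 : 0 < 2 :> R by [].
have B40 : 0 <= B4 by rewrite /B4 !addr_ge0 // !mulr_ge0 // ltW.
exists (B1 + B2 + B4), (Num.min d1 (Num.min d2 d3)); split.
- by have := B10; lra.
- by rewrite !lt_min d10 d20.
move=> z; rewrite !lt_min => /andP[/H1[Oz' [Xz dXz]] /andP[/H2 gz /H3 dgz]].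
have gzB : mx_nm (g z) <= B2.
  by have := mx_nmD (g z - g z0) (g z0); rewrite subrK /B2; lra.
split=> //; [lra|lra|].
move=> w; apply: (@le_trans _ _ (B4 * nrm w)); last first.
  by rewrite ler_wpM2r ?nrm_ge0 //; lra.
have -> : B4 * nrm w = 2 * (B3 * nrm w * B1 * B1) + 2 * (B2 * (B1 * nrm w) * B1) +
    2 * (B2 * B1 * (B1 * nrm w)) by rewrite /B4; ring.
rewrite /dsqnorm; apply: le_trans (ler_normD _ _) _; apply: lerD; last first.
  apply: le_trans (rf_bound _ _ _) _; rewrite ler_pM2l //.
  by rewrite ler_pM ?mulr_ge0 ?nrm_ge0 ?mx_nm_ge0 // ler_pM ?nrm_ge0 ?mx_nm_ge0.
apply: le_trans (ler_normD _ _) _; apply: lerD; apply: le_trans (rf_bound _ _ _) _;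
  rewrite ler_pM2l //.
  by rewrite ler_pM ?mulr_ge0 ?nrm_ge0 ?mx_nm_ge0 // ler_pM ?nrm_ge0 ?mx_nm_ge0.
by rewrite ler_pM ?mulr_ge0 ?nrm_ge0 ?mx_nm_ge0 // ler_pM ?nrm_ge0 ?mx_nm_ge0.
Qed.

Lemma sqnorm_mvt z w (h e : R) : 0 <= h ->
  (forall s, 0 <= s <= h -> Om (real_line z w s) /\ `|dsqnorm g X (real_line z w s) w| <= e) ->
  `|sqnorm g X (real_line z w h) - sqnorm g X z| <= e * h.
Proof.
move=> h0 H; rewrite -{2}(real_line0 z w) -[X in e * X]subr0.
apply: (@mvt_bound R (fun s => sqnorm g X (real_line z w s)) (fun s => dsqnorm g X (real_line z
  w s) w)) => //.
  move=> s /H[Os _]; apply: (@is_derive_line_shift R n (sqnorm g X)).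
  exact: (is_derive_sqnorm oOm gC1 dX).
by move=> s /H[].
Qed.

Section Bound.
Variable c0 : R.
Hypothesis c00 : 0 <= c0.
Hypothesis dsq_bound : forall z c, Om z ->
  `|dsqnorm g X z (c *: X z)| <= `|complex.Re c| * (c0 * (1 + sqnorm g X z)).

(* The Euler step is [z -> z + h c X(z)].  The rate [2 c0 + 1] exceeds the infinitesimal growth
   rate [c0] of [1 + |X|^2] in order to absorb the discretization error. *)
Definition admissible (z : V) (c : R[i]) (h : R) : Prop :=
  (forall s, 0 <= s <= h -> Om (real_line z (c *: X z) s) /\
     rf (g (real_line z (c *: X z) s)) (c *: X z) (c *: X z) <= 3 * (1 + sqnorm g X z)) /\
  1 + sqnorm g X (real_line z (c *: X z) h) <= (1 + sqnorm g X z) * (1 + (2 * c0 + 1) * h).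

(** One bound on the step size serves all starting points near [z0] and all [c] in [square]: this
    local uniformity is what compactness is applied to later. *)
Lemma admissible_near z0 : Om z0 -> exists2 d : R, 0 < d &
  forall z c h, nrm (z - z0) < d -> square c -> 0 <= h <= d -> admissible z c h.
Proof.
move=> Oz0; have [B [d1 [B0 d10 H1]]] := local_bounds Oz0.
have B1 : 0 < 16 * B ^+ 2 + 1 by rewrite ltr_wpDl // mulr_ge0 // sqr_ge0.
have [d2 d20 H2] := metric_continuous Oz0 (e := (16 * B ^+ 2 + 1)^-1) ltac:(by rewrite invr_gt0).
have [d3 d30 H3] := diff_nrm_continuous (dX Oz0) (e := (4 * B + 1)^-1 / 2)
  ltac:(by rewrite divr_gt0 // invr_gt0; lra).
pose r := Num.min (Num.min d1 d2) (Num.min d3 (B^-1 / 2)).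
have r0 : 0 < r by rewrite !lt_min d10 d20 d30 divr_gt0 // invr_gt0.
have rP y : nrm (y - z0) < r -> [/\ nrm (y - z0) < d1, nrm (y - z0) < d2,
   nrm (X y - X z0) < (4 * B + 1)^-1 / 2 & nrm (y - z0) < B^-1 / 2].
  rewrite !lt_min => /andP[/andP[h1 h2] /andP[h3 h4]]; split=> //.
  by have := H3 _ h3; rewrite (addrC z0) subrK.
have sq_near y : nrm (y - z0) < r -> `|sqnorm g X y - sqnorm g X z0| <= 2^-1.
  move=> yr; have [y1 _ _ y4] := rP y yr.
  have -> : y = real_line z0 (y - z0) 1 by rewrite /real_line scale1r addrC subrK.
  apply: le_trans (@sqnorm_mvt z0 (y - z0) 1 (B * nrm (y - z0)) ler01 _) _.
    move=> s /andP[s0 s1]; have [|Os _ _ hd] := H1 (real_line z0 (y - z0) s).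
      rewrite nrm_real_line ger0_norm //; apply: le_lt_trans y1.
      by rewrite ler_piMl // nrm_ge0.
    by split.
  rewrite mulr1 mulrC -ler_pdivlMr // mulrC; exact: ltW.
exists (Num.min 1 (r / (2 + 4 * B))) => [|z c h].
  by rewrite lt_min ltr01 divr_gt0 //; lra.
rewrite lt_min ltr_pdivlMr; last by lra.
move=> /andP[_ zr] cs /andP[h0]; rewrite le_min ler_pdivlMr; last by lra.
move=> /andP[h1 hr].
have nc : nm c <= 2 by case: cs => a b; rewrite /nm; lra.
set v := c *: X z.
have nz0 := nrm_ge0 (z - z0).
have zr' : nrm (z - z0) < r.
  have : 0 <= nrm (z - z0) * (4 * B) by rewrite !mulr_ge0 // ltW.
  lra.
have [z1 z2 z3 z4] := rP z zr'; have [Oz XzB gzB dz] := H1 z z1.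
have nv : nrm v <= 2 * B.
  by apply: le_trans (nrmZ _ _) _; rewrite ler_pM ?nm_ge0 ?nrm_ge0.
have near s : 0 <= s <= h -> nrm (real_line z v s - z0) < r.
  move=> /andP[s0 sh]; rewrite -(subrKA z); apply: le_lt_trans (nrmD _ _) _.
  rewrite nrm_real_line ger0_norm //.
  have : s * nrm v <= h * (2 * B) by rewrite ler_pM ?nrm_ge0.
  have : 0 <= nrm (z - z0) * (4 * B) by rewrite !mulr_ge0 // ltW.
  lra.
have W0 : 0 <= sqnorm g X z by exact: rf_ge0.
split=> [s sI|].
  have [y1 y2 y3 y4] := rP _ (near s sI); have [Oy XyB gyB dy] := H1 _ y1.
  split=> //; set y := real_line z v s in y1 y2 Oy gyB *.
  (* The squared modulus of [c] is at most 2. Moving the base point of the metric from [z] to [y]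
     adds at most 1, by the choice of [16 * B ^+ 2 + 1]; together this stays below
     [3 * (1 + sqnorm g X z)]. *)
  have A : rf (g z) v v <= 2 * sqnorm g X z.
    rewrite /v rf_scale ler_wpM2r //; case: cs => a b.
    have : complex.Re c ^+ 2 <= 1 by rewrite -real_normK ?num_real // exprn_ile1.
    have : complex.Im c ^+ 2 <= 1 by rewrite -real_normK ?num_real // exprn_ile1.
    lra.
  have D : rf (g y) v v = rf (g z) v v + rf (g y - g z) v v by rewrite -rfDm addrC subrK.
  have mxd : mx_nm (g y - g z) <= 2 * (16 * B ^+ 2 + 1)^-1.
    have -> : g y - g z = (g y - g z0) + (g z0 - g z) by rewrite addrA subrK.
    have := H2 _ y2; have := H2 _ z2; have := mx_nmD (g y - g z0) (g z0 - g z).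
    rewrite (mx_nmBC (g z0)); lra.
  have E : rf (g y - g z) v v <= 1.
    apply: le_trans (ler_norm _) _; apply: le_trans (rf_bound _ _ _) _.
    have : mx_nm (g y - g z) * nrm v * nrm v <= 2 * (16 * B ^+ 2 + 1)^-1 * (2 * B) * (2 * B).
      have m0 := mx_nm_ge0 (g y - g z).
      by rewrite ler_pM ?nrm_ge0 // ?mulr_ge0 ?nrm_ge0 // ler_pM ?nrm_ge0.
    have -> : 2 * (16 * B ^+ 2 + 1)^-1 * (2 * B) * (2 * B) = (16 * B ^+ 2 + 1)^-1 * (8 * B ^+
      2) by ring.
    have : (16 * B ^+ 2 + 1)^-1 * (8 * B ^+ 2) <= 2^-1.
      by rewrite ler_pdivrMl // ; have := sqr_ge0 B; lra.
    lra.
  lra.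
have key : `|sqnorm g X (real_line z v h) - sqnorm g X z| <= (2 * c0 + 1) * (1 + sqnorm g X z)
  * h.
  apply: sqnorm_mvt => // s sI.
  have [y1 y2 y3 y4] := rP _ (near s sI); have [Oy XyB gyB dy] := H1 _ y1.
  split=> //; set y := real_line z v s in y1 y2 y3 Oy gyB XyB dy *.
  (* The direction is frozen at [z], while [dsq_bound] concerns the field at [y]. The first part
     contributes at most [c0 * (2 + sqnorm g X z)], the error at most 1, and the rate [2 * c0 + 1]
     absorbs both. *)
  have -> : v = c *: X y + c *: (X z - X y) by rewrite -scalerDr addrC subrK.
  rewrite dsqnormD //; apply: le_trans (ler_normD _ _) _.
  have A : `|dsqnorm g X y (c *: X y)| <= c0 * (2 + sqnorm g X z).
    apply: le_trans (dsq_bound _ Oy) _; case: cs => a b.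
    have W1 : 0 <= sqnorm g X y by exact: rf_ge0.
    have yy := sq_near y (near s sI); have zz := sq_near z zr'.
    apply: (@le_trans _ _ (1 * (c0 * (1 + sqnorm g X y)))).
      by rewrite ler_wpM2r // mulr_ge0 //; lra.
    rewrite mul1r ler_wpM2l //; move: yy zz; rewrite !ler_norml => /andP[? ?] /andP[? ?]; lra.
  have D : `|dsqnorm g X y (c *: (X z - X y))| <= 1.
    apply: le_trans (dy _) _.
    have nX : nrm (X z - X y) <= (4 * B + 1)^-1.
      by rewrite -(subrKA (X z0)); apply: le_trans (nrmD _ _) _; rewrite (nrmBC (X z0)); lra.
    have : nrm (c *: (X z - X y)) <= 2 * (4 * B + 1)^-1.
      by apply: le_trans (nrmZ _ _) _; rewrite ler_pM ?nm_ge0 ?nrm_ge0.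
    move=> nc'; apply: (@le_trans _ _ (B * (2 * (4 * B + 1)^-1))); first by rewrite ler_pM2l.
    by rewrite mulrA ler_pdivrMr ?mul1r; lra.
  have : 0 <= c0 * sqnorm g X z by rewrite mulr_ge0.
  move: A D; rewrite !mulrDl !mulrDr; lra.
move: key; rewrite ler_norml => /andP[_]; rewrite -/v; lra.
Qed.

End Bound.
End LocalStep.

(** * Paths and completeness *)

Section Integral.
Local Open Scope ereal_scope.

(* Unlike [ge0_le_integral], this needs no measurability. *)
Lemma ge0_subset_integral_le d (T : measurableType d) (R : realType) (mu : {measure set T ->
  \bar R})
    (D : set T) (f1 f2 : T -> \bar R) :
  (forall x, D x -> 0 <= f1 x) -> (forall x, D x -> f1 x <= f2 x) ->
  \int[mu]_(x in D) f1 x <= \int[mu]_(x in D) f2 x.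
Proof.
move=> f10 f12; rewrite !ge0_integralE // => [|x Dx]; last exact: le_trans (f10 x Dx) (f12 x Dx).
apply: le_ereal_sup => _ [h hf <-]; exists h => // x; apply: le_trans (hf x) _.
by rewrite /patch; case: ifPn => // /set_mem /f12.
Qed.

End Integral.

(** * A C^1 reparametrization at rest at both ends *)

Section Smoothstep.
Context {R : realType}.

Definition sqpos (t : R) : R := Num.max t 0 ^+ 2.

Lemma is_derive_sqpos (t : R) : is_derive t 1 sqpos (2 * Num.max t 0).
Proof.
apply/is_derive_epsP => e e0; exists e => // h he.
apply: (@le_trans _ _ (`|h| * `|h|)); last by rewrite ler_wpM2r // ltW.
rewrite -normrM /sqpos; have hh : `|h * h| = h * h by rewrite ger0_norm // -expr2 sqr_ge0.
rewrite hh !maxEle.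
case: ifPn => a; case: ifPn => b; rewrite ler_norml; apply/andP; move: a b;
  rewrite -?ltNge => a b; split; nra.
Qed.

Lemma max0_lip (x y : R) : `|Num.max x 0 - Num.max y 0| <= `|x - y|.
Proof.
by rewrite !maxEle; case: ifPn; case: ifPn; rewrite -?ltNge => *; rewrite !ler_norml;
  apply/andP; split; have := ler_norm (x - y); have := ler_norm (y - x); rewrite (distrC y); lra.
Qed.

(** A quadratic spline rising from 0 to 1 on [0, 1], with derivative the hat function of height 2.
    Travelling a segment in this way costs a factor 2 in the maximal speed. *)
Definition smoothstep (t : R) : R := 2 * (sqpos t - 2 * sqpos (t - 2^-1) + sqpos (t - 1)).
Definition smoothstep' (t : R) : R :=
  4 * (Num.max t 0 - 2 * Num.max (t - 2^-1) 0 + Num.max (t - 1) 0).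

Lemma is_derive_smoothstep (t : R) : is_derive t 1 smoothstep (smoothstep' t).
Proof.
have H c : is_derive t 1 (fun s => sqpos (s - c)) (2 * Num.max (t - c) 0).
  have /is_derive_epsP D := is_derive_sqpos (t - c); apply/is_derive_epsP => e /D[dl dl0 h].
  by exists dl => // s /h; rewrite (addrAC t).
have := H 2^-1; have := H 1; have := is_derive_sqpos t => D1 D2 D3.
rewrite /smoothstep; apply: is_derive_eq; rewrite /smoothstep' /GRing.scale /=; ring.
Qed.

Lemma continuous_smoothstep' : continuous smoothstep'.
Proof.
move=> t; apply/continuous_epsP => e e0; exists (e / 17) => [|y h]; first lra.
have E (c : R) : y - c - (t - c) = y - t by ring.
have := max0_lip y t; have := max0_lip (y - 2^-1) (t - 2^-1); have := max0_lip (y - 1) (t - 1);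
  rewrite !E.
rewrite /smoothstep'; move: h.
set a := Num.max y 0; set b := Num.max t 0; set a1 := Num.max (y - _) 0;
  set b1 := Num.max (t - _) 0.
set a2 := Num.max (y - 1) 0; set b2 := Num.max (t - 1) 0; set d := `|y - t| => h.
by rewrite !ler_norml ltr_norml => /andP[? ?] /andP[? ?] /andP[? ?]; apply/andP; split; lra.
Qed.

Lemma smoothstep_le0 t : t <= 0 -> smoothstep t = 0 /\ smoothstep' t = 0.
Proof.
move=> t0; rewrite /smoothstep /smoothstep' /sqpos !max_r; lra.
Qed.

Lemma smoothstep_ge1 t : 1 <= t -> smoothstep t = 1 /\ smoothstep' t = 0.
Proof.
move=> t1; rewrite /smoothstep /smoothstep' /sqpos !max_l; lra.
Qed.

Lemma smoothstep_itv t : 0 <= smoothstep t <= 1 /\ 0 <= smoothstep' t <= 2.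
Proof.
case: (lerP t 0) => [/smoothstep_le0[-> ->]|t0]; first by split; lra.
case: (lerP 1 t) => [/smoothstep_ge1[-> ->]|t1]; first by split; lra.
rewrite /smoothstep /smoothstep' /sqpos (max_l (ltW t0)) (max_r (_ : t - 1 <= 0)); last lra.
case: (lerP t 2^-1) => ht.
  rewrite max_r; last lra.
  by split; apply/andP; split; nra.
rewrite max_l; last lra.
by split; apply/andP; split; nra.
Qed.

End Smoothstep.

Section Paths.
Context {R : realType} {n : nat}.
Local Notation V := 'rV[R[i]]_n.
Variables (Om : set V) (g : V -> 'M[R[i]]_n).

(* Curves from [p] to [q] that rest outside [0, 1] and have speed at most [l]:
   such curves can be concatenated without losing differentiability. *)
Definition resting_path (p q : V) (l : R) : Prop := exists gam vel : R -> V,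
  [/\ forall a (t : R), is_derive t 1 (curve_coord gam a) (rcoord (vel t) a),
      forall a, continuous (fun t => rcoord (vel t) a),
      forall t, Om (gam t) /\ rf (g (gam t)) (vel t) (vel t) <= l ^+ 2,
      forall t : R, t <= 0 -> gam t = p /\ vel t = 0 &
      forall t, 1 <= t -> gam t = q /\ vel t = 0].

Lemma resting_path_length p q l : 0 <= l -> resting_path p q l ->
  exists gam, C1_path Om p q gam /\ (path_length (realform g) gam <= l%:E)%E.
Proof.
move=> l0 [gam [vel [dg cv sp h0 h1]]]; exists gam.
have dE a : derive1 (curve_coord gam a) = (fun t => rcoord (vel t) a).
  by apply/funext => t; rewrite derive1E; exact: (derive_val (is_derive := dg a t)).
split.
  split=> [a|t _||].
  - split=> [t|]; first by have [] := dg a t.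
    rewrite dE; exact: cv.
  - exact: (sp t).1.
  - exact: (h0 _ (lexx 0)).1.
  - exact: (h1 _ (lexx 1)).1.
have vE t : velocity gam t = vel t.
  by rewrite /velocity [RHS]rcoord_sum; apply: eq_bigr => a _; rewrite dE.
apply: (@le_trans _ _ (\int[lebesgue_measure]_(t in `[0%R, 1%R]) (cst l%:E t))%E).
  apply: ge0_subset_integral_le => t _; first by rewrite lee_fin sqrtr_ge0.
  rewrite lee_fin -(ger0_norm l0) -sqrtr_sqr ler_sqrt ?sqr_ge0 // vE realformE.
  exact: (sp t).2.
rewrite integral_cst //=.
by rewrite lebesgue_measure_itv /= lte_fin ltr01 oppr0 adde0 mule1 lexx.
Qed.

Lemma resting_path_refl p l : Om p -> resting_path p p l.
Proof.
move=> Op; exists (fun=> p), (fun=> 0).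
split=> //.
- by move=> a t; rewrite rcoord0; exact: is_derive_cst.
- by move=> a t; exact: cst_continuous.
- move=> t; split=> //; rewrite rf0l; exact: sqr_ge0.
Qed.

Lemma continuous_affine (c d : R) : continuous (fun t : R => c * t + d).
Proof.
by move=> x; apply: cvgD; [apply: cvgM; [exact: cvg_cst|exact: cvg_id]|exact: cvg_cst].
Qed.

Lemma is_derive_affine (f : R -> R) (c d t k : R) : is_derive (c * t + d) 1 f k ->
  is_derive t 1 (fun s => f (c * s + d)) (c * k).
Proof.
move=> D; have D' : is_derive t 1 (fun s : R => c * s + d) c.
  by apply: is_derive_eq; rewrite /GRing.scale /=; ring.
have := @is_derive1_comp R f (fun s => c * s + d) t k c D D'.
by rewrite mulrC.
Qed.

Lemma resting_path_cat p q s l1 l2 : 0 < l1 -> 0 < l2 ->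
  resting_path p q l1 -> resting_path q s l2 -> resting_path p s (l1 + l2).
Proof.
move=> l10 l20 [g1 [v1 [dg1 cv1 sp1 h10 h11]]] [g2 [v2 [dg2 cv2 sp2 h20 h21]]].
pose l := l1 + l2; have l0 : 0 < l by rewrite addr_gt0.
pose a1 := l / l1; pose a2 := l / l2; pose tau := l1 / l.
have a10 : 0 < a1 by rewrite divr_gt0. have a20 : 0 < a2 by rewrite divr_gt0.
pose b2 := - (l1 / l2).
have E1 : a1 * tau = 1 by rewrite /a1 /tau; field; rewrite !gt_eqF.
have E2 : a2 * tau + b2 = 0 by rewrite /a2 /tau /b2; field; rewrite !gt_eqF.
have E3 : a2 + b2 = 1 by rewrite /a2 /b2 /l; field; rewrite !gt_eqF.
have tau1 : tau <= 1 by rewrite ler_pdivrMr // mul1r lerDl ltW.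
have tau0 : 0 <= tau by rewrite divr_ge0 // ltW.
(* Time is shared in proportion to the lengths, so both pieces get the speed bound [l1 + l2]. At
   each time one of the two curves rests at [q], so the sum minus [q] is the concatenation, and
   differentiability needs no case distinction. *)
exists (fun t => g1 (a1 * t + 0) + g2 (a2 * t + b2) - q),
  (fun t => a1%:C *: v1 (a1 * t + 0) + a2%:C *: v2 (a2 * t + b2)).
have aft t : tau <= t -> g1 (a1 * t + 0) = q /\ v1 (a1 * t + 0) = 0.
  by move=> tt; apply: h11; rewrite addr0 -E1 ler_pM2l.
have bef t : t <= tau -> g2 (a2 * t + b2) = q /\ v2 (a2 * t + b2) = 0.
  by move=> tt; apply: h20; rewrite -E2 lerD2r ler_pM2l.
split.
- move=> a t; rewrite rcoordD !rcoordZ /curve_coord.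
  under eq_fun do rewrite !rcoordD rcoordN.
  have D1 := is_derive_affine (dg1 a (a1 * t + 0)).
  have D2 := is_derive_affine (dg2 a (a2 * t + b2)).
  rewrite -[X in is_derive _ _ _ X]addr0; apply: is_deriveD.
- move=> a t; under eq_fun do rewrite rcoordD !rcoordZ.
  apply: cvgD; apply: cvgM; try exact: cvg_cst.
  + exact: (continuous_comp (@continuous_affine a1 0 t) (cv1 a _)).
  + exact: (continuous_comp (@continuous_affine a2 b2 t) (cv2 a _)).
- move=> t; case: (lerP t tau) => tt.
    have [-> ->] := bef t tt; have [I1 s1] := sp1 (a1 * t + 0).
    rewrite addrK scaler0 (addr0 (a1%:C *: _)); split=> //; rewrite rfZl rfZr mulrA.
    have -> : l1 + l2 = a1 * l1 by rewrite /a1 divfK // gt_eqF.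
    by rewrite exprMn -expr2 ler_pM2l // exprn_gt0.
  have [-> ->] := aft t (ltW tt); have [I1 s1] := sp2 (a2 * t + b2).
  rewrite addrAC subrr add0r scaler0 add0r; split=> //; rewrite rfZl rfZr mulrA.
  have -> : l1 + l2 = a2 * l2 by rewrite /a2 divfK // gt_eqF.
  by rewrite exprMn -expr2 ler_pM2l // exprn_gt0.
- move=> t t0; have [-> ->] := bef t (le_trans t0 tau0).
  have t1 : a1 * t + 0 <= 0 by rewrite addr0 pmulr_rle0.
  have [-> ->] := h10 _ t1.
  by rewrite addrK !scaler0 addr0.
- move=> t t1; have [-> ->] := aft t (le_trans tau1 t1).
  have t2 : 1 <= a2 * t + b2 by rewrite -E3 lerD2r ler_peMr // ltW.
  have [-> ->] := h21 _ t2.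
  by rewrite addrAC subrr add0r !scaler0 addr0.
Qed.

Lemma resting_path_segment z v h B : 0 <= h ->
  (forall s, 0 <= s <= h -> Om (real_line z v s) /\ rf (g (real_line z v s)) v v <= B ^+ 2) ->
  resting_path z (real_line z v h) (2 * h * B).
Proof.
move=> h0 H; exists (fun t => real_line z v (h * smoothstep t)),
  (fun t => (h * smoothstep' t)%:C *: v); split.
- move=> a t; rewrite rcoordZ /curve_coord /real_line.
  under eq_fun do rewrite rcoordD rcoordZ.
  have D := is_derive_smoothstep t.
  apply: is_derive_eq; rewrite /GRing.scale /=; ring.
- move=> a t; under eq_fun do rewrite rcoordZ.
  apply: cvgM; last exact: cvg_cst.
  by apply: cvgM; [exact: cvg_cst|exact: continuous_smoothstep'].
- move=> t; have [/andP[s0 s1] /andP[d0 d1]] := smoothstep_itv t.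
  have [|I1 r1] := H (h * smoothstep t); first by rewrite mulr_ge0 //= ler_piMr.
  split=> //; rewrite rfZl rfZr mulrA.
  have c0 : 0 <= h * smoothstep' t by rewrite mulr_ge0.
  have c1 : h * smoothstep' t <= 2 * h by rewrite mulrC ler_wpM2r.
  have -> : (2 * h * B) ^+ 2 = (2 * h) * (2 * h) * B ^+ 2 by ring.
  apply: (@le_trans _ _ (h * smoothstep' t * (h * smoothstep' t) * B ^+ 2)).
    by rewrite ler_wpM2l // mulr_ge0.
  by rewrite ler_wpM2r ?sqr_ge0 // ler_pM.
- by move=> t /smoothstep_le0[-> ->]; rewrite !mulr0 real_line0 scale0r.
- by move=> t /smoothstep_ge1[-> ->]; rewrite mulr1 mulr0 scale0r.
Qed.

Lemma resting_path_sym p q l : resting_path p q l -> resting_path q p l.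
Proof.
move=> [gam [vel [dg cv sp h0 h1]]].
exists (fun t => gam (-1 * t + 1)), (fun t => (-1)%:C *: vel (-1 * t + 1)); split.
- by move=> a t; rewrite rcoordZ; exact: is_derive_affine (dg a (-1 * t + 1)).
- move=> a t; under eq_fun do rewrite rcoordZ.
  apply: cvgM; first exact: cvg_cst.
  exact: (continuous_comp (@continuous_affine (-1) 1 t) (cv a _)).
- move=> t; have [I1 s1] := sp (-1 * t + 1); split=> //.
  by rewrite rfZl rfZr mulrA mulrNN mulr1 mul1r.
- move=> t t0; have t1 : 1 <= -1 * t + 1 by lra.
  by have [-> ->] := h1 _ t1; rewrite scaler0.
- move=> t t0; have t1 : -1 * t + 1 <= 0 by lra.
  by have [-> ->] := h0 _ t1; rewrite scaler0.
Qed.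

Lemma riem_dist_resting p q l : 0 <= l -> resting_path p q l ->
  (riem_dist (realform g) Om p q <= l%:E)%E.
Proof.
move=> l0 /(resting_path_length l0)[gam [cg lg]]; apply: le_trans lg.
by apply: ereal_inf_lbound; exists gam.
Qed.

Lemma riem_dist_path p q l : (riem_dist (realform g) Om p q < l%:E)%E ->
  exists gam, C1_path Om p q gam /\ (path_length (realform g) gam < l%:E)%E.
Proof. by move/ereal_inf_lt => [_ [gam cg <-] lg]; exists gam. Qed.

End Paths.

(** * Quantitative positivity of Hermitian forms *)

Section PositiveForms.
Context {R : realType} {n : nat}.
Local Notation V := 'rV[R[i]]_n.

Lemma nrm_rcoord (v : V) : nrm v = \sum_a `|rcoord v a|.
Proof.
rewrite big_split_ord /= -big_split; apply: eq_bigr => j _ /=.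
by rewrite /rcoord split_lshift split_rshift.
Qed.

Lemma rcoord_frame a b : rcoord (frame b : V) a = (a == b)%:R.
Proof.
rewrite /rcoord /frame; case: (split_ordP a) => j ->; case: (split_ordP b) => k ->;
  rewrite ?split_lshift ?split_rshift.
- by rewrite eq_lshift mxE /= eq_sym; case: eqP.
- by rewrite eq_lrshift !mxE cReM /= mul0r mul1r; case: eqP => _ /=; rewrite subr0.
- by rewrite eq_rlshift mxE /=; case: eqP.
- by rewrite eq_rshift !mxE cImM /= mul0r mul1r add0r eq_sym; case: eqP.
Qed.

Variable h : 'M[R[i]]_n.
Hypothesis hH : forall i j, h j i = (h i j)^*.
Hypothesis hpos : forall u : V, u != 0 -> 0 < rf h u u.

Lemma rf_cauchy_schwarz u v : rf h u v ^+ 2 <= rf h u u * rf h v v.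
Proof.
have [->|v0] := eqVneq v 0; first by rewrite !rf0r expr0n mulr0.
have a0 := hpos v0; set a := rf h v v in a0 *; set b := rf h u v.
pose w := a%:C *: u + (- b)%:C *: v.
have w0 : 0 <= rf h w w.
  by have [->|/hpos/ltW //] := eqVneq w 0; rewrite rf0l.
have E : rf h w w = a * (a * rf h u u - b ^+ 2).
  by rewrite /w !rfDl !rfDr !rfZl !rfZr (rfC u v hH) -/a -/b; ring.
by move: w0; rewrite E pmulr_rge0 // subr_ge0 mulrC.
Qed.

(** Riesz representation of the real coordinates: positivity makes [h] invertible, and a column of
    the inverse, conjugated and halved, represents a complex coordinate; a factor ['i] passes from
    real to imaginary part. *)
Lemma rf_dual (a : 'I_(n + n)) : exists w : V, forall v, rf h v w = rcoord v a.
Proof.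
have hu : h \in unitmx.
  rewrite -row_free_unit; apply: inj_row_free => v vh; apply/eqP/negPn/negP => v0.
  have := hpos v0; have -> : rf h v v = 0; last by rewrite ltxx.
  rewrite /rf /sesq exchange_big /= big1 ?mulr0 // => j _.
  rewrite -mulr_suml; have /matrixP/(_ 0 j) := vh; rewrite !mxE => E.
  by rewrite (_ : \sum_(i < n) h i j * v 0 i = 0) ?mul0r // -[RHS]E; apply: eq_bigr => i _;
    rewrite mulrC.
have key k : exists w : V, forall v, sesq h v w = v 0 k / 2.
  pose w : V := \row_j Num.conj (invmx h j k / 2).
  have wE j : w 0 j = Num.conj (invmx h j k / 2) by rewrite /w; exact: mxE.
  exists w => v; rewrite /sesq.
  have -> : v 0 k = (v *m (h *m invmx h)) 0 k by rewrite mulmxV // mulmx1.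
  rewrite mulmxA mxE mulr_suml exchange_big /=; apply: eq_bigr => j _.
  rewrite [(v *m h) 0 j]mxE !mulr_suml; apply: eq_bigr => i _; rewrite wE conjCK; ring.
rewrite /rcoord; case: fintype.split => k; have [w wP] := key k.
  exists w => v; rewrite /rf wP;
    have -> : (2 : R[i])^-1 = (2^-1 : R)%:C by rewrite fmorphV rmorph_nat.
  by rewrite cReM /=; field.
exists ('i *: w) => v; rewrite /rf sesqZr wP;
  have -> : (2 : R[i])^-1 = (2^-1 : R)%:C by rewrite fmorphV rmorph_nat.
by rewrite !cReM cImM /=; field.
Qed.

(** Each coordinate of [v] is a pairing with its dual vector, hence at most a constant times the
    length of [v] by Cauchy-Schwarz; summing over the coordinates bounds [nrm v]. *)
Lemma rf_lower_bound : exists2 mu : R, 0 < mu & forall v, mu * nrm v ^+ 2 <= rf h v v.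
Proof.
pose w a := projT1 (cid (rf_dual a)); have wP a := projT2 (cid (rf_dual a)).
pose S := \sum_a Num.sqrt (rf h (w a) (w a)) + 1.
have S0 : 0 < S by rewrite ltr_wpDl // sumr_ge0.
have r0 v : 0 <= rf h v v.
  by have [->|/hpos/ltW //] := eqVneq v 0; rewrite rf0l.
exists (S ^- 2) => [|v]; first by rewrite invr_gt0 exprn_gt0.
rewrite ler_pdivrMl ?exprn_gt0 // -(sqr_sqrtr (r0 v)) -exprMn.
rewrite ler_sqr ?nnegrE ?nrm_ge0 ?mulr_ge0 ?sqrtr_ge0 ?(ltW S0) //.
apply: (@le_trans _ _ (\sum_a Num.sqrt (rf h (w a) (w a)) * Num.sqrt (rf h v v))).
  rewrite nrm_rcoord; apply: ler_sum => a _.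
  rewrite -(wP a v) -sqrtrM // -[leLHS]sqrtr_sqr ler_sqrt; last by rewrite mulr_ge0.
  by rewrite [leRHS]mulrC; exact: rf_cauchy_schwarz.
by rewrite -mulr_suml ler_wpM2r ?sqrtr_ge0 // lerDl.
Qed.

End PositiveForms.

(** * Short curves stay close in the Euclidean sense *)

Section Barrier.
Context {R : realType} {n : nat}.
Local Notation V := 'rV[R[i]]_n.
Variables (Om : set V) (g : V -> 'M[R[i]]_n).
Hypothesis oOm : open Om.
Hypothesis gC1 : forall i j, Ck 1 Om (fun z => complex.Re (g z i j)) /\
                             Ck 1 Om (fun z => complex.Im (g z i j)).
Hypothesis gH : forall z, Om z -> forall i j, g z j i = (g z i j)^*.
Hypothesis gpos : forall z, Om z -> forall u, u != 0 -> 0 < rf (g z) u u.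

Lemma metric_lower_bound q : Om q -> exists mu d, [/\ 0 < mu, 0 < d &
  forall y, nrm (y - q) < d -> forall v, (mu * nrm v) ^+ 2 <= rf (g y) v v].
Proof.
move=> Oq; have [mu mu0 H] := rf_lower_bound (gH Oq) (gpos Oq).
(* With the factor 2 of [rf_bound] the perturbation of [g] costs [mu / 2], which leaves the constant
   [Num.sqrt (mu / 2)] after taking the root. *)
have m4 : 0 < mu / 4 by rewrite divr_gt0.
have [d d0 hd] := metric_continuous gC1 Oq m4.
exists (Num.sqrt (mu / 2)), d; split=> //; first by rewrite sqrtr_gt0 divr_gt0.
move=> y /hd yd v; rewrite exprMn sqr_sqrtr; last by rewrite ltW // divr_gt0.
have -> : rf (g y) v v = rf (g q) v v + rf (g y - g q) v v by rewrite -rfDm addrC subrK.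
have := rf_bound (g y - g q) v v; rewrite ler_norml => /andP[b _].
have := H v.
have : mx_nm (g y - g q) * nrm v * nrm v <= mu / 4 * nrm v * nrm v.
  by rewrite -(mulrA (mx_nm _)) -(mulrA (mu / 4)) ler_wpM2r ?mulr_ge0 ?nrm_ge0 // ltW.
move: b; rewrite expr2; lra.
Qed.

(* [bump] is a C^1 cutoff vanishing outside a small ball around [q], where [g] dominates
   the Euclidean metric; so it varies along a curve at most in proportion to the length. *)
Lemma barrier q rho : Om q -> 0 < rho -> exists2 kappa, 0 < kappa &
  forall p p' gam, C1_path Om p p' gam -> (path_length (realform g) gam < kappa%:E)%E ->
    (nrm (p - q) < kappa -> nrm (p' - q) < rho) /\ (nrm (p' - q) < kappa -> nrm (p - q) < rho).
Proof.
move=> Oq rho0; have [mu [d [mu0 d0 low]]] := metric_lower_bound Oq.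
pose N : R := (n + n).+1%:R; have N0 : 0 < N by rewrite ltr0n.
pose r := Num.min d rho / N; have r0 : 0 < r by rewrite divr_gt0 // lt_min d0.
pose dist2 (y : V) : R := \sum_a rcoord (y - q) a ^+ 2.
pose bump y := sqpos (r ^+ 2 - dist2 y).
have dist2_lt y : dist2 y < r ^+ 2 -> (forall a, `|rcoord (y - q) a| < r) /\ nrm (y - q) <
  Num.min d rho.
  move=> yr; have ra a : `|rcoord (y - q) a| < r.
    rewrite -(ltr_pXn2r (_ : (0 < 2)%N)) ?nnegrE ?(ltW r0) // real_normK ?num_real //.
    apply: le_lt_trans yr; rewrite /dist2 (bigD1 a) //= lerDl sumr_ge0 // => b _; exact: sqr_ge0.
  split=> //; rewrite nrm_rcoord; apply: (@le_lt_trans _ _ (\sum_(a < n + n) r)).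
    by apply: ler_sum => a _; exact: ltW.
  rewrite sumr_const card_ord -mulr_natr /r mulrAC ltr_pdivrMr // ltr_pM2l ?lt_min ?d0 //.
  by rewrite ltr_nat.
have dist2_le y : dist2 y <= nrm (y - q) ^+ 2.
  rewrite /dist2 expr2 {2}nrm_rcoord mulr_sumr; apply: ler_sum => a _.
  by rewrite -real_normK ?num_real // expr2 ler_wpM2r // rcoord_le.
(* Where the bump is not zero, its derivative along the curve is at most [2 * r ^+ 2] times [2 * r]
   times the Euclidean speed, and that speed is at most the Riemannian one divided by [mu]. *)
pose C := 4 * r ^+ 3 / mu; have C0 : 0 < C by rewrite divr_gt0 // mulr_gt0 // exprn_gt0.
suff lip p p' gam (l : R) : C1_path Om p p' gam -> (path_length (realform g) gam < l%:E)%E ->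
    `|bump p' - bump p| <= C * l.
  (* Within [r / 2] of [q] the bump is at least 9/16 of [r ^+ 4]. A curve shorter than the second
     bound changes it by at most 8/16 of [r ^+ 4], so it remains positive at the other end. *)
  exists (Num.min (r / 2) (r ^+ 4 / 2 / C)).
    by rewrite lt_min divr_gt0 //= divr_gt0 // divr_gt0 // exprn_gt0.
  move=> p p' gam cg lg.
  have {}lip := lip p p' gam _ cg lg; set kappa := Num.min _ _ in lip *.
  have k1 : kappa <= r / 2 by rewrite /kappa ge_min lexx.
  have k2 : C * kappa <= r ^+ 4 / 2 by rewrite mulrC -ler_pdivlMr // /kappa ge_min lexx orbT.
  have fin x y : `|bump y - bump x| <= C * kappa -> nrm (x - q) < kappa -> nrm (y - q) < rho.
    move=> B xk; have dx : dist2 x <= r ^+ 2 / 4.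
      apply: le_trans (dist2_le x) _.
      have : nrm (x - q) ^+ 2 <= (r / 2) ^+ 2.
        by apply: lerXn2r; rewrite ?nnegrE ?nrm_ge0 //; lra.
      by rewrite (_ : (r / 2) ^+ 2 = r ^+ 2 / 4) //; field.
    have bx : (3 / 4 * r ^+ 2) ^+ 2 <= bump x.
      rewrite /bump /sqpos; have r20 := sqr_ge0 r.
      rewrite max_l; last lra.
      by rewrite ler_sqr ?nnegrE; lra.
    have by0 : 0 < bump y.
      have r40 : 0 < r ^+ 4 by rewrite exprn_gt0.
      have E : (3 / 4 * r ^+ 2) ^+ 2 = 9 / 16 * r ^+ 4 by field.
      move: B; rewrite ler_norml => /andP[B _]; lra.
    have yr : dist2 y < r ^+ 2.
      rewrite ltNge; apply/negP => h; move: by0; rewrite /bump /sqpos max_r ?subr_le0 //.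
      by rewrite expr0n ltxx.
    by have [_] := dist2_lt y yr; rewrite lt_min => /andP[].
  by split; apply: fin => //; rewrite distrC.
move=> [dg inOm g0 g1] lg.
have dgt a (t : R) : is_derive t 1 (curve_coord gam a) (derive1 (curve_coord gam a) t).
  by have [h _] := dg a; apply: (DeriveDef (h t)); rewrite derive1E.
pose dd t := \sum_a 2 * rcoord (gam t - q) a * derive1 (curve_coord gam a) t.
have d2 (t : R) : is_derive t 1 (fun s => dist2 (gam s)) (dd t).
  rewrite /dist2 /dd.
  have -> : (fun s => \sum_a rcoord (gam s - q) a ^+ 2) =
     (\sum_a (fun s : R => rcoord (gam s - q) a ^+ 2)).
    by apply/funext => s; rewrite fct_sumE.
  apply: is_derive_sum => a.
  have D : is_derive t 1 (fun s => rcoord (gam s - q) a) (derive1 (curve_coord gam a) t).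
    under eq_fun do rewrite rcoordD.
    by rewrite -[X in is_derive _ _ _ X]addr0; apply: is_deriveD; exact: dgt.
  apply: is_derive_eq; rewrite /GRing.scale /=; ring.
pose D t := - (2 * Num.max (r ^+ 2 - dist2 (gam t)) 0 * dd t).
have dbump (t : R) : is_derive t 1 (fun s => bump (gam s)) (D t).
  have dr : is_derive t 1 (fun s => r ^+ 2 - dist2 (gam s)) (- dd t).
    have d2t := d2 t; by apply: is_derive_eq; ring.
  have := @is_derive1_comp R (@sqpos R) (fun s => r ^+ 2 - dist2 (gam s)) t _ _
    (is_derive_sqpos (r ^+ 2 - dist2 (gam t))) dr.
  by rewrite /D mulrN.
have velE (t : R) a : rcoord (velocity gam t) a = derive1 (curve_coord gam a) t.
  rewrite /velocity; have rs (I : finType) (F : I -> V) : rcoord (\sum_i F i) a = \sum_i rcoord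
    (F i) a.
    by elim/big_rec2 : _ => [|i x y _ <-]; [exact: rcoord0|exact: rcoordD].
  rewrite rs (bigD1 a) //= rcoordZ rcoord_frame eqxx mulr1 big1 ?addr0 // => b ba.
  by rewrite rcoordZ rcoord_frame eq_sym (negPf ba) mulr0.
have ddB t : 0 <= t <= 1 -> `|D t| <= C * Num.sqrt (realform g (gam t) (velocity gam t)
  (velocity gam t)).
  move=> tI; rewrite /D normrN normrM.
  case: (lerP (r ^+ 2 - dist2 (gam t)) 0) => [dr|dr].
    by rewrite mulr0 normr0 mul0r mulr_ge0 ?sqrtr_ge0 // ltW.
  have [ra dn] := dist2_lt (gam t) (ltac:(by rewrite -subr_gt0)).
  have gd : nrm (gam t - q) < d by move: dn; rewrite lt_min => /andP[].
  have lo := low _ gd (velocity gam t).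
  have n0 : 0 <= mu * nrm (velocity gam t) by rewrite mulr_ge0 ?nrm_ge0 // ltW.
  have lo' : mu * nrm (velocity gam t) <= Num.sqrt (realform g (gam t) (velocity gam t)
    (velocity gam t)).
    by rewrite -(ger0_norm n0) -sqrtr_sqr ler_sqrt // (le_trans _ lo) // sqr_ge0.
  have ddb : `|dd t| <= 2 * r * nrm (velocity gam t).
    rewrite /dd nrm_rcoord mulr_sumr; apply: le_trans (ler_norm_sum _ _ _) _.
    apply: ler_sum => a _; rewrite velE 2!normrM normr_nat.
    by rewrite ler_wpM2r // ler_pM2l // ltW.
  have d20 : 0 <= dist2 (gam t) by apply: sumr_ge0 => a _; exact: sqr_ge0.
  rewrite normrM normr_nat (ger0_norm (ltW dr)).
  apply: (@le_trans _ _ (2 * r ^+ 2 * (2 * r * nrm (velocity gam t)))).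
    by rewrite ler_pM // ?mulr_ge0 // ?(ltW dr) //; lra.
  rewrite /C; have -> : 2 * r ^+ 2 * (2 * r * nrm (velocity gam t)) =
     4 * r ^+ 3 / mu * (mu * nrm (velocity gam t)) by field; rewrite gt_eqF.
  by rewrite ler_wpM2l // ltW.
have cdist : continuous (fun t => dist2 (gam t)).
  by move=> t; exact: is_derive_continuous (d2 t).
have ccoord a : continuous (fun t => rcoord (gam t - q) a).
  move=> t; under eq_fun do rewrite rcoordD.
  apply: cvgD; last exact: cvg_cst.
  exact: is_derive_continuous (dgt a t).
have cdd : continuous dd.
  move=> t; apply: cvg_big => [|a _]; first exact: add_continuous.
  apply: cvgM; last exact: (dg a).2.
  by apply: cvgM; [exact: cvg_cst|exact: ccoord].
have cD : continuous D.
  move=> t; apply: cvgN; apply: cvgM; last exact: cdd.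
  apply: cvgM; first exact: cvg_cst.
  apply/(@continuous_epsP R (fun t => Num.max (r ^+ 2 - dist2 (gam t)) 0) t) => e e0.
  have [dl dl0 hd] := (continuous_epsP _ _).1 (cdist t) e e0.
  exists dl => // y /hd h; apply: le_lt_trans (max0_lip _ _) _.
  by rewrite distrC (_ : _ - _ - (_ - _) = dist2 (gam y) - dist2 (gam t)) //; ring.
pose F t := bump (gam t) / C.
have dF (t : R) : is_derive t 1 F (D t / C).
  have db := dbump t; rewrite /F; apply: is_derive_eq; rewrite /GRing.scale /= ; ring.
have I : (\int[lebesgue_measure]_(t in `[0%R, 1%R]) (D t / C)%:E = (F 1)%:E - (F 0)%:E)%E.
  apply: continuous_FTC2 => //.
  - apply: continuous_subspaceT => t; apply: cvgM; [exact: cD|exact: cvg_cst].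
  - have cF : continuous F.
      by move=> t; exact: is_derive_continuous (dF t).
    split=> [t _||]; first by have [] := dF t.
    + by apply: cvg_at_right_filter; exact: cF.
    + by apply: cvg_at_left_filter; exact: cF.
  - by move=> t _; rewrite derive1E; exact: (derive_val (is_derive := dF t)).
have J : (`|(F 1)%:E - (F 0)%:E| <= path_length (realform g) gam)%E.
  rewrite -I; apply: le_trans (le_abse_integral _ _ _) _ => //.
    apply/measurable_EFinP; apply: measurable_funTS; apply: continuous_measurable_fun.
    move=> t; apply: cvgM; [exact: cD|exact: cvg_cst].
  apply: ge0_subset_integral_le => t; first by rewrite abse_ge0.
  rewrite /= in_itv /= => tI; rewrite lee_fin normrM normfV (gtr0_norm C0).
  by rewrite ler_pdivrMr // mulrC; exact: ddB.
have := le_lt_trans J lg; rewrite -EFinB lte_fin /F -mulrBl normrM normfV (gtr0_norm C0).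
by rewrite ltr_pdivrMr // g0 g1 mulrC => /ltW.
Qed.

End Barrier.

(** * Holomorphic Euler polygons *)

Section VectorDerivative.
Context {R : realType} {n : nat}.
Local Notation V := 'rV[R[i]]_n.

Definition cderV (F : R[i] -> V) (c : R[i]) (d : V) : Prop :=
  forall e, 0 < e -> exists2 dl, 0 < dl &
    forall w, nm w < dl -> nrm (F (c + w) - F c - w *: d) <= e * nm w.

Lemma cderV_coord F c d j : cderV F c d -> cder (fun w => F w 0 j) c (d 0 j).
Proof.
move=> H e /H[dl dl0 h]; exists dl => // w /h; apply: le_trans.
by have := nm_le_nrm (F (c + w) - F c - w *: d) j; rewrite !mxE (mulrC w).
Qed.

Lemma cderV_lip F c d : cderV F c d -> exists2 dl, 0 < dl &
  forall w, nm w < dl -> nrm (F (c + w) - F c) <= (nrm d + 1) * nm w.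
Proof.
move=> /(_ 1 ltr01) [dl dl0 H]; exists dl => // w /H h.
rewrite -(subrK (w *: d) (F (c + w) - F c)); apply: le_trans (nrmD _ _) _.
by rewrite mulrDl addrC lerD // (le_trans (nrmZ _ _)) // mulrC.
Qed.

Lemma cderV_cont F c d e : cderV F c d -> 0 < e -> exists2 dl, 0 < dl &
  forall w, nm w < dl -> nrm (F (c + w) - F c) < e.
Proof.
move=> /cderV_lip [dl dl0 H] e0.
have d0 : 0 < nrm d + 1 by rewrite ltr_wpDl ?nrm_ge0.
exists (Num.min dl (e / (nrm d + 1))); first by rewrite lt_min dl0 divr_gt0.
move=> w; rewrite lt_min => /andP[/H h1 h2]; apply: le_lt_trans h1 _.
by rewrite mulrC -ltr_pdivlMr.
Qed.

Lemma cderV_cst p c : cderV (fun=> p) c 0.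
Proof. by move=> e e0; exists 1 => // w _;
  rewrite subrr scaler0 subr0 nrm0 mulr_ge0 ?nm_ge0 // ltW. Qed.

Variable X : V -> V.

Lemma diff_nrm_bound z : differentiable X z -> exists2 B : R, 0 <= B & forall v, nrm ('d X z v)
  <= B * nrm v.
Proof.
move=> dX; exists (\sum_i nrm ('d X z (delta_mx 0 i : V))); first by apply: sumr_ge0 => i _;
  exact: nrm_ge0.
apply: linear_nrm_bound => i; rewrite (bigD1 i) //= lerDl.
by apply: sumr_ge0 => k _; exact: nrm_ge0.
Qed.

Definition euler_step (h : R) (F : R[i] -> V) (c : R[i]) : V :=
  real_line (F c) (c *: X (F c)) h.

Definition deuler_step (h : R) (F dF : R[i] -> V) (c : R[i]) : V :=
  dF c + h%:C *: (X (F c) + c *: 'd X (F c) (dF c)).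

(** The chain rule for [X \o F], then the product rule for its multiple by the complex time [c]. *)
Lemma cderV_euler_step h F dF c : cderV F c (dF c) -> differentiable X (F c) ->
  cderV (euler_step h F) c (deuler_step h F dF c).
Proof.
move=> HF dX; set d := dF c; set L := 'd X (F c) d.
have [B B0 HB] := diff_nrm_bound dX.
have HG : cderV (X \o F) c L.
  move=> e e0.
  have D0 : 0 < nrm d + 1 by rewrite ltr_wpDl ?nrm_ge0.
  have B1 : 0 < B + 1 by rewrite ltr_wpDl.
  have [d1 d10 H1] := HF (e / 2 / (B + 1)) ltac:(rewrite !divr_gt0 //; lra).
  have [d2 d20 H2] := differentiable_nrm dX (e := e / 2 / (nrm d + 1)) ltac:(rewrite !divr_gt0
    //; lra).
  have [d3 d30 H3] := cderV_lip HF.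
  have [d4 d40 H4] := cderV_cont HF d20.
  exists (Num.min d1 (Num.min d3 d4)) => [|w]; first by rewrite !lt_min d10 d30.
  rewrite !lt_min => /andP[w1 /andP[w3 w4]] /=.
  set u := F (c + w) - F c.
  have Eu : F (c + w) = F c + u by rewrite /u [RHS]addrC subrK.
  have EL : w *: L = 'd X (F c) u - 'd X (F c) (u - w *: d).
    have E : u - (u - w *: d) = w *: d by rewrite opprB addrCA subrr addr0.
    have EL : 'd X (F c) (w *: d) = w *: L by exact: linearZ.
    by rewrite -EL -{1}E linearB.
  have -> : X (F (c + w)) - X (F c) - w *: L =
     (X (F c + u) - X (F c) - 'd X (F c) u) + 'd X (F c) (u - w *: d).
    by rewrite Eu EL opprB addrA addrAC.
  apply: le_trans (nrmD _ _) _.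
  have h1 : nrm (X (F c + u) - X (F c) - 'd X (F c) u) <= e / 2 * nm w.
    apply: le_trans (H2 _ (H4 _ w4)) _.
    apply: (@le_trans _ _ (e / 2 / (nrm d + 1) * ((nrm d + 1) * nm w))).
      by rewrite ler_pM2l ?H3 // !divr_gt0 //; lra.
    by rewrite mulrA divfK ?gt_eqF.
  have h2 : nrm ('d X (F c) (u - w *: d)) <= e / 2 * nm w.
    apply: le_trans (HB _) _.
    apply: (@le_trans _ _ ((B + 1) * (e / 2 / (B + 1) * nm w))).
      by rewrite ler_pM ?nrm_ge0 ?H1 // lerDl.
    by rewrite mul_divK.
  move: h1 h2; lra.
move=> e e0.
have e2 : 0 < e / 2 by lra.
pose K := (`|h| + 1) * (nm c + 1).
have K0 : 0 < K by rewrite mulr_gt0 // ltr_wpDl ?nm_ge0.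
have [d1 d10 H1] := HF _ e2.
have [d2 d20 H2] := HG (e / 4 / K) ltac:(rewrite !divr_gt0 //; lra).
have h0 : 0 < `|h| + 1 by rewrite ltr_wpDl.
have [d3 d30 H3] := cderV_cont HG (e := e / 4 / (`|h| + 1)) ltac:(rewrite !divr_gt0 //; lra).
exists (Num.min d1 (Num.min d2 d3)) => [|w]; first by rewrite !lt_min d10 d20.
rewrite !lt_min => /andP[w1 /andP[w2 w3]].
have -> : euler_step h F (c + w) - euler_step h F c - w *: deuler_step h F dF c =
   (F (c + w) - F c - w *: d) + h%:C *: (c *: ((X \o F) (c + w) - (X \o F) c - w *: L) +
      w *: ((X \o F) (c + w) - (X \o F) c)).
  by rewrite /euler_step /deuler_step /real_line -/d -/L /=; apply/rowP => j; rewrite !mxE; ring.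
apply: le_trans (nrmD _ _) _; rewrite nrmZr.
have h1 := H1 w w1.
have h2 : nrm (c *: ((X \o F) (c + w) - (X \o F) c - w *: L)) <= (nm c + 1) * (e / 4 / K * nm w).
  by apply: le_trans (nrmZ _ _) _; rewrite ler_pM ?nm_ge0 ?nrm_ge0 ?H2 // lerDl.
have h3 : nrm (w *: ((X \o F) (c + w) - (X \o F) c)) <= nm w * (e / 4 / (`|h| + 1)).
  by apply: le_trans (nrmZ _ _) _; rewrite ler_wpM2l ?nm_ge0 // ltW // H3.
have h4 : `|h| * nrm (c *: ((X \o F) (c + w) - (X \o F) c - w *: L) +
      w *: ((X \o F) (c + w) - (X \o F) c)) <= e / 2 * nm w.
  apply: (@le_trans _ _ ((`|h| + 1) * ((nm c + 1) * (e / 4 / K * nm w) + nm w * (e / 4 / (`|h|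
    + 1))))).
    apply: ler_pM; rewrite ?nrm_ge0 ?lerDl //.
    by apply: le_trans (nrmD _ _) _; apply: lerD.
  rewrite mulrDr [X in X + _]mulrA mul_divK // (mulrC (nm w)) mul_divK //; lra.
move: h1 h4; lra.
Qed.

End VectorDerivative.

(** * Divergence of the total time, and vanishing of the field *)

Section EulerDiscs.
Context {R : realType} {n : nat}.
Local Notation V := 'rV[R[i]]_n.
Variables (Om : set V) (g : V -> 'M[R[i]]_n) (X : V -> V) (c0 : R).
Hypothesis oOm : open Om.
Hypothesis gC1 : forall i j, Ck 1 Om (fun z => complex.Re (g z i j)) /\
                             Ck 1 Om (fun z => complex.Im (g z i j)).
Hypothesis gH : forall z, Om z -> forall i j, g z j i = (g z i j)^*.
Hypothesis gpos : forall z, Om z -> forall u, u != 0 -> 0 < rf (g z) u u.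
Hypothesis dX : forall z, Om z -> differentiable X z.
Hypothesis c00 : 0 <= c0.
Hypothesis dsq_bound : forall z c, Om z ->
  `|dsqnorm g X z (c *: X z)| <= `|complex.Re c| * (c0 * (1 + sqnorm g X z)).
Hypothesis gcompl : complete_metric (realform g) Om.
Variable p : V.
Hypothesis Op : Om p.

Local Notation adm := (admissible Om g X c0).
Let pow2 (m : nat) : R := (2 ^+ m)^-1.

Let pow2_gt0 m : 0 < pow2 m. Proof. by rewrite invr_gt0 exprn_gt0. Qed.

Let pow2_small e : 0 < e -> exists N, forall m, (N <= m)%N -> pow2 m <= e.
Proof.
move=> e0; exists (Num.bound e^-1) => m Nm; rewrite /pow2 invf_ple ?posrE ?exprn_gt0 //.
have h : e^-1 < (Num.bound e^-1)%:R by apply: archi_boundP; rewrite invr_ge0 ltW.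
apply: (le_trans (ltW h)); rewrite -natrX ler_nat; apply: (leq_trans Nm); exact/ltnW/ltn_expl.
Qed.

(** Used twice: with a constant sequence it gives an admissible step at each stage, and with the
    polygons themselves it gives one step size for all late stages. Compactness of the square passes
    from [admissible_near] at the points [z0] to a uniform statement. *)
Lemma uniform_admissible (F : nat -> R[i] -> V) :
  (forall c, square c -> exists2 z0, Om z0 & forall rho, 0 < rho -> exists N, exists2 d, 0 < d &
     forall k c', (N <= k)%N -> square c' -> nm (c' - c) < d -> nrm (F k c' - z0) < rho) ->
  exists N, forall k m c, (N <= k)%N -> (N <= m)%N -> square c -> adm (F k c) c (pow2 m).
Proof.
move=> H.
pose K : set (R * R) := `[-1, 1]%classic `*` `[-1, 1]%classic.
have cK : compact K by apply: compact_setX; exact: segment_compact.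
have sqK (x : R * R) : K x <-> square (x.1 +i* x.2).
  rewrite /K /square /=; split.
    by case; rewrite /= !in_itv /= => h1 h2; rewrite !ler_norml.
  by case; rewrite !ler_norml => h1 h2; split; rewrite /= in_itv.
pose P (N : nat) (x : R * R) := forall k m, (N <= k)%N -> (N <= m)%N ->
  square (x.1 +i* x.2) -> adm (F k (x.1 +i* x.2)) (x.1 +i* x.2) (pow2 m).
have /compact_near_coveringP /(_ nat \oo P _) nc := cK.
have [|N _ hN] := nc _.
  move=> x /sqK sx; have [z0 Oz0 Hz] := H _ sx.
  have [d d0 hd] := admissible_near oOm gC1 gpos dX c00 dsq_bound Oz0.
  have [N [d' d'0 hN]] := Hz d d0; have [N' hN'] := pow2_small d0.
  exists ([set y : R * R | `|y.1 - x.1| < d' / 2 /\ `|y.2 - x.2| < d' / 2], [set i | (maxn N N'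
    <= i)%N]).
    split; last by exists (maxn N N').
    apply/nbhs_ballP; exists (d' / 2); first by rewrite /= divr_gt0.
    by move=> y [y1 y2]; split; [move: y1|move: y2]; rewrite /ball /= distrC.
  move=> [y i] /= [[y1 y2]]; rewrite geq_max => /andP[i1 i2] k m ik im sy.
  apply: hd => //; last by rewrite ltW // hN' // (leq_trans i2).
  apply: hN => //; first exact: leq_trans ik.
  by rewrite /nm /= ; lra.
exists N => k m [a b] Nk Nm sc.
by apply: (hN N (leqnn N) (a, b)) => //; apply/sqK.
Qed.

(** The smallest admissible exponent is the largest dyadic step. If none is admissible the value 0
    is taken, so [level] is total and the polygons can be defined before they are known to stay in
    [Om]. *)
Lemma level_ex (F : R[i] -> V) : exists m, forall m',
  (forall c, square c -> adm (F c) c (pow2 m')) ->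
  (forall c, square c -> adm (F c) c (pow2 m)) /\ (m <= m')%N.
Proof.
pose good m := forall c, square c -> adm (F c) c (pow2 m).
have [[m0 g0]|ng] := pselect (exists m, good m); last first.
  by exists 0%N => m' gm'; case: ng; exists m'.
have ex : exists m, `[< good m >] by exists m0; exact/asboolP.
exists (ex_minn ex); case: ex_minnP => m /asboolP gm mmin m' gm'; split=> //.
by apply: mmin; exact/asboolP.
Qed.

Definition level (F : R[i] -> V) : nat := projT1 (cid (level_ex F)).
Let levelP F : forall m', (forall c, square c -> adm (F c) c (pow2 m')) ->
  (forall c, square c -> adm (F c) c (pow2 (level F))) /\ (level F <= m')%N.
Proof. exact: projT2 (cid (level_ex F)). Qed.

(* Holomorphic Euler polygons for the complex time [c]: step [k] uses time [c h_k], where the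
   dyadic [h_k] is the largest one for which the step is admissible for all [c] in [square]. *)
Fixpoint disc (k : nat) : R[i] -> V :=
  if k is k'.+1 then euler_step X (pow2 (level (disc k'))) (disc k') else fun=> p.

Fixpoint ddisc (k : nat) : R[i] -> V :=
  if k is k'.+1 then deuler_step X (pow2 (level (disc k'))) (disc k') (ddisc k') else fun=> 0.

Definition time (k : nat) : R := \sum_(j < k) pow2 (level (disc j)).

Lemma timeS k : time k.+1 = time k + pow2 (level (disc k)).
Proof. by rewrite /time big_ord_recr. Qed.

Lemma time_lt k : time k < time k.+1.
Proof. by rewrite timeS ltrDl. Qed.

Lemma time_mono : {homo time : i j / (i <= j)%N >-> i <= j}.
Proof. by apply: homo_leq => //; [exact: le_trans|move=> k; exact/ltW/time_lt]. Qed.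

Lemma disc_admissible k :
  (forall c, square c -> Om (disc k c)) /\
  (forall c, square c -> cderV (disc k) c (ddisc k c)) /\
  (forall c, square c -> adm (disc k c) c (pow2 (level (disc k)))).
Proof.
have step F : (forall c, square c -> Om (F c)) -> (forall c, square c -> exists d, cderV F c d) ->
    forall c, square c -> adm (F c) c (pow2 (level F)).
  move=> FO Fd; have [|N hN] := @uniform_admissible (fun=> F).
    move=> c sc; exists (F c); first exact: FO.
    move=> rho rho0; have [d dd] := Fd c sc; have [dl dl0 h] := cderV_cont dd rho0.
    by exists 0%N, dl => // i c' _ _ /h; rewrite (addrC c) subrK.
  have [h _] := @levelP F N (fun c sc => hN N N c (leqnn N) (leqnn N) sc).
  exact: h.
elim: k => [|k [IO [Id Ia]]].
  have h1 c : square c -> Om (disc 0 c) by [].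
  have h2 c : square c -> cderV (disc 0) c (ddisc 0 c) by move=> _; exact: cderV_cst.
  by split=> //; split=> //; apply: step => // c sc; exists 0; exact: h2.
have h1 c : square c -> Om (disc k.+1 c).
  by move=> sc; have [A _] := Ia c sc; apply: (A _ _).1; rewrite lexx ltW.
have h2 c : square c -> cderV (disc k.+1) c (ddisc k.+1 c).
  by move=> sc; apply: cderV_euler_step; [exact: Id|apply: dX; exact: IO].
by split=> //; split=> //; apply: step => // c sc; eexists; exact: h2.
Qed.

(** At [c = 0] the polygon does not move, and in the derivative of a step the term containing the
    differential of [X] carries the factor [c]; only the multiples of [X p] accumulate. *)
Lemma disc0 k : disc k 0 = p /\ ddisc k 0 = (time k)%:C *: X p.
Proof.
elim: k => [|k [IH1 IH2]]; first by rewrite /time big_ord0 scale0r.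
rewrite /= /euler_step /deuler_step IH1 IH2 !scale0r addr0 /real_line scaler0 addr0; split=> //.
by rewrite -scalerDl -rmorphD timeS.
Qed.

Lemma disc_growth k c : square c ->
  1 + sqnorm g X (disc k c) <= (1 + sqnorm g X p) * expR ((2 * c0 + 1) * time k).
Proof.
move=> sc; elim: k => [|k IH]; first by rewrite /time big_ord0 mulr0 expR0 mulr1.
have [_ [_ Ia]] := disc_admissible k; have [_ A] := Ia c sc.
apply: (le_trans A); rewrite timeS [in leRHS](mulrDr (2 * c0 + 1)) expRD [leRHS]mulrA.
have a0 : 0 <= (2 * c0 + 1) * pow2 (level (disc k)).
  by apply: mulr_ge0; [rewrite addr_ge0 ?mulr_ge0|exact: ltW].
apply: ler_pM => //.
- have [IO _] := disc_admissible k; rewrite addr_ge0 //; exact: (rf_ge0 gpos _ (IO c sc)).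
- by rewrite addr_ge0.
- exact: expR_ge1Dx.
Qed.

Lemma time_unbounded T : exists k, T < time k.
Proof.
apply: contrapT => /forallNP nk.
have ub k : time k <= T by rewrite leNgt; apply/negP; exact: nk.
pose W := (1 + sqnorm g X p) * expR ((2 * c0 + 1) * T).
have W1 : 0 < 1 + sqnorm g X p by rewrite ltr_pwDl //; exact: (rf_ge0 gpos).
have W0 : 0 < W by rewrite mulr_gt0 ?expR_gt0.
have Wk k c : square c -> 1 + sqnorm g X (disc k c) <= W.
  move=> sc; apply: le_trans (disc_growth k sc) _; rewrite ler_pM2l // ler_expR.
  by rewrite ler_wpM2l // addr_ge0 ?mulr_ge0.
(* Admissibility bounds the squared speed on every edge by [3 * W]; the factor 2 is that of
   [resting_path_segment]. *)
pose B := 2 * Num.sqrt (3 * W); have B0 : 0 < B.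
  by rewrite mulr_gt0 // sqrtr_gt0 mulr_gt0.
have seg k c : square c ->
    resting_path Om g (disc k c) (disc k.+1 c) (B * (time k.+1 - time k)).
  move=> sc; have E : time k.+1 - time k = pow2 (level (disc k)).
    by rewrite timeS addrC addKr.
  rewrite E (_ : B * _ = 2 * pow2 (level (disc k)) * Num.sqrt (3 * W)); last by rewrite /B; ring.
  apply: resting_path_segment; first exact: ltW.
  move=> s sI; have [_ [_ Ia]] := disc_admissible k; have [A _] := Ia c sc.
  have [I1 I2] := A s sI; split=> //; apply: le_trans I2 _.
  by rewrite sqr_sqrtr ?ler_pM2l ?Wk // mulr_ge0 // ltW.
have pathS k j c : square c ->
    resting_path Om g (disc k c) (disc (k + j.+1) c) (B * (time (k + j.+1) - time k)).
  move=> sc; elim: j => [|j IH]; first by rewrite addn1; exact: seg.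
  have lt0 i m : (i < m)%N -> 0 < B * (time m - time i).
    by move=> im; rewrite mulr_gt0 // subr_gt0 (lt_le_trans (time_lt i)) // time_mono.
  have kj : (k < k + j.+1)%N by rewrite addnS ltnS leq_addr.
  have := resting_path_cat (lt0 _ _ kj) (lt0 _ _ (ltnSn _)) IH (seg (k + j.+1)%N c sc).
  by rewrite -mulrDr (addrC (_ - time k)) subrKA !addnS.
have dist_le k l c : square c -> (k <= l)%N ->
    (riem_dist (realform g) Om (disc k c) (disc l c) <= (B * (time l - time k))%:E)%E /\
    (riem_dist (realform g) Om (disc l c) (disc k c) <= (B * (time l - time k))%:E)%E.
  move=> sc kl; have rp : resting_path Om g (disc k c) (disc l c) (B * (time l - time k)).
    move: kl; rewrite leq_eqVlt => /predU1P[->|kl].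
      by apply: resting_path_refl; have [+ _] := disc_admissible l; apply.
    by have := pathS k (l - k.+1)%N c sc; rewrite addnS -addSn subnKC.
  have L0 : 0 <= B * (time l - time k) by rewrite mulr_ge0 ?(ltW B0) // subr_ge0 time_mono.
  by split; apply: riem_dist_resting => //; exact: resting_path_sym.
pose Ts := sup (range time).
have hs : has_sup (range time) by split; [exists (time 0), 0%N|exists T => _ [k _ <-]].
have tTs k : time k <= Ts by apply: ub_le_sup; [exact: hs.2|exists k].
have close e : 0 < e -> exists N, forall k l, (N <= k)%N -> B * (time l - time k) < e.
  move=> e0; have [_ [N _ <-] hN] := sup_adherent (divr_gt0 e0 B0) hs.
  exists N => k l Nk; rewrite mulrC -ltr_pdivlMr //.
  have := time_mono Nk; have := tTs l; rewrite -/Ts in hN; lra.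
have lim c : square c -> exists2 q, Om q & forall e : R, 0 < e -> exists N : nat, forall k : nat,
    (N <= k)%N -> (riem_dist (realform g) Om (disc k c) q < e%:E)%E.
  move=> sc; apply: gcompl => [k|e e0]; first by have [+ _] := disc_admissible k; apply.
  have [N hN] := close e e0; exists N => k l Nk Nl.
  have [kl|/ltnW lk] := leqP k l.
    by apply: le_lt_trans (dist_le k l c sc kl).1 _; rewrite lte_fin hN.
  by apply: le_lt_trans (dist_le l k c sc lk).2 _; rewrite lte_fin hN.
have [|N hN] := @uniform_admissible disc.
  move=> c sc; have [q Oq hq] := lim c sc; exists q => // rho rho0.
  (* Two barriers: the inner one places [disc m c] within [ka] of the limit [q]. Continuity of this
     single polygon carries that over to nearby [c'], and the outer barrier follows the path from
     [disc m c'] to [disc k c'] for all later [k]. *)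
  have [ka ka0 bar] := barrier gC1 gH gpos Oq rho0.
  have [ka2 ka20 bar2] := barrier gC1 gH gpos Oq ka0.
  have [N1 hN1] := hq _ ka20; have [N2 hN2] := close _ ka0.
  pose m := maxn N1 N2; exists m.
  have [gam [cg lg]] := riem_dist_path (hN1 m (leq_maxl _ _)).
  have mq : nrm (disc m c - q) < ka.
    by apply: (bar2 _ _ _ cg lg).2; rewrite subrr nrm0.
  have [_ [Id _]] := disc_admissible m.
  have [d d0 hd] := cderV_cont (Id c sc) (e := ka - nrm (disc m c - q)) ltac:(by rewrite
    subr_gt0).
  exists d => // k c' mk sc' /hd; rewrite (addrC c) subrK => h.
  have mq' : nrm (disc m c' - q) < ka.
    by have := nrm_triangle (disc m c) (disc m c') q; lra.
  have [|gam' [cg' lg']] := @riem_dist_path R n Om g (disc m c') (disc k c') ka.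
    by apply: le_lt_trans (dist_le m k c' sc' mk).1 _; rewrite lte_fin hN2 // leq_maxr.
  exact: (bar _ _ _ cg' lg').1.
(* The exponent [N] is admissible at every late stage, so minimality of [level] makes each late step
   at least [pow2 N], and the total time grows linearly. *)
have step k : (N <= k)%N -> pow2 N <= time k.+1 - time k.
  move=> Nk; have [_ le] := @levelP (disc k) N (fun c sc => hN k N c Nk (leqnn N) sc).
  rewrite timeS addrC addKr /pow2 lef_pV2 ?posrE ?exprn_gt0 //.
  by rewrite ler_weXn2l // ler1n.
have grow j : time N + j%:R * pow2 N <= time (N + j).
  elim: j => [|j IH]; first by rewrite mul0r addr0 addn0.
  have := step (N + j)%N (leq_addr _ _); rewrite addnS -natr1 mulrDl mul1r; lra.
have T0 : 0 <= T by have := ub 0%N; rewrite /time big_ord0.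
have := archi_boundP (divr_ge0 T0 (ltW (pow2_gt0 N))); rewrite ltr_pdivrMr // => h.
have := grow (Num.bound (T / pow2 N)); have := ub (N + Num.bound (T / pow2 N))%N.
have := time_mono (leq0n N); rewrite {1}/time big_ord0; lra.
Qed.

(** The Cauchy estimate bounds [time k * nm (X p 0 j)] by [8 * M] for every [k], while [time k] is
    unbounded. *)
Lemma bounded_complete_field_eq0 : (exists M : R, forall z, Om z -> nrm z <= M) -> X p = 0.
Proof.
move=> [M HM]; apply/rowP => j; rewrite mxE; apply: nm_eq0.
have M0 : 0 <= M by apply: le_trans (HM p Op); exact: nrm_ge0.
rewrite leNgt; apply/negP => x0.
have [k hk] := time_unbounded (8 * M / nm (X p 0 j)).
have [IO [Id _]] := disc_admissible k.
have := @cauchy_estimate R (fun c => disc k c 0 j) (fun c => ddisc k c 0 j) M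
  (fun c sc => cderV_coord j (Id c sc))
  (fun c sc => le_trans (nm_le_nrm _ _) (HM _ (IO c sc))).
rewrite (disc0 k).2 mxE nmMr ger0_norm; last first.
  by have := time_mono (leq0n k); rewrite {1}/time big_ord0.
by rewrite leNgt -ltr_pdivrMr // hk.
Qed.

End EulerDiscs.

(** * The growth bound for the length of the field, and the conclusion *)

Section FieldEquation.
Context {R : realType} {n : nat}.
Local Notation V := 'rV[R[i]]_n.
Variables (Om K : set V) (g : V -> 'M[R[i]]_n) (X : V -> V) (lam C1 C2 : R).
Hypothesis oOm : open Om.
Hypothesis gC1 : forall i j, Ck 1 Om (fun z => complex.Re (g z i j)) /\
                             Ck 1 Om (fun z => complex.Im (g z i j)).
Hypothesis gH : forall z, Om z -> forall i j, g z j i = (g z i j)^*.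
Hypothesis gpos : forall z, Om z -> forall u, u != 0 -> 0 < rf (g z) u u.
Hypothesis dX : forall z, Om z -> differentiable X z.
Hypothesis sol : forall z, Om z -> forall u v,
  realform (ricci g) z u v + lie_derivative X (realform g) z u v = lam * realform g z u v.
Hypothesis clX : closed_1form Om (flat (realform g) X).
Hypotheses (cK : compact K) (KOm : K `<=` Om) (C1_gt0 : 0 < C1) (C1C2 : C1 <= C2).
Hypothesis ric_bnd : forall z, (Om `\` K) z -> forall u,
  - C2 * realform g z u u <= realform (ricci g) z u u <= - C1 * realform g z u u.

(** On [K] the combination [lam * sqnorm - Ric(X, X)] is bounded through its other expression, the
    derivative of |X|^2 along X, which involves only first derivatives of [g] and [X]. *)
Lemma dsqnorm_bounded_on_compact : exists N : nat, forall z, K z -> `|dsqnorm g X z (X z)| <=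
  N%:R.
Proof.
pose P (N : nat) (x : V) := `|dsqnorm g X x (X x)| <= N%:R.
have /compact_near_coveringP /(_ nat \oo P _) nc := cK.
have [|N _ hN] := nc _; last by exists N => z Kz; exact: (hN N (leqnn N) z Kz).
move=> x /KOm Ox; have [B [d [B0 d0 H]]] := local_bounds oOm gC1 dX Ox.
pose N := Num.bound (B * B).
exists ([set y | nrm (y - x) < d], [set i | (N <= i)%N]); first split.
- by apply/nbhs_nrm; exists d.
- by exists N.
move=> [y i] [/= yd Ni]; have [_ XB _ hd] := H y yd.
apply: le_trans (hd _) _; apply: (@le_trans _ _ (B * B)); first by rewrite ler_pM2l.
have h : B * B < N%:R by apply: archi_boundP; rewrite mulr_ge0 // ltW.
by apply: (le_trans (ltW h)); rewrite ler_nat.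
Qed.

Lemma dsqnorm_bounded : exists2 c0, 0 <= c0 & forall z c, Om z ->
  `|dsqnorm g X z (c *: X z)| <= `|complex.Re c| * (c0 * (1 + sqnorm g X z)).
Proof.
have [N hN] := dsqnorm_bounded_on_compact.
have C20 : 0 < C2 by apply: lt_le_trans C1C2.
have l0 := normr_ge0 lam; have N0 : 0 <= N%:R :> R by [].
(* [N] serves on [K], and [|lam| + C2] outside, where [Ric(X, X)] lies between [- C2 * |X|^2] and
   0. *)
exists (N%:R + (`|lam| + C2)); first by rewrite !addr_ge0 // ltW.
move=> z c Oz; rewrite (dsqnorm_zetaX oOm gC1 gH dX sol clX c Oz) normrM ler_wpM2l //.
have s0 : 0 <= sqnorm g X z by exact: (rf_ge0 gpos).
have a0 : 0 <= N%:R * sqnorm g X z by rewrite mulr_ge0.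
have b0 : 0 <= (`|lam| + C2) * sqnorm g X z by rewrite mulr_ge0 // addr_ge0 // ltW.
have b1 : 0 <= `|lam| + C2 by rewrite addr_ge0 // ltW.
have [Kz|nKz] := pselect (K z).
  have := hN z Kz; rewrite (dsqnorm_X oOm gC1 dX sol Oz) => /le_trans; apply.
  rewrite mulrDr mulr1 mulrDl; lra.
have /andP[r1 r2] := ric_bnd (conj Oz nKz) (X z).
apply: le_trans (ler_normB _ _) _; rewrite normrM (ger0_norm s0).
have : `|realform (ricci g) z (X z) (X z)| <= C2 * sqnorm g X z.
  rewrite ler_norml -mulNr r1 /=; apply: le_trans r2 _.
  apply: (@le_trans _ _ 0); last by rewrite mulr_ge0 // ltW.
  by rewrite mulNr oppr_le0 mulr_ge0 // ltW.
rewrite mulrDr mulr1 mulrDl; lra.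
Qed.

End FieldEquation.

Lemma dX_eq0 (R : realType) (n : nat) (Om : set 'rV[R[i]]_n) (X : 'rV[R[i]]_n -> 'rV[R[i]]_n) z
  u :
  open Om -> Om z -> differentiable X z -> (forall y, Om y -> X y = 0) -> 'd X z u = 0.
Proof.
move=> oOm Oz dX X0; apply: nrm_eq0; apply/ler_addgt0Pr => e e0; rewrite add0r.
have [d0 d00 HO] := open_nrm oOm Oz.
have u0 : 0 < nrm u + 1 by rewrite ltr_wpDl ?nrm_ge0.
have [d d_gt0 H] := differentiable_nrm dX (divr_gt0 e0 u0).
pose t := Num.min d0 d / 2 / (nrm u + 1).
have t0 : 0 < t by rewrite !divr_gt0 // lt_min d00.
have tu : nrm (t%:C *: u) < Num.min d0 d.
  rewrite nrmZr gtr0_norm //; apply: (@le_lt_trans _ _ (t * (nrm u + 1))).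
    by rewrite ler_pM2l // lerDl.
  by rewrite /t divfK ?gt_eqF //; have : 0 < Num.min d0 d by [rewrite lt_min d00]; lra.
move: (tu); rewrite lt_min => /andP[td0 td].
have := H _ td; rewrite X0; last by apply: HO; rewrite addrC addKr.
rewrite X0 // subrr sub0r nrmN.
have -> : 'd X z (t%:C *: u) = t%:C *: 'd X z u by exact: linearZ.
rewrite !nrmZr !gtr0_norm // mulrCA ler_pM2l // => h; apply: le_trans h _.
by rewrite mulrAC ler_pdivrMr // ler_pM2l // lerDl.
Qed.

Theorem theorem1p2 (R : realType) (n : nat) (hn : (0 < n)%N)
    (Om : set 'rV[R[i]]_n) (g : 'rV[R[i]]_n -> 'M[R[i]]_n)
    (K : set 'rV[R[i]]_n) (C1 C2 : R) (X : 'rV[R[i]]_n -> 'rV[R[i]]_n)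
    (dom_Om : domain Om) (bnd_Om : bounded_set Om)
    (psc_Om : pseudoconvex Om) (C2_Om : C2_boundary Om)
    (kg : kaehler_metric Om g) (compl_g : complete_metric (realform g) Om)
    (bg_g : bounded_geometry 1 (realform g) Om)
    (cK : compact K) (KOm : K `<=` Om) (C1_gt0 : 0 < C1) (C1C2 : C1 <= C2)
    (ric_bnd : forall z, (Om `\` K) z -> forall u,
       - C2 * realform g z u u <= realform (ricci g) z u u
         <= - C1 * realform g z u u)
    (hX : real_holomorphic Om X) (sol : kaehler_ricci_soliton Om g X)
    (clX : closed_1form Om (flat (realform g) X)) :
  kaehler_einstein Om g.
Proof.
have [_ oOm _] := dom_Om; have [sg gH gpos _] := kg; have [lam sol'] := sol.
have gC1 i j : Ck 1 Om (fun z => complex.Re (g z i j)) /\ Ck 1 Om (fun z => complex.Im (g z i j)).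
  by have [a b] := sg i j; split; [exact: a|exact: b].
have [c0 c00 dsq] := dsqnorm_bounded oOm gC1 gH gpos hX sol' clX cK KOm C1_gt0 C1C2 ric_bnd.
have bd : exists M : R, forall z, Om z -> nrm z <= M.
  have [M0 [/complex_realP[r ->] HM]] := bnd_Om.
  exists ((n * 2)%:R * (r + 1)) => z Oz; rewrite -lecR.
  have -> : ((n * 2)%:R * (r + 1))%:C = (n * 2)%:R * (r + 1)%:C :> R[i].
    by rewrite -[(n * 2)%:R in RHS](rmorph_nat (real_complex R)) -rmorphM.
  apply: le_trans (nrm_normr z) _; rewrite ler_wpM2l ?ler0n //.
  (* Boundedness provides the estimate only for constants strictly above [r], hence [r + 1]. *)
  by apply: HM Oz; rewrite ltcR ltrDl.
have X0 y : Om y -> X y = 0.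
  by move=> Oy; exact: (bounded_complete_field_eq0 oOm gC1 gH gpos hX c00 dsq compl_g Oy bd).
(* The Einstein constant is that of the soliton. The Lie derivative contains the field and its
   differential at [z], and both vanish because [X] is zero on the open set [Om]. *)
exists lam => z Oz; apply: rf_inj => u v; rewrite rfZm -!realformE -sol' //.
have d0 w : 'd X z w = 0 by exact: (dX_eq0 w oOm Oz (hX z Oz) X0).
rewrite /lie_derivative (dirD_realform oOm gC1) // !(dirDV_holo hX) // !d0 X0 // !realformE.
have -> : dmetric g z 0 = 0 by rewrite -[X in dmetric g z X](scale0r 0) dmetricZ scale0r.
by rewrite rf0l rf0r -(scale0r (0 : 'M[R[i]]_n)) rfZm mul0r !addr0.
Qed.
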